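(* For every integer $n \ge 2$, there exist a pseudoconvex domain $\Omega \subset \mathbb{C}^n$ and a nonempty open set $\omega \subset \Omega$ such that the following assertions hold true: (1) There exists a function $\varphi \in \mathcal{PSH}(\Omega) \cap \mathcal{C}^0(\Omega)$ such that $\varphi < 0$ on $\Omega$ and $\varphi$ is strictly plurisubharmonic on $\omega$. (2) Every function $\varphi \in \mathcal{PSH}(\Omega) \cap \mathcal{C}^1(\Omega)$ such that $\varphi < 0$ on $\Omega$ is constant on $\omega$. In particular, $\mathfrak{c}^0(\Omega) \neq \mathfrak{c}^1(\Omega)$.
   Context: For a domain $\Omega \subset \mathbb{C}^n$, $\mathcal{PSH}(\Omega)$ denotes the set of plurisubharmonic functions on $\Omega$, and $\mathcal{PSH}^k(\Omega) := \mathcal{PSH}(\Omega) \cap \mathcal{C}^k(\Omega)$ for $k \in \{0,1\}$. A function $\varphi \colon \Omega \to [-\infty, \infty)$, $\varphi \not\equiv -\infty$, is called strictly plurisubharmonic if for every $\mathcal{C}^\infty$-smooth function $\theta \colon \Omega \to \mathbb{R}$ with compact support there exists a constant $\varepsilon_0 > 0$ such that for all $\varepsilon \in (-\varepsilon_0, \varepsilon_0)$ the function $\varphi + \varepsilon\theta$ is plurisubharmonic on $\Omega$. The same definition is applied on open subsets: $\varphi$ is strictly plurisubharmonic on an open set $U \subset \Omega$ if its restriction to $U$ satisfies this condition with $U$ in place of $\Omega$. We say that $\varphi$ is strictly plurisubharmonic near a point $z \in \Omega$ if $\varphi$ is strictly plurisubharmonic on some open neighborhood $U \subset \Omega$ of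 $z$. For $k \in \{0,1\}$, the core $\mathfrak{c}^k(\Omega)$ is the set of all $z \in \Omega$ such that every function $\varphi \in \mathcal{PSH}^k(\Omega)$ that is bounded from above fails to be strictly plurisubharmonic near $z$. *)

(* Defs.v *)
From mathcomp Require Import all_boot all_order all_algebra.
From mathcomp Require Import complex.
From mathcomp Require Import all_classical all_reals all_analysis.

Set Implicit Arguments.
Unset Strict Implicit.
Unset Printing Implicit Defensive.

Import Order.TTheory GRing.Theory Num.Theory.
Import numFieldNormedType.Exports.

Local Open Scope classical_set_scope.
Local Open Scope ring_scope.
Local Open Scope complex_scope.

(* The regular algebra [R[i]^o] has the carrier [R[i]]; it is used because it
   is the one that carries the topology.  A function on an open set [U] is
   encoded as a total function; every notion below that is relative to an open
   [U] depends only on the values of the function on [U]. *)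
Notation Cspace R n := 'rV[R[i]^o]_n.

Section RealRegularity.
Context {R : realType} {n : nat}.
Implicit Types (U : set (Cspace R n)) (f : Cspace R n -> R).

(* Writing z_j = x_j + i y_j, [real_dir false j] is the direction of x_j and
   [real_dir true j] that of y_j. *)
Definition real_dir (b : bool) (j : 'I_n) : Cspace R n :=
  (if b then 'i%C else 1) *: delta_mx 0 j.

Definition along (b : bool) (j : 'I_n) f (z : Cspace R n) : R -> R :=
  fun t => f (z + t%:C *: real_dir b j).

Definition partial (b : bool) (j : 'I_n) f : Cspace R n -> R :=
  fun z => derive1 (along b j f z) 0.

(* C^k in the sense of the 2n real coordinates. *)
Fixpoint Ck (k : nat) U f : Prop :=
  (forall z, U z -> {for z, continuous f}) /\
  match k with
  | 0%N => True
  | k'.+1 => forall b j,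
      (forall z, U z -> derivable (along b j f z) 0 1) /\ Ck k' U (partial b j f)
  end.

Definition Cinfty U f : Prop := forall k, Ck k U f.

(* The support is taken relative to U. *)
Definition compact_support U f : Prop :=
  compact (U `&` closure [set z | U z /\ f z != 0]).

End RealRegularity.

Section Plurisubharmonic.
Context {R : realType}.

Definition usc_on (T : topologicalType) (U : set T) (u : T -> \bar R) : Prop :=
  forall z, U z -> forall c : R, (u z < c%:E)%E -> \forall y \near z, (u y < c%:E)%E.

Definition circle_point (a : R[i]) (r t : R) : R[i] :=
  a + r%:C * (cos t +i* sin t)%C.

Definition circle_mean (u : R[i]^o -> \bar R) (a : R[i]) (r : R) : \bar R :=
  (((2 * pi)^-1)%:E *
   \int[lebesgue_measure]_(t in `[0%R, (2 * pi)%R]) u (circle_point a r t))%E.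

(* The function identically -oo counts as (pluri)subharmonic. *)
Definition subharmonic (V : set R[i]^o) (u : R[i]^o -> \bar R) : Prop :=
  [/\ forall z, V z -> (u z < +oo)%E,
      usc_on V u &
      forall (a : R[i]) (r : R), 0 < r ->
        [set z : R[i]^o | `|z - a| <= r%:C] `<=` V ->
        (u a <= circle_mean u a r)%E].

Definition psh (n : nat) (U : set (Cspace R n)) (phi : Cspace R n -> \bar R) : Prop :=
  [/\ forall z, U z -> (phi z < +oo)%E,
      usc_on U phi &
      forall z w : Cspace R n,
        subharmonic [set l : R[i]^o | U (z + l *: w)] (fun l => phi (z + l *: w))].

Definition pshk (n k : nat) (U : set (Cspace R n)) (phi : Cspace R n -> R) : Prop :=
  psh U (fun z => (phi z)%:E) /\ Ck k U phi.

Definition strictly_psh (n : nat) (U : set (Cspace R n))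
    (phi : Cspace R n -> \bar R) : Prop :=
  (forall z, U z -> (phi z < +oo)%E) /\
  (exists2 z, U z & phi z != -oo%E) /\
  forall theta : Cspace R n -> R, Cinfty U theta -> compact_support U theta ->
    exists2 e0 : R, 0 < e0 &
      forall e : R, - e0 < e < e0 ->
        psh U (fun z => (phi z + (e * theta z)%:E)%E).

Definition strictly_psh_near (n : nat) (Omega : set (Cspace R n))
    (phi : Cspace R n -> \bar R) (z : Cspace R n) : Prop :=
  exists U : set (Cspace R n), [/\ open U, U z, U `<=` Omega & strictly_psh U phi].

Definition domain (n : nat) (Omega : set (Cspace R n)) : Prop :=
  [/\ Omega !=set0, open Omega & connected Omega].

(* Existence of a continuous plurisubharmonic exhaustion function. *)
Definition pseudoconvex (n : nat) (Omega : set (Cspace R n)) : Prop :=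
  exists2 rho : Cspace R n -> R, pshk 0 Omega rho &
    forall c : R, let S := [set z | Omega z /\ rho z < c] in
      compact (closure S) /\ closure S `<=` Omega.

Definition core (n k : nat) (Omega : set (Cspace R n)) : set (Cspace R n) :=
  [set z | Omega z /\
     forall phi : Cspace R n -> R, pshk k Omega phi ->
       (exists M : R, forall x, Omega x -> phi x <= M) ->
       ~ strictly_psh_near Omega (fun x => (phi x)%:E) z].

End Plurisubharmonic.

(* Main.v *)
(** Write x = (z, w, x_2, ...).  The poles a_j, with |a_j| = 1 + 2^-(j+2),
    accumulate at every point of the unit circle.  Omega is a component of
    an increasing union of sublevel sets {F_m < 0}, where F_m is a decreasing
    sequence of maxima of truncated logarithms, and it contains a polydisc about
    the origin, the complex line {w = 1, x_k = 0} and all the hyperplanes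
    {z = a_j}.  By Liouville's theorem a plurisubharmonic function that is
    bounded above takes one and the same value c on that line and on those
    hyperplanes, hence, when it is continuous, on the circle |z| = 1 of every
    slice through the polydisc.  If it is C^1, its normal derivative at z = 1
    vanishes because infinitely many of the a_j are real, and the Hopf boundary
    lemma forces the slice to be constant.

    Conversely, for |w| < 1/2 the domain is contained, outside small discs
    |z - a_j| < r_j, in {|w| <= 1/4}.  The function |z|^2 on the unit disc
    extends continuously to a subharmonic function psi of z with psi <= 1 on
    those discs, so max(1, psi) can be continued by the constant 1 through
    the necks 1/4 < |w| < 1/2.  Near the origin |z|^2 may be replaced by
    its maximum with a small multiple of 1 + |x|^2. *)
Require Import Defs.
From mathcomp Require Import all_boot all_order all_algebra.
From mathcomp Require Import complex.
From mathcomp Require Import all_classical all_reals all_analysis.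
From mathcomp Require Import ring lra.

Set Implicit Arguments.
Unset Strict Implicit.
Unset Printing Implicit Defensive.

Import Order.TTheory GRing.Theory Num.Theory.
Import numFieldNormedType.Exports.
Import Normc.

Local Open Scope classical_set_scope.
Local Open Scope ring_scope.
Local Open Scope complex_scope.

(** * Means over a period and over circles *)

(** The two assertions pull in opposite directions. Rigidity needs whole hyperplanes z = a_j inside
    Omega, while the function of assertion (1) survives only if the passages so opened are confined
    to discs where psi <= 1. Hence the order of the choices: the gaps 2^-(j+2); then the dents cut
    into |z|^2 around the poles, whose depth dictates the radii r_j; last the weights of the
    logarithmic poles, so small that their sum stays bounded below off all the discs.

    psi is an average, with weights 2^-(j+1) of total mass 1, of the functions |z|^2 minus one dent
    each. The j-th weight is twice the j-th gap, which lets the dent outweigh the excess of |z|^2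
    over 1 near a_j.

    On a slice through the polydisc the resulting function has slope 2 on the inner side of z = 1
    but returns to 1 or less in psi at real poles tending to 1; this kink is what C^1 excludes.

    Truncating the logarithms keeps every F_m finite and continuous, and a margin 2^-(m+1) between
    consecutive F_m prevents limit points from escaping the union. The cores are told apart at the
    origin, where a C^1 function bounded above is locally constant and so not strictly
    plurisubharmonic. *)

Section PeriodMean.
Context {R : realType}.
Implicit Types (g h G : R -> R) (M s : R).
Notation mu := (@lebesgue_measure R).

Lemma pi2_gt0 : 0 < 2 * pi :> R.
Proof. by rewrite mulr_gt0 ?ltr0n ?pi_gt0. Qed.

Lemma continuous_integrable g (a b : R) : continuous g ->
  mu.-integrable `[a, b] (EFin \o g).
Proof.
move=> cg; apply: continuous_compact_integrable; first exact: segment_compact.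
exact: continuous_subspaceT.
Qed.

(** The primitive is based at -M; M is taken large enough each time for the translated or doubled
    period to stay inside the interval. *)
Lemma continuous_primitive g M : continuous g ->
  exists G : R -> R, forall x : R, `|x| < M -> is_derive x 1 G (g x).
Proof.
move=> cg; exists (fun x => \int[mu]_(t in `[- M, x]) g t) => x.
rewrite ltr_norml => /andP[Mx xM].
have [dG GE] := continuous_FTC1_closed xM (continuous_integrable _ _ cg) Mx (cg x).
apply: DeriveDef; first exact: dG.
by rewrite -derive1E GE.
Qed.

Lemma is_derive_within G g (a b : R) M : (forall x : R, `|x| < M -> is_derive x 1 G (g x)) ->
  - M < a -> b < M -> {within `[a, b], continuous G}.
Proof.
move=> dG Ma bM; apply: derivable_within_continuous => x.
rewrite in_itv/= => /andP[ax xb].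
have : `|x| < M by rewrite ltr_norml (lt_le_trans Ma ax) (le_lt_trans xb bM).
by move/dG => [].
Qed.

Lemma is_derive0_cst (H : R -> R) M : (forall x : R, `|x| < M -> is_derive x 1 H 0) ->
  forall x y, `|x| < M -> `|y| < M -> H x = H y.
Proof.
move=> dH x y; wlog xy : x y / x <= y.
  move=> W; have [xy|/ltW yx] := leP x y; first exact: W.
  by move=> ? ?; symmetry; apply: W.
rewrite !ltr_norml => /andP[Mx xM] /andP[My yM].
have [|c _ E] := @MVT_segment _ H (fun=> 0) x y xy _ (is_derive_within dH Mx yM).
  move=> z; rewrite in_itv/= => /andP[xz zy]; apply: dH.
  by rewrite ltr_norml (lt_trans Mx xz) (lt_trans zy yM).
by apply/eqP; rewrite eq_sym -subr_eq0 E mul0r.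
Qed.

Definition pmean g : R := (2 * pi)^-1 * \int[mu]_(t in `[0, 2 * pi]) g t.

Lemma pmeanE g G M : continuous g -> 2 * pi < M ->
  (forall x : R, `|x| < M -> is_derive x 1 G (g x)) ->
  pmean g = (2 * pi)^-1 * (G (2 * pi) - G 0).
Proof.
move=> cg ltM dG; rewrite /pmean /Rintegral.
have p0 := pi2_gt0.
have dG' (x : R) : x \in `]0, 2 * pi[ -> is_derive x 1 G (g x).
  rewrite in_itv/= => /andP[x0 xp]; apply: dG.
  by rewrite ger0_norm ?ltW// (lt_trans xp).
have cG x : `|x| < M -> G y @[y --> x] --> G x.
  by move=> /dG [dx _]; apply/differentiable_continuous/derivable1_diffP.
rewrite (@continuous_FTC2 _ g G) //.
- exact: continuous_subspaceT.
- split.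
  + by move=> x /dG' [].
  + by apply: cvg_at_right_filter; apply: cG; rewrite normr0 (lt_trans p0).
  + by apply: cvg_at_left_filter; apply: cG; rewrite gtr0_norm.
- by move=> x /dG' [dx <-]; rewrite derive1E.
Qed.

Definition periodic2pi g := forall t, g (t + 2 * pi) = g t.

Lemma shift_continuous g s : continuous g -> continuous (fun t => g (t + s)).
Proof.
move=> cg t; apply: (@continuous_comp _ _ _ (fun t => t + s) g); last exact: cg.
by apply: cvgD; [exact: cvg_id|exact: cvg_cst].
Qed.

(** The increment of G over a period has derivative g (x + 2 pi) - g x = 0. *)
Lemma primitive_period g G M : periodic2pi g ->
  (forall x : R, `|x| < M -> is_derive x 1 G (g x)) -> forall x y,
  `|x| < M - 2 * pi -> `|y| < M - 2 * pi ->
  G (x + 2 * pi) - G x = G (y + 2 * pi) - G y.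
Proof.
move=> pg dG x y xM yM.
apply: (@is_derive0_cst (fun x => G (x + 2 * pi) - G x) (M - 2 * pi)) => // z zM.
have p0 := pi2_gt0.
have d1 : is_derive z 1 G (g z) by apply: dG; apply: lt_le_trans zM _; lra.
have d2 : is_derive (z + 2 * pi) 1 G (g z).
  rewrite -(pg z); apply: dG; apply: le_lt_trans (ler_normD _ _) _.
  by rewrite (gtr0_norm p0); lra.
have d3 : is_derive z 1 (G \o (fun x => x + 2 * pi)) (g z).
  have : is_derive z 1 (fun x : R => x + 2 * pi) (1 + 0) by apply: is_deriveD.
  rewrite addr0 => d; rewrite -[g z]mulr1.
  exact: is_derive1_comp.
have : is_derive z 1 (G \o (fun x => x + 2 * pi) - G) (g z - g z) by apply: is_deriveB.
by rewrite subrr.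
Qed.

Lemma pmean_shift g s : continuous g -> periodic2pi g ->
  pmean (fun t => g (t + s)) = pmean g.
Proof.
move=> cg pg; have p0 := pi2_gt0.
pose M : R := 2 * pi + 2 * pi + 1 + `|s|.
have s0 := normr_ge0 s.
have [G dG] := continuous_primitive M cg.
have dGs (x : R) : `|x| < 2 * pi + 1 -> is_derive x 1 (fun t => G (t + s)) (g (x + s)).
  move=> xM.
  have d2 : is_derive (x + s) 1 G (g (x + s)).
    apply: dG; apply: le_lt_trans (ler_normD _ _) _; rewrite /M; lra.
  have : is_derive x 1 (fun x : R => x + s) (1 + 0) by apply: is_deriveD.
  rewrite addr0 => d; rewrite -[g _]mulr1.
  exact: is_derive1_comp.
have -> := pmeanE (shift_continuous cg) _ dGs; last by rewrite ltrDl.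
have -> := pmeanE cg _ dG; last by rewrite /M; lra.
have := primitive_period pg dG (x := s) (y := 0).
rewrite normr0 !add0r [2 * pi + s]addrC => -> //; first by rewrite /M; lra.
by rewrite /M; lra.
Qed.

Lemma pmean_double g : continuous g -> periodic2pi g ->
  pmean (fun t => g (2 * t)) = pmean g.
Proof.
move=> cg pg; have p0 := pi2_gt0.
pose M : R := 4 * (2 * pi) + 2.
have [G dG] := continuous_primitive M cg.
have dG2 (x : R) : `|x| < 2 * pi + 1 ->
    is_derive x 1 (fun t => 2^-1 * G (2 * t)) (g (2 * x)).
  move=> xM.
  have d2 : is_derive (2 * x) 1 G (g (2 * x)).
    by apply: dG; rewrite normrM ger0_norm// /M; lra.
  have d : is_derive x 1 (fun x : R => 2 * x) 2.
    have : is_derive x 1 (fun x : R => 2 *: x) (2 *: 1) by apply: is_deriveZ.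
    by rewrite [2 *: 1]mulr1.
  have d3 := is_derive1_comp d2 d.
  have : is_derive x 1 (2^-1 *: (G \o (fun x => 2 * x))) (2^-1 *: (g (2 * x) * 2)).
    by apply: is_deriveZ.
  by rewrite [_ *: (_ * _)](_ : _ = g (2 * x))// [LHS]mulrC -mulrA divff ?mulr1.
have c2 : continuous (fun t : R => g (2 * t)).
  move=> t; apply: (@continuous_comp R R R (fun t => 2 * t) g); last exact: cg.
  exact: (@mulrl_continuous R 2 t).
have -> := pmeanE c2 _ dG2; last by rewrite ltrDl.
have -> := pmeanE cg _ dG; last by rewrite /M; lra.
congr (_ * _); rewrite mulr0 -mulrBr.
have E := primitive_period pg dG (x := 2 * pi) (y := 0).
rewrite normr0 (gtr0_norm p0) add0r in E.
have -> : 2 * (2 * pi) = 2 * pi + 2 * pi :> R by ring.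
have := E ltac:(rewrite /M; lra) ltac:(rewrite /M; lra).
lra.
Qed.

Lemma pmean_cst (k : R) : pmean (fun=> k) = k.
Proof.
rewrite /pmean Rintegral_cst//= lebesgue_measure_itv/= lte_fin pi2_gt0 oppr0 adde0/=.
by rewrite mulrCA mulVf ?mulr1// gt_eqF// pi2_gt0.
Qed.

Lemma pmeanD g h : continuous g -> continuous h ->
  pmean (fun t => g t + h t) = pmean g + pmean h.
Proof.
by move=> cg ch; rewrite /pmean RintegralD ?mulrDr//; exact: continuous_integrable.
Qed.

Lemma pmeanZ g (k : R) : continuous g -> pmean (fun t => k * g t) = k * pmean g.
Proof.
by move=> cg; rewrite /pmean RintegralZl ?(mulrCA _ k)//; exact: continuous_integrable.
Qed.

Lemma le_pmean g h : continuous g -> continuous h ->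
  (forall t, 0 <= t <= 2 * pi -> g t <= h t) -> pmean g <= pmean h.
Proof.
move=> cg ch gh; apply: ler_wpM2l; first by rewrite invr_ge0 ltW// pi2_gt0.
apply: le_Rintegral => //; try exact: continuous_integrable.
Qed.

Lemma pmean_sum (n : nat) (F : nat -> R -> R) : (forall j, continuous (F j)) ->
  continuous (fun t => \sum_(j < n) F j t) /\
  pmean (fun t => \sum_(j < n) F j t) = \sum_(j < n) pmean (F j).
Proof.
move=> cF; elim: n => [|n [c E]].
  have -> : (fun t => \sum_(j < 0) F j t) = fun=> 0.
    by apply/funext => t; rewrite big_ord0.
  by rewrite big_ord0 pmean_cst; split => // t; exact: cvg_cst.
have -> : (fun t => \sum_(j < n.+1) F j t) = (fun t => \sum_(j < n) F j t + F n t).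
  by apply/funext => t; rewrite big_ord_recr.
rewrite pmeanD// E big_ord_recr/=; split => // t.
by apply: cvgD; [exact: c|exact: cF].
Qed.

(** With G a primitive, c x - G x is nondecreasing, and the bound on the mean says that it does not
    grow over a period. It is therefore constant and its derivative vanishes. *)
Lemma pmean_max_eq g (c : R) : continuous g -> periodic2pi g -> (forall t, g t <= c) ->
  c <= pmean g -> forall t, g t = c.
Proof.
move=> cg pg gc cm t0; have p0 := pi2_gt0.
(* The translation moves t0 to 1, an interior point of the period, where a derivative can be
   taken. *)
pose h t := g (t + (t0 - 1)).
have ch : continuous h by exact: shift_continuous.
have mh : c <= pmean h by rewrite pmean_shift.
have p1 : 1 < 2 * pi :> R by have := pi_ge2 R; lra.
suff : h 1 = c by rewrite /h addrC subrK.
pose M : R := 2 * pi + 1.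
have [G dG] := continuous_primitive M ch.
have E : c * (2 * pi) <= G (2 * pi) - G 0.
  move: mh; have -> := pmeanE ch _ dG; last by rewrite ltrDl.
  by rewrite ler_pdivlMl// mulrC.
pose H x := c * x - G x.
have dH (x : R) : `|x| < M -> is_derive x 1 H (c - h x).
  move=> /dG d.
  have : is_derive x 1 ((c \*: id) - G) (c *: 1 - h x) by apply: is_deriveB.
  by rewrite [c *: 1]mulr1.
have Hmon x y : 0 <= x -> x <= y -> y <= 2 * pi -> H x <= H y.
  move=> x0 xy yp.
  have [||z zxy Ez] := @MVT_segment _ H (fun x => c - h x) x y xy.
  - move=> z; rewrite in_itv/= => /andP[xz zy]; apply: dH.
    by rewrite ger0_norm /M; lra.
  - by apply: (is_derive_within dH); rewrite /M; lra.
  by rewrite -subr_ge0 Ez mulr_ge0// subr_ge0// /h.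
have Hc x : 0 <= x <= 2 * pi -> H x = H 0.
  case/andP=> x0 xp; apply/eqP; rewrite eq_le; apply/andP; split; last exact: Hmon.
  apply: le_trans (Hmon _ _ x0 xp (lexx _)) _.
  by rewrite /H mulr0 sub0r; lra.
have d1 : is_derive (1 : R) 1 H (c - h 1) by apply: dH; rewrite normr1 /M; lra.
have d2 : is_derive (1 : R) 1 H 0.
  have := @is_derive_cst _ _ _ (H 0) (1 : R) 1.
  apply: near_eq_is_derive.
  have : (1 : R) \in `]0, (2 * pi)[ by rewrite in_itv/= ltr01 p1.
  move/near_in_itvoo; apply: filterS => x; rewrite in_itv/= => /andP[x0 xp].
  by apply/esym/Hc; rewrite !ltW.
have E0 : c - h 1 = 0.
  by case: d1 => _ <-; case: d2.
by move/eqP: E0; rewrite subr_eq0 => /eqP.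
Qed.

Lemma periodic_unif_continuous g (M e : R) : continuous g -> 0 < e ->
  exists2 d : R, 0 < d & forall x y, `|x| <= M -> `|x - y| <= d -> `|g x - g y| < e.
Proof.
move=> cg e0.
have cI : compact (`[- M, M] : set R) by exact: segment_compact.
have e20 : 0 < e / 2 by rewrite divr_gt0.
have : \forall d \near (0^'+ : set_system R),
    `[- M, M] `<=` (fun x => forall y, `|x - y| <= d -> `|g x - g y| < e).
  apply: (iffLR (compact_near_coveringP _) cI) => x _.
  have /cvgrPdist_lt /(_ _ e20) [r /= r0 H] := cg x.
  exists (ball x (r / 2), [set d | d < r / 2]) => /=.
    split; first by apply: nbhsx_ballx; rewrite divr_gt0.
    by apply: nbhs_right_lt; rewrite divr_gt0.
  move=> [x' d] /= [xx' dr] y x'y.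
  have -> : g x' - g y = (g x - g y) - (g x - g x') by ring.
  rewrite (le_lt_trans (ler_normB _ _))// [ltRHS](splitr e) ltrD//; apply: H.
    rewrite /ball_/= (_ : x - y = (x - x') + (x' - y)); last by ring.
    by rewrite (le_lt_trans (ler_normD _ _))// [ltRHS](splitr r) ltrD// (le_lt_trans x'y).
  by rewrite /ball_/= (lt_trans xx')// gtr_pMr// invf_lt1// ltr1n.
case=> d /= d0 H.
exists (d / 2); first by rewrite divr_gt0.
move=> x y xM xy; apply: (H (d / 2)) => //=.
- by rewrite sub0r normrN gtr0_norm ?divr_gt0// gtr_pMr// invf_lt1// ltr1n.
- by rewrite divr_gt0.
- by rewrite in_itv/= -ler_norml.
Qed.

(** The Riemann sum A is invariant under translation by its step h, so any translation amounts to
    one by less than a step and changes A by at most e. Averaging A (s + t) over a period of t gives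
    exactly the mean of g. *)
Lemma riemann_pmean g (e : R) : continuous g -> periodic2pi g -> 0 < e ->
  exists2 N : nat, (0 < N)%N & forall s, `|s| <= 2 * pi ->
    N%:R^-1 * \sum_(j < N) g (s + j%:R * (2 * pi / N%:R)) <= pmean g + e.
Proof.
move=> cg pg e0; have p0 := pi2_gt0.
have [d d0 H] := periodic_unif_continuous (5 * (2 * pi)) cg e0.
pose N := (Num.truncn (2 * pi / d)).+1.
have N0 : 0 < N%:R :> R by rewrite ltr0n.
pose h : R := 2 * pi / N%:R.
have h0 : 0 < h by rewrite divr_gt0.
have hN : h * N%:R = 2 * pi by rewrite divfK// gt_eqF.
have hd : h <= d.
  by rewrite /h ler_pdivrMr// [leRHS]mulrC -ler_pdivrMr// ltW// /N truncnS_gt.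
exists N => // s sp.
pose A x := N%:R^-1 * \sum_(j < N) g (x + j%:R * h).
have Ah x : A (x + h) = A x.
  apply/eqP; rewrite -subr_eq0 /A -mulrBr -sumrB.
  rewrite (eq_bigr (fun j : 'I_N => g (x + j.+1%:R * h) - g (x + j%:R * h))); last first.
    by move=> j _; rewrite mulrSr mulrDl mul1r addrAC addrA.
  rewrite -(big_mkord xpredT (fun j => g (x + j.+1%:R * h) - g (x + j%:R * h))).
  by rewrite telescope_sumr// mul0r addr0 [_ * h]mulrC hN pg subrr mulr0.
have Amh m x : A (x + m%:R * h) = A x.
  elim: m => [|m IH]; first by rewrite mul0r addr0.
  by rewrite mulrSr mulrDl mul1r addrA Ah.
have As t : 0 <= t <= 2 * pi -> A s <= A (s + t) + e.
  case/andP=> t0 tp; pose m := Num.truncn (t / h).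
  have th : 0 <= t / h by rewrite divr_ge0// ltW.
  have m1 : m%:R * h <= t by rewrite -ler_pdivlMr// /m truncn_le.
  have m2 : t <= m%:R * h + h.
    by rewrite -[X in _ + X]mul1r -mulrDl -mulrSr -ler_pdivrMr// ltW// /m truncnS_gt.
  have -> : s + t = s + (t - m%:R * h) + m%:R * h by ring.
  rewrite Amh; set u := t - _.
  have u0 : 0 <= u by rewrite /u; lra.
  have uh : u <= h by rewrite /u; lra.
  rewrite -lerBlDl /A -mulrBr -sumrB.
  rewrite ler_pdivrMl// mulr_natl -[in leRHS](card_ord N) -sumr_const.
  apply: ler_sum => j _; apply/ltW; apply: le_lt_trans (ler_norm _) _.
  apply: H; last by rewrite (_ : _ - _ = - u) ?normrN ?ger0_norm ?(le_trans uh)//; ring.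
  apply: le_trans (ler_normD _ _) _.
  have jN : j%:R * h <= 2 * pi.
    by rewrite -hN mulrC ler_wpM2l ?(ltW h0)// ler_nat ltnW.
  by rewrite (ger0_norm (_ : 0 <= j%:R * h)) ?mulr_ge0// ?(ltW h0)//; lra.
have [cA EA] := pmean_sum N (fun j => @shift_continuous g (s + j%:R * h) cg).
have cA1 : continuous (fun t => N%:R^-1 * \sum_(j < N) g (t + (s + j%:R * h))).
  by move=> t; apply: cvgMr; exact: cA.
have : A s <= pmean (fun t => N%:R^-1 * \sum_(j < N) g (t + (s + j%:R * h)) + e).
  rewrite -[leLHS]pmean_cst; apply: le_pmean.
  - by move=> t; exact: cvg_cst.
  - by move=> t; apply: cvgD; [exact: cA1|exact: cvg_cst].
  - move=> t tp; apply: le_trans (As t tp) _; rewrite /A lerD2r.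
    by rewrite le_eqVlt; apply/orP; left; apply/eqP; congr (_ * _); apply: eq_bigr => j _; congr g; ring.
rewrite pmeanD//; last by move=> t; exact: cvg_cst.
rewrite pmean_cst pmeanZ// EA (eq_bigr (fun=> pmean g)); last first.
  by move=> j _; rewrite pmean_shift.
by rewrite sumr_const card_ord -(mulr_natl (pmean g)) mulKf// gt_eqF.
Qed.

End PeriodMean.

(** * Topology and polar coordinates of the complex numbers *)

Section ComplexTopology.
Context {R : realType}.
Implicit Types (z : R[i]).

Lemma normc_norm z : `|z| = (normc z)%:C.
Proof. by []. Qed.

Lemma normc_ge0 z : 0 <= normc z.
Proof. by case: z => a b; exact: sqrtr_ge0. Qed.

Lemma normc_real (r : R) : normc r%:C = `|r|.
Proof. by rewrite /normc /= expr0n addr0 sqrtr_sqr. Qed.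

Lemma normc_eq0 z : (normc z == 0) = (z == 0).
Proof. by apply/eqP/eqP => [/eq0_normc//|->]; rewrite normc0. Qed.

Lemma normc_gt0 z : (0 < normc z) = (z != 0).
Proof. by rewrite lt0r normc_ge0 andbT normc_eq0. Qed.

Lemma normc_Re z : `|complex.Re z| <= normc z.
Proof.
case: z => a b /=; rewrite -sqrtr_sqr ler_wsqrtr// lerDl sqr_ge0//.
Qed.

Lemma normc_Im z : `|complex.Im z| <= normc z.
Proof.
case: z => a b /=; rewrite -sqrtr_sqr ler_wsqrtr// lerDr sqr_ge0//.
Qed.

Lemma normc_le z : normc z <= `|complex.Re z| + `|complex.Im z|.
Proof.
rewrite [in leLHS](complexE z); apply: le_trans (le_normcD _ _) _.
by rewrite normcM !normc_real; case: z => a b /=; rewrite expr0n expr1n add0r sqrtr1 mul1r.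
Qed.

Lemma normcB z1 z2 : normc (z1 - z2) = normc (z2 - z1).
Proof. by rewrite -normcN opprB. Qed.

Lemma normc_sqr z : normc z ^+ 2 = complex.Re z ^+ 2 + complex.Im z ^+ 2.
Proof. by case: z => a b /=; rewrite sqr_sqrtr// addr_ge0 ?sqr_ge0. Qed.

Lemma gt0_complex (e : R[i]) : 0 < e -> exists2 r : R, 0 < r & e = r%:C.
Proof.
by case: e => a b; rewrite ltcE/= => /andP[/eqP -> a0]; exists a.
Qed.

(** Balls of [R[i]^o] have radii in [R[i]], but a positive element of [R[i]] is real, so real radii
    suffice. *)
Lemma nearCP (z : R[i]^o) (P : set R[i]^o) :
  (\forall y \near z, P y) <->
  exists2 e : R, 0 < e & forall y, normc (y - z) < e -> P y.
Proof.
split.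
  move=> Pz; have [e /= e0 eP] := (iffLR (nbhs_normP _ _)) Pz.
  have [r r0 er] := gt0_complex e0; exists r => // y yr; apply: eP.
  by rewrite /ball_/= er normc_norm ltcR normcB.
case=> e e0 eP; apply/nbhs_normP; exists (e%:C : R[i]) => /=; first by rewrite ltcR.
by move=> y; rewrite /ball_/= normc_norm ltcR normcB; exact: eP.
Qed.

Lemma normV_near (V : normedModType R[i]) (x : V) (P : set V) :
  (\forall y \near x, P y) <->
  exists2 e : R, 0 < e & forall y, normc `|y - x| < e -> P y.
Proof.
split.
  move=> Pz; have [e /= e0 eP] := (iffLR (nbhs_normP _ _)) Pz.
  have [r r0 er] := gt0_complex e0; exists r => // y yr; apply: eP.
  rewrite /ball_/= er -opprB normrN.
  have : `|y - x| = (normc `|y - x|)%:C by rewrite -normc_norm normr_id.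
  by move=> ->; rewrite ltcR.
case=> e e0 eP; apply/nbhs_normP; exists (e%:C : R[i]) => /=; first by rewrite ltcR.
move=> y; rewrite /ball_/= -opprB normrN => yx; apply: eP.
have : `|y - x| = (normc `|y - x|)%:C by rewrite -normc_norm normr_id.
by move=> E; rewrite -ltcR -E.
Qed.

Lemma continuous_distP (T : topologicalType) (f : T -> R) (x : T) :
  {for x, continuous f} <->
  forall e : R, 0 < e -> \forall y \near x, `|f x - f y| < e.
Proof. exact: (@cvgrPdist_lt R R T (nbhs x) _ f (f x)). Qed.

Lemma continuous_fcomp (S T U : topologicalType) (f : S -> T) (g : T -> U) (x : S) :
  continuous_at x f -> continuous_at (f x) g ->
  continuous_at x (fun y => g (f y)).
Proof. by move=> cf cg; exact: continuous_comp cf cg. Qed.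

Lemma Re_continuous : continuous (@complex.Re R : R[i]^o -> R).
Proof.
move=> z; apply/continuous_distP => e e0; apply/nearCP; exists e => // y yz.
rewrite (_ : _ - _ = complex.Re (z - y)).
  by apply: le_lt_trans (normc_Re _) _; rewrite normcB.
by case: z {yz} => ? ?; case: y => ? ?.
Qed.

Lemma Im_continuous : continuous (@complex.Im R : R[i]^o -> R).
Proof.
move=> z; apply/continuous_distP => e e0; apply/nearCP; exists e => // y yz.
rewrite (_ : _ - _ = complex.Im (z - y)).
  by apply: le_lt_trans (normc_Im _) _; rewrite normcB.
by case: z {yz} => ? ?; case: y => ? ?.
Qed.

Lemma normc_dist z1 z2 : `|normc z1 - normc z2| <= normc (z1 - z2).
Proof.
have H (a b : R[i]) : normc a - normc b <= normc (a - b).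
  by rewrite lerBlDr -[in leLHS](subrK b a) le_normcD.
by rewrite ler_norml H andbT lerNl opprB normcB H.
Qed.

Lemma normc_continuous : continuous (@normc R : R[i]^o -> R).
Proof.
move=> z; apply/continuous_distP => e e0; apply/nearCP; exists e => // y yz.
by apply: le_lt_trans (normc_dist _ _) _; rewrite normcB.
Qed.

Lemma complex_cvg (T : Type) (F : set_system T) (FF : Filter F) (f g : T -> R) (a b : R) :
  f @ F --> a -> g @ F --> b -> (fun t => (f t +i* g t : R[i]^o)) @ F --> ((a +i* b) : R[i]^o).
Proof.
move=> fa gb P /nearCP [e e0 eP].
have e20 : 0 < e / 2 by rewrite divr_gt0.
move/cvgrPdist_lt : fa => /(_ _ e20) fa; move/cvgrPdist_lt : gb => /(_ _ e20) gb.
have : F [set t | P (f t +i* g t)].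
  apply: filterS2 fa gb => t fa gb; apply: eP; apply: le_lt_trans (normc_le _) _.
  rewrite (_ : _ - _ = (f t - a) +i* (g t - b))//=.
  by rewrite [ltRHS](splitr e) ltrD// distrC.
by [].
Qed.

Lemma real_complex_continuous : continuous (fun t : R => t%:C : R[i]^o).
Proof. by move=> t; apply: complex_cvg; [exact: cvg_id|exact: cvg_cst]. Qed.

Definition cis (t : R) : R[i] := (cos t +i* sin t).

Lemma cis_continuous : continuous (cis : R -> R[i]^o).
Proof. by move=> t; apply: complex_cvg; [exact: continuous_cos|exact: continuous_sin]. Qed.

Lemma normc_cis t : normc (cis t) = 1.
Proof. by rewrite /= cos2Dsin2 sqrtr1. Qed.

Lemma cisD s t : cis (s + t) = cis s * cis t.
Proof. by rewrite /cis cosD sinD; simpc; rewrite [sin s * _ + _]addrC. Qed.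

Lemma cispi : cis pi = -1.
Proof. by rewrite /cis cospi sinpi; apply/eqP; rewrite eq_complex/= oppr0 !eqxx. Qed.

Lemma cis2pi : cis (2 * pi) = 1.
Proof. by rewrite mulrDl mul1r cisD cispi mulrNN mulr1. Qed.

Lemma cis_period t : cis (t + 2 * pi) = cis t.
Proof. by rewrite cisD cis2pi mulr1. Qed.

(** The angle is the arc cosine of Re z / |z|, with the sign of Im z. It is bounded because
    [riemann_pmean] is uniform only over bounded rotations. *)
Lemma polar z : exists2 t : R, `|t| <= pi & z = (normc z)%:C * cis t.
Proof.
have [->|z0] := eqVneq z 0; first by exists 0; rewrite ?normr0 ?pi_ge0// normc0 mul0r.
have n0 : 0 < normc z by rewrite normc_gt0.
case: z z0 n0 => a b z0; set r := normc _ => n0.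
have r2 : r ^+ 2 = a ^+ 2 + b ^+ 2 by rewrite /r normc_sqr.
have E1 : (a / r) ^+ 2 + (b / r) ^+ 2 = 1.
  by rewrite !expr_div_n -mulrDl -r2 divff// expf_eq0/= gt_eqF.
have Ea : -1 <= a / r <= 1.
  rewrite -ler_norml -(@ler_pXn2r _ 2)// ?nnegrE// expr1n real_normK ?num_real//.
  by rewrite -E1 lerDl sqr_ge0.
have E2 : sin (acos (a / r)) = `|b / r|.
  rewrite sin_acos// -sqrtr_sqr; congr Num.sqrt.
  by rewrite -E1 addrAC subrr add0r.
have ap : `|acos (a / r)| <= pi by rewrite ger0_norm ?acos_ge0 ?acos_lepi.
have [b0|b0] := leP 0 (b / r).
  exists (acos (a / r)) => //; rewrite /cis acosK// E2 ger0_norm//; simpc.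
  by rewrite ![r * _]mulrC !divfK// gt_eqF.
exists (- acos (a / r)); first by rewrite normrN.
rewrite /cis cosN sinN acosK// E2 ltr0_norm// opprK; simpc.
by rewrite ![r * _]mulrC !divfK// gt_eqF.
Qed.

Lemma compact_complex (K : set R[i]^o) (M : R) : closed K ->
  (forall z, K z -> normc z <= M) -> compact K.
Proof.
move=> cK bK.
have cf : continuous (fun p : R * R => (p.1 +i* p.2) : R[i]^o).
  move=> p; apply: complex_cvg; [exact: cvg_fst|exact: cvg_snd].
have cI : compact (`[- M, M] `*` `[- M, M] : set (R * R)).
  by apply: compact_setX; exact: segment_compact.
apply: (@subclosed_compact _ _ ((fun p : R * R => (p.1 +i* p.2) : R[i]^o) @` (`[- M, M] `*` `[- M, M]))) => //.
  by apply: continuous_compact => //; exact: continuous_subspaceT.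
move=> z /bK zM; exists (complex.Re z, complex.Im z) => /=; last by case: z {zM}.
by rewrite !in_itv/= -!ler_norml (le_trans (normc_Re _) zM) (le_trans (normc_Im _) zM).
Qed.

End ComplexTopology.

Section ContinuousAt.
Context {K : numFieldType} {T : topologicalType} {W : normedModType K}.
Implicit Types (f g : T -> W) (x : T).

Lemma continuous_atD f g x : continuous_at x f -> continuous_at x g ->
  continuous_at x (fun y => f y + g y).
Proof. by move=> cf cg; exact: cvgD. Qed.

Lemma continuous_atB f g x : continuous_at x f -> continuous_at x g ->
  continuous_at x (fun y => f y - g y).
Proof. by move=> cf cg; exact: cvgB. Qed.

Lemma continuous_atZ (k : K) f x : continuous_at x f -> continuous_at x (fun y => k *: f y).
Proof. by move=> cf; exact: cvgZl_tmp. Qed.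

Lemma continuous_at_scale (f : T -> K^o) (w : W) x :
  continuous_at x f -> continuous_at x (fun y => f y *: w).
Proof. by move=> cf; exact: cvgZr_tmp. Qed.

Lemma continuous_at_cst (w : W) x : continuous_at x (fun=> w).
Proof. exact: cvg_cst. Qed.

Lemma continuous_at_id x : continuous_at x id.
Proof. exact: cvg_id. Qed.

Lemma continuous_at_sum (n : nat) (F : nat -> T -> W) x :
  (forall j, (j < n)%N -> continuous_at x (F j)) ->
  continuous_at x (fun y => \sum_(j < n) F j y).
Proof.
elim: n => [|n IH] cF.
  rewrite (_ : (fun y => _) = fun=> 0); first exact: continuous_at_cst.
  by apply/funext => y; rewrite big_ord0.
rewrite (_ : (fun y => _) = (fun y => \sum_(j < n) F j y + F n y)).
  by apply: continuous_atD; [apply: IH => j jn; apply: cF; exact: ltnW|exact: cF].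
by apply/funext => y; rewrite big_ord_recr.
Qed.

End ContinuousAt.

(** * The pointwise sub-mean value property *)

Section Submean.
Context {R : realType} {V : normedModType R[i]}.
Implicit Types (f g m : V -> R) (x v : V) (r t : R).

(** The norm of a module normed over [R[i]] has its values in [R[i]]; this is the same number in
    [R]. *)
Definition nrm x : R := normc `|x|.

Lemma nrmE x : `|x| = (nrm x)%:C.
Proof. by rewrite /nrm -normc_norm normr_id. Qed.

Lemma nrm_ge0 x : 0 <= nrm x.
Proof. exact: normc_ge0. Qed.

Lemma nearVP x (P : set V) :
  (\forall y \near x, P y) <->
  exists2 e : R, 0 < e & forall y, nrm (y - x) < e -> P y.
Proof. exact: normV_near. Qed.

Lemma nrmD x y : nrm (x + y) <= nrm x + nrm y.
Proof. by have := ler_normD x y; rewrite !nrmE -(rmorphD (real_complex R)) lecR. Qed.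

Lemma nrmZ (k : R[i]) x : nrm (k *: x) = normc k * nrm x.
Proof. by rewrite /nrm normrZ normcM !normc_norm normc_real ger0_norm// normc_ge0. Qed.

Lemma circle_near x v (P : set V) : (\forall y \near x, P y) ->
  \forall r \near 0^'+, forall t, P (x + (r%:C * cis t) *: v).
Proof.
move=> /nearVP [e e0 eP].
have n0 : 0 < nrm v + 1 by rewrite ltr_wpDl// nrm_ge0.
near=> r => t; apply: eP; rewrite addrAC subrr add0r nrmZ normcM normc_cis mulr1 normc_real.
have r0 : 0 < r by near: r; exact: nbhs_right_gt.
rewrite gtr0_norm//; apply: (@le_lt_trans _ _ (r * (nrm v + 1))).
  by rewrite ler_wpM2l ?(ltW r0)// lerDl.
rewrite -ltr_pdivlMr//; near: r; apply: nbhs_right_lt; exact: divr_gt0.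
Unshelve. all: by end_near. Qed.

Definition cmean f x v r : R := pmean (fun t => f (x + (r%:C * cis t) *: v)).

(** Continuity at all nearby points, rather than at x alone, makes the integrands on small circles
    continuous. *)
Definition cts_near f x := \forall y \near x, {for y, continuous f}.

Lemma circle_path_continuous x v r :
  continuous (fun t => x + (r%:C * cis t) *: v).
Proof.
move=> t; apply: cvgD; first exact: cvg_cst.
apply: (@cvgZr_tmp _ _ _ _ _ (fun t => r%:C * cis t : R[i]^o)).
by apply: cvgMr; exact: cis_continuous.
Qed.

Lemma circle_continuous f x v r :
  (forall t, {for x + (r%:C * cis t) *: v, continuous f}) ->
  continuous (fun t => f (x + (r%:C * cis t) *: v)).
Proof.
move=> cf t.
by apply: (@continuous_comp _ _ _ (fun t => x + (r%:C * cis t) *: v) f) => //; exact: circle_path_continuous.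
Qed.

Lemma circle_periodic f x v r : periodic2pi (fun t => f (x + (r%:C * cis t) *: v)).
Proof. by move=> t; rewrite cis_period. Qed.

(* Only small radii are required, with no uniformity in x: on the complex line
   the maximum principle upgrades this to all radii ([submean_disc]), which
   makes submean_at a pointwise substitute for plurisubharmonicity of
   continuous functions. *)
Definition submean_at f x := cts_near f x /\
  forall v, \forall r \near 0^'+, f x <= cmean f x v r.

Definition mean_at f x := cts_near f x /\
  forall v, \forall r \near 0^'+, cmean f x v r = f x.

Lemma mean_submean f x : mean_at f x -> submean_at f x.
Proof. by move=> [cf mf]; split => // v; apply: filterS (mf v) => r ->. Qed.

(** The gluing principle: maxima, truncated logarithms, dents and the function of assertion (1) are
    all treated by exhibiting, at the delicate points, a submean minorant that touches there. *)
Lemma submean_le m f x : submean_at m x -> cts_near f x -> m x = f x ->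
  (\forall y \near x, m y <= f y) -> submean_at f x.
Proof.
move=> [cm mm] cf mf mlef; split=> // v; near=> r.
rewrite -mf; apply: (@le_trans _ _ (cmean m x v r)); first by near: r; exact: mm.
apply: le_pmean.
- by apply: circle_continuous; near: r; exact: (circle_near v cm).
- by apply: circle_continuous; near: r; exact: (circle_near v cf).
- by move=> t _; move: t; near: r; exact: (circle_near v mlef).
Unshelve. all: by end_near. Qed.

Lemma cts_near_eq f g x : (\forall y \near x, f y = g y) -> cts_near f x -> cts_near g x.
Proof.
move=> /nearVP [e e0 fg] cf; near=> y.
have cfy : {for y, continuous f} by near: y.
have yx : nrm (y - x) < e by near: y; apply/nearVP; exists e.
have fgy : \forall z \near y, f z = g z.
  apply/nearVP; exists (e - nrm (y - x)); first by rewrite subr_gt0.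
  move=> z zy; apply: fg; rewrite -(subrK y z) -addrA.
  apply: (@le_lt_trans _ _ (nrm (z - y) + nrm (y - x))); last by rewrite -ltrBrDr.
  by rewrite -lecR rmorphD/= -!nrmE ler_normD.
rewrite /prop_for/continuous_at -(nbhs_singleton fgy).
by apply: cvg_trans cfy; exact: near_eq_cvg.
Unshelve. all: by end_near. Qed.

Lemma submean_eq f g x : (\forall y \near x, f y = g y) -> submean_at f x -> submean_at g x.
Proof.
move=> fg sf; apply: (submean_le sf).
- by apply: cts_near_eq fg _; case: sf.
- exact: (nbhs_singleton fg).
- by apply: filterS fg => y ->.
Qed.

Lemma cts_nearD f g x : cts_near f x -> cts_near g x -> cts_near (fun y => f y + g y) x.
Proof. by apply: filterS2 => y cf cg; exact: cvgD. Qed.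

Lemma cts_nearZ f (k : R) x : cts_near f x -> cts_near (fun y => k * f y) x.
Proof. by apply: filterS => y cf; exact: cvgMr. Qed.

Lemma cts_near_max f g x : cts_near f x -> cts_near g x ->
  cts_near (fun y => Num.max (f y) (g y)) x.
Proof. by apply: filterS2 => y cf cg; exact: continuous_max. Qed.

Lemma continuous_cts_near f x : continuous f -> cts_near f x.
Proof. by move=> cf; apply: nearW => y; exact: cf. Qed.

Lemma cts_near_cst (k : R) x : cts_near (fun=> k) x.
Proof. by apply: nearW => y; exact: cvg_cst. Qed.

Lemma cmeanD f g x v : cts_near f x -> cts_near g x -> \forall r \near 0^'+,
  cmean (fun y => f y + g y) x v r = cmean f x v r + cmean g x v r.
Proof.
move=> cf cg; near=> r; rewrite /cmean pmeanD//; apply: circle_continuous; near: r;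
  [exact: (circle_near v cf)|exact: (circle_near v cg)].
Unshelve. all: by end_near. Qed.

Lemma cmeanZ f (k : R) x v : cts_near f x -> \forall r \near 0^'+,
  cmean (fun y => k * f y) x v r = k * cmean f x v r.
Proof.
move=> cf; near=> r; rewrite /cmean pmeanZ//; apply: circle_continuous; near: r.
exact: (circle_near v cf).
Unshelve. all: by end_near. Qed.

Lemma submeanD f g x : submean_at f x -> submean_at g x ->
  submean_at (fun y => f y + g y) x.
Proof.
move=> [cf mf] [cg mg]; split; first exact: cts_nearD.
move=> v; near=> r; have -> : cmean (fun y => f y + g y) x v r = cmean f x v r + cmean g x v r.
  by near: r; exact: cmeanD.
by apply: lerD; near: r.
Unshelve. all: by end_near. Qed.

Lemma submeanZ f (k : R) x : 0 <= k -> submean_at f x ->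
  submean_at (fun y => k * f y) x.
Proof.
move=> k0 [cf mf]; split; first exact: cts_nearZ.
move=> v; near=> r; have -> : cmean (fun y => k * f y) x v r = k * cmean f x v r.
  by near: r; exact: cmeanZ.
by apply: ler_wpM2l => //; near: r.
Unshelve. all: by end_near. Qed.

Lemma meanD f g x : mean_at f x -> mean_at g x -> mean_at (fun y => f y + g y) x.
Proof.
move=> [cf mf] [cg mg]; split; first exact: cts_nearD.
move=> v; near=> r; have -> : cmean (fun y => f y + g y) x v r = cmean f x v r + cmean g x v r.
  by near: r; exact: cmeanD.
by congr (_ + _); near: r.
Unshelve. all: by end_near. Qed.

Lemma meanZ f (k : R) x : mean_at f x -> mean_at (fun y => k * f y) x.
Proof.
move=> [cf mf]; split; first exact: cts_nearZ.
move=> v; near=> r; have -> : cmean (fun y => k * f y) x v r = k * cmean f x v r.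
  by near: r; exact: cmeanZ.
by congr (_ * _); near: r.
Unshelve. all: by end_near. Qed.

Lemma mean_cst (k : R) x : mean_at (fun=> k) x.
Proof.
split; first exact: cts_near_cst.
by move=> v; near=> r; rewrite /cmean pmean_cst.
Unshelve. all: by end_near. Qed.

Lemma submean_cst (k : R) x : submean_at (fun=> k) x.
Proof. exact/mean_submean/mean_cst. Qed.

Lemma submean_max f g x : submean_at f x -> submean_at g x ->
  submean_at (fun y => Num.max (f y) (g y)) x.
Proof.
move=> sf sg; have c : cts_near (fun y => Num.max (f y) (g y)) x.
  by apply: cts_near_max; [case: sf|case: sg].
have [fg|gf] := leP (f x) (g x).
  apply: (submean_le sg) => //; first by rewrite max_r.
  by apply: nearW => y; rewrite le_max lexx orbT.
apply: (submean_le sf) => //; first by rewrite max_l// ltW.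
by apply: nearW => y; rewrite le_max lexx.
Qed.

Lemma submean_sum (n : nat) (F : nat -> V -> R) x :
  (forall j, (j < n)%N -> submean_at (F j) x) ->
  submean_at (fun y => \sum_(j < n) F j y) x.
Proof.
elim: n => [|n IH] sF.
  rewrite (_ : (fun y => _) = fun=> 0); first exact: submean_cst.
  by apply/funext => y; rewrite big_ord0.
rewrite (_ : (fun y => _) = (fun y => \sum_(j < n) F j y + F n y)).
  by apply: submeanD; [apply: IH => j jn; apply: sF; exact: ltnW|exact: sF].
by apply/funext => y; rewrite big_ord_recr.
Qed.

Lemma submean_continuous f x : submean_at f x -> {for x, continuous f}.
Proof. by case=> /nbhs_singleton. Qed.

End Submean.

(** * Circle means of logarithms and of affine functions *)

Section LogMean.
Context {R : realType}.
Implicit Types (z : R[i]) (t : R).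

Lemma normc_1Dcis_gt0 z t : normc z < 1 -> 1 - normc z <= normc (1 + z * cis t).
Proof.
move=> z1; have := normc_dist 1 (- (z * cis t)).
rewrite normc1 normcN normcM normc_cis mulr1 opprK => H.
by apply: le_trans H; exact: ler_norm.
Qed.

Lemma ln_1Dcis_continuous z : normc z < 1 ->
  continuous (fun t => ln (normc (1 + z * cis t))).
Proof.
move=> z1 t; have p : 0 < normc (1 + z * cis t).
  by apply: lt_le_trans (normc_1Dcis_gt0 t z1); rewrite subr_gt0.
refine (@continuous_fcomp R R R (fun t => normc (1 + z * cis t)) (@ln R) t _ _).
  refine (@continuous_fcomp R R[i]^o R (fun t => 1 + z * cis t) (@normc R) t _ _).
    apply: cvgD; first exact: cvg_cst.
    by apply: cvgMr; exact: cis_continuous.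
  exact: normc_continuous.
exact: continuous_ln.
Qed.

Lemma ln_1Dcis_periodic z : periodic2pi (fun t => ln (normc (1 + z * cis t))).
Proof. by move=> t; rewrite cis_period. Qed.

Let I z := pmean (fun t => ln (normc (1 + z * cis t))).

Let I_double z : normc z < 1 -> 2 * I z = I (z ^+ 2).
Proof.
move=> z1; have c := ln_1Dcis_continuous z1.
have zN1 : normc (- z) < 1 by rewrite normcN.
have z21 : normc (z ^+ 2) < 1.
  by rewrite expr2 normcM mulr_ilt1// normc_ge0.
have z2N1 : normc (- z ^+ 2) < 1 by rewrite normcN.
have IN w : normc w < 1 -> I (- w) = I w.
  move=> w1; rewrite -[RHS](pmean_shift pi (ln_1Dcis_continuous w1) (@ln_1Dcis_periodic w)).
  by congr pmean; apply/funext => t; rewrite cisD cispi mulrN1 mulrN mulNr.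
rewrite -(IN _ z21) -[RHS](pmean_double (ln_1Dcis_continuous z2N1) (@ln_1Dcis_periodic _)).
rewrite mulr_natl mulr2n -[X in _ + X](IN _ z1) -pmeanD//; last exact: ln_1Dcis_continuous.
congr pmean; apply/funext => t.
have p : 0 < normc (1 + z * cis t).
  by apply: lt_le_trans (normc_1Dcis_gt0 t z1); rewrite subr_gt0.
have pN : 0 < normc (1 + - z * cis t).
  by apply: lt_le_trans (normc_1Dcis_gt0 t zN1); rewrite subr_gt0.
rewrite -lnM ?posrE// -normcM; congr (ln (normc _)).
by rewrite (_ : 2 * t = t + t) ?cisD; ring.
Qed.

Let I_bound z (q : R) : normc z <= q -> q < 1 -> `|I z| <= - ln (1 - q).
Proof.
move=> zq q1; have z1 := le_lt_trans zq q1.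
have q0 : 0 <= q := le_trans (normc_ge0 z) zq.
have lo t : ln (1 - q) <= ln (normc (1 + z * cis t)).
  have h := normc_1Dcis_gt0 t z1.
  by rewrite ler_ln ?posrE ?subr_gt0//; lra.
have hi t : ln (normc (1 + z * cis t)) <= - ln (1 - q).
  have h := normc_1Dcis_gt0 t z1.
  have p : 0 < normc (1 + z * cis t) by lra.
  rewrite -lnV ?posrE ?subr_gt0// ler_ln ?posrE ?invr_gt0 ?subr_gt0//.
  apply: le_trans (le_normcD _ _) _; rewrite normc1 normcM normc_cis mulr1.
  rewrite -[leRHS]mul1r ler_pdivlMr ?subr_gt0//; nra.
rewrite ler_norml opprK; apply/andP; split.
  rewrite -[leLHS]pmean_cst; apply: le_pmean => //; [move=> t; exact: cvg_cst|].
  exact: ln_1Dcis_continuous.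
rewrite -[leRHS]pmean_cst; apply: le_pmean => //; [|move=> t; exact: cvg_cst].
exact: ln_1Dcis_continuous.
Qed.

(* The mean I z satisfies 2 * I z = I (z ^+ 2), since t and t + pi pair
   (1 + z cis t) with (1 - z cis t); as I stays bounded by - ln (1 - |z|)
   along the squarings, it vanishes. *)
Lemma pmean_ln_1Dcis z : normc z < 1 -> pmean (fun t => ln (normc (1 + z * cis t))) = 0.
Proof.
move=> z1; rewrite -/(I z).
have H k : (2 ^+ k) * `|I z| <= - ln (1 - normc z).
  suff [w wz E] : exists2 w, normc w <= normc z & 2 ^+ k * I z = I w.
    rewrite -[2 ^+ k]ger0_norm ?exprn_ge0// -normrM E.
    exact: I_bound wz z1.
  elim: k => [|k [w wz E]]; first by exists z => //; rewrite expr0 mul1r.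
  exists (w ^+ 2).
    rewrite expr2 normcM (le_trans _ wz)// ler_piMl ?normc_ge0//.
    by rewrite (le_trans wz)// ltW.
  by rewrite exprS -mulrA E I_double// (le_lt_trans wz).
apply/eqP; rewrite -normr_eq0 eq_le normr_ge0 andbT leNgt; apply/negP => I0.
pose k := (Num.truncn (- ln (1 - normc z) / `|I z|)).+1.
have := H k; rewrite -ler_pdivlMr// leNgt => /negP; apply.
apply: (@lt_trans _ _ k%:R); first by rewrite truncnS_gt.
by rewrite -natrX ltr_nat ltn_expl.
Qed.

(** Translation by pi changes the sign of the integrand and preserves its mean. *)
Lemma pmean_Re_cis z : continuous (fun t => complex.Re (z * cis t)) /\
  pmean (fun t => complex.Re (z * cis t)) = 0.
Proof.
have c : continuous (fun t => complex.Re (z * cis t)).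
  move=> t; refine (@continuous_fcomp R R[i]^o R (fun t => z * cis t) (@complex.Re R) t _ _).
    by apply: cvgMr; exact: cis_continuous.
  exact: Re_continuous.
split=> //.
have p : periodic2pi (fun t => complex.Re (z * cis t)) by move=> t; rewrite cis_period.
have := pmean_shift pi c p.
have -> : (fun t => complex.Re (z * cis (t + pi))) = (fun t => -1 * complex.Re (z * cis t)).
  apply/funext => t; rewrite cisD cispi mulrN1 mulrN mulN1r.
  by case: (z * cis t).
by rewrite pmeanZ//; lra.
Qed.

End LogMean.

Section AffineMean.
Context {R : realType} {V : normedModType R[i]}.
Variables (l : V -> R[i]^o) (L : V -> R[i]).
Hypothesis cl : continuous l.
Hypothesis lD : forall x c v, l (x + c *: v) = l x + c * L v.

Lemma normc_affine_continuous : continuous (fun y => normc (l y)).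
Proof.
move=> y; refine (@continuous_fcomp V R[i]^o R l (@normc R) y _ _); first exact: cl.
exact: normc_continuous.
Qed.

(** Factoring out l x leaves ln |1 + z cis t| with |z| < 1 once r is small, and its mean is 0. *)
Lemma ln_affine_mean x : l x != 0 -> mean_at (fun y => ln (normc (l y))) x.
Proof.
move=> lx; have p : 0 < normc (l x) by rewrite normc_gt0.
split.
  have : \forall y \near x, 0 < normc (l y) by exact: (cvgr_gt _ (@normc_affine_continuous x)).
  apply: filterS => y py.
  refine (@continuous_fcomp V R R (fun y => normc (l y)) (@ln R) y _ _); last exact: continuous_ln.
  exact: normc_affine_continuous.
move=> v; have n0 : 0 < normc (L v / l x) + 1 by rewrite ltr_wpDl// normc_ge0.
near=> r.
have r0 : 0 < r by near: r; exact: nbhs_right_gt.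
have z1 : normc (r%:C * (L v / l x)) < 1.
  rewrite normcM normc_real gtr0_norm//.
  apply: (@le_lt_trans _ _ (r * (normc (L v / l x) + 1))).
    by rewrite ler_wpM2l ?(ltW r0)// lerDl.
  rewrite -ltr_pdivlMr//; near: r; apply: nbhs_right_lt; exact: divr_gt0.
rewrite /cmean.
have -> : (fun t => ln (normc (l (x + (r%:C * cis t) *: v)))) =
  (fun t => ln (normc (l x)) + ln (normc (1 + r%:C * (L v / l x) * cis t))).
  apply/funext => t; rewrite lD -lnM ?posrE//; last first.
    by apply: lt_le_trans (normc_1Dcis_gt0 t z1); rewrite subr_gt0.
  rewrite -normcM; congr (ln (normc _)); rewrite mulrDr mulr1; congr (_ + _).
  by rewrite mulrC; field.
rewrite pmeanD; [|by move=> t; exact: cvg_cst|exact: ln_1Dcis_continuous].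
by rewrite pmean_cst pmean_ln_1Dcis// addr0.
Unshelve. all: by end_near. Qed.

Lemma Re_affine_mean (k : R[i]) x : mean_at (fun y => complex.Re (k * l y)) x.
Proof.
have RD (a b : R[i]) : complex.Re (a + b) = complex.Re a + complex.Re b.
  by case: a => ? ?; case: b.
split.
  apply: nearW => y; refine (@continuous_fcomp V R[i]^o R (fun y => k * l y) (@complex.Re R) y _ _).
    by apply: cvgMr; exact: cl.
  exact: Re_continuous.
move=> v; near=> r; rewrite /cmean.
have -> : (fun t => complex.Re (k * l (x + (r%:C * cis t) *: v))) =
  (fun t => complex.Re (k * l x) + complex.Re (k * (r%:C * L v) * cis t)).
  by apply/funext => t; rewrite lD mulrDr RD; congr (_ + complex.Re _); ring.
have [c E] := pmean_Re_cis (k * (r%:C * L v)).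
by rewrite pmeanD// ?pmean_cst ?E ?addr0//; move=> t; exact: cvg_cst.
Unshelve. all: by end_near. Qed.

Lemma cmean_normc2_affine x v r :
  cmean (fun y => normc (l y) ^+ 2) x v r = normc (l x) ^+ 2 + normc (r%:C * L v) ^+ 2.
Proof.
rewrite /cmean; pose k := conjc (l x) * (r%:C * L v).
have -> : (fun t => normc (l (x + (r%:C * cis t) *: v)) ^+ 2) =
  (fun t => (normc (l x) ^+ 2 + normc (r%:C * L v) ^+ 2) + 2 * complex.Re (k * cis t)).
  apply/funext => t; rewrite lD /k.
  have -> : r%:C * cis t * L v = (r%:C * L v) * cis t by ring.
  have : cos t ^+ 2 + sin t ^+ 2 = 1 by exact: cos2Dsin2.
  move: (l x) (r%:C * L v) => [a b] [c d].
  rewrite !normc_sqr /= => cs.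
  have E : (c ^+ 2 + d ^+ 2) * (cos t ^+ 2 + sin t ^+ 2) = c ^+ 2 + d ^+ 2.
    by rewrite cs mulr1.
  by rewrite -[c ^+ 2 + d ^+ 2]E; ring.
have [c E] := pmean_Re_cis k.
rewrite pmeanD ?pmean_cst ?pmeanZ// ?E ?mulr0 ?addr0//.
- by move=> t; exact: cvg_cst.
- by move=> t; apply: cvgMr; exact: c.
Qed.

Lemma normc2_affine_submean x : submean_at (fun y => normc (l y) ^+ 2) x.
Proof.
split.
  apply: nearW => y; refine (@continuous_fcomp V R R (fun y => normc (l y)) (fun t => t ^+ 2) y _ _).
    exact: normc_affine_continuous.
  exact: exprn_continuous.
by move=> v; near=> r; rewrite cmean_normc2_affine lerDl sqr_ge0.
Unshelve. all: by end_near. Qed.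

End AffineMean.

Section IdentityMean.
Context {R : realType}.
Notation C := (R[i]^o).
Implicit Types z : C.

Let idc : continuous (id : C -> C).
Proof. by move=> z; exact: continuous_at_id. Qed.

Let idD (x : C) (c : R[i]) (v : C) : (x + c *: v : R[i]) = x + c * v.
Proof. by []. Qed.

Lemma Re_mean (k : R[i]) z : mean_at (fun y : C => complex.Re (k * y)) z.
Proof. exact: (@Re_affine_mean R C id id idc idD k z). Qed.

Lemma normc2_submean z : submean_at (fun y : C => normc y ^+ 2) z.
Proof. exact: (@normc2_affine_submean R C id id idc idD z). Qed.

End IdentityMean.

(** * Subharmonic functions: maximum principle, Liouville, Hopf *)

Section AffineComp.
Context {R : realType} {V W : normedModType R[i]}.
Variables (l : V -> W) (L : V -> W).
Hypothesis cl : continuous l.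
Hypothesis lD : forall x (c : R[i]) v, l (x + c *: v) = l x + c *: L v.

Lemma cts_near_comp (f : W -> R) x : cts_near f (l x) -> cts_near (fun y => f (l y)) x.
Proof.
move=> cf; have : nbhs x (l @^-1` [set y | {for y, continuous f}]) by apply: cl; exact: cf.
by apply: filterS => y /= cfy; refine (@continuous_fcomp V W R l f y (@cl y) cfy).
Qed.

Lemma submean_comp (f : W -> R) x : submean_at f (l x) -> submean_at (fun y => f (l y)) x.
Proof.
move=> [cf mf]; split; first exact: cts_near_comp.
move=> v; apply: filterS (mf (L v)) => r; rewrite /cmean.
by under [in X in _ -> X]eq_fun do rewrite lD.
Qed.

End AffineComp.

Section MaxPrinciple.
Context {R : realType}.
Notation C := (R[i]^o).
Implicit Types (f : C -> R) (z a : C).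

Lemma cmean_normc2 (z v : C) r :
  cmean (fun y : C => normc y ^+ 2) z v r = normc z ^+ 2 + normc (r%:C * v) ^+ 2.
Proof.
by rewrite (@cmean_normc2_affine R C id (fun v => v)).
Qed.

Lemma normc2_continuous : continuous (fun y : C => normc y ^+ 2).
Proof.
move=> y; refine (@continuous_fcomp C R R (@normc R) (fun t => t ^+ 2) y _ _).
  exact: normc_continuous.
exact: exprn_continuous.
Qed.

(** Adding d |z|^2 makes the mean inequality strict, so the maximum of the sum F cannot lie in W.
    Here d is so small that the addition is at most half of f z0 - M on K, which keeps the maximum
    out of the rest of K as well. *)
Lemma max_principle (K W : set C) f (M : R) : compact K -> W `<=` K ->
  (forall z, K z -> {for z, continuous f}) ->
  (forall z, W z -> submean_at f z) ->
  (forall z, W z -> \forall y \near z, K y) ->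
  (forall z, K z -> ~ W z -> f z <= M) -> forall z, K z -> f z <= M.
Proof.
move=> cK WK cf sf WN fM z0 Kz0; rewrite leNgt; apply/negP => Mf.
have [B HB] : exists2 B : R, 0 < B & forall z, K z -> normc z ^+ 2 <= B.
  have [||c _ cB] := @compact_EVT_max _ R (fun y : C => normc y ^+ 2) K _ cK.
  - by exists z0.
  - exact/continuous_subspaceT/normc2_continuous.
  exists (normc c ^+ 2 + 1); first by rewrite ltr_wpDl// sqr_ge0.
  by move=> z Kz; rewrite ler_wpDr//; apply: cB; rewrite inE.
move=> KB; pose d := (f z0 - M) / (2 * B).
have d0 : 0 < d by rewrite divr_gt0 ?subr_gt0// mulr_gt0.
have dB : d * B = (f z0 - M) / 2 by rewrite /d; field; rewrite gt_eqF.
pose F (z : C) := f z + d * normc z ^+ 2.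
have cF z : K z -> {for z, continuous F}.
  by move=> Kz; apply: (cvgD (cf z Kz)); apply: cvgMr; exact: normc2_continuous.
have [||c Kc cmax] := @compact_EVT_max _ R F K _ cK.
- by exists z0.
- by apply: continuous_in_subspaceT => z; rewrite inE; exact: cF.
rewrite inE in Kc.
have F0 : F z0 <= F c by apply: cmax; rewrite inE.
have Wc : W c.
  apply: contrapT => nWc; have := fM _ Kc nWc; have := KB _ Kc.
  move: F0; rewrite /F => F0 h1 h2.
  have := sqr_ge0 (normc z0).
  have : d * normc c ^+ 2 <= d * B by rewrite ler_wpM2l// ltW.
  have : 0 <= d * normc z0 ^+ 2 by rewrite mulr_ge0 ?sqr_ge0// ltW.
  rewrite dB; lra.
have [cfc mf] := sf _ Wc.
have cN : cts_near (fun y : C => normc y ^+ 2) c.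
  exact/continuous_cts_near/normc2_continuous.
have cFc : cts_near F c by apply: cts_nearD => //; exact: cts_nearZ.
suff : F c < F c by rewrite ltxx.
near (0 : R)^'+ => r.
have r0 : 0 < r by near: r; exact: nbhs_right_gt.
apply: (@lt_le_trans _ _ (cmean F c 1 r)).
  have -> : cmean F c 1 r = cmean f c 1 r + cmean (fun z : C => d * normc z ^+ 2) c 1 r.
    by near: r; apply: cmeanD => //; exact: cts_nearZ.
  have -> : cmean (fun z : C => d * normc z ^+ 2) c 1 r = d * cmean (fun z : C => normc z ^+ 2) c 1 r.
    by near: r; exact: cmeanZ.
  rewrite cmean_normc2 /F ler_ltD//; first by near: r; exact: mf.
  rewrite ltr_pM2l// ltrDl mulr1 normc_real exprn_gt0// normr_gt0 gt_eqF//.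
rewrite -[leRHS]pmean_cst; apply: le_pmean.
- by apply: circle_continuous; near: r; exact: (circle_near (1 : C) cFc).
- by move=> t; exact: cvg_cst.
- by move=> t _; apply: cmax; rewrite inE; move: t; near: r; exact: (circle_near (1 : C) (WN c Wc)).
Unshelve. all: by end_near. Qed.

(* The averages of f over N equally spaced rotations are again submean, so the
   maximum principle bounds f a by their maximum on the circle, which is a
   Riemann sum for the circle mean. *)
Lemma submean_disc f a r : 0 < r ->
  (forall z, normc (z - a) <= r -> {for z, continuous f}) ->
  (forall z, normc (z - a) < r -> submean_at f z) -> f a <= cmean f a 1 r.
Proof.
move=> r0 cf sf; apply/ler_addgt0Pr => e e0.
pose g t := f (a + (r%:C * cis t) *: (1 : C)).
have cg : continuous g.
  apply: circle_continuous => t; apply: cf.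
  by rewrite addrAC subrr add0r [_ *: _]mulr1 normcM normc_cis mulr1 normc_real gtr0_norm.
have pg : periodic2pi g by exact: circle_periodic.
have [N N0 H] := riemann_pmean cg pg e0.
have Nn0 : N%:R != 0 :> R by rewrite pnatr_eq0 -lt0n.
pose k j : R[i] := cis (j%:R * (2 * pi / N%:R)).
pose l j (z : C) : C := a + k j * (z - a).
have lc j : continuous (l j).
  move=> z; rewrite /l.
  apply: (@continuous_atD _ C C (fun=> a) (fun z => k j * (z - a))).
    exact: (@continuous_at_cst C C).
  apply: (@continuous_atZ _ C C (k j) (fun z => z - a)).
  apply: (@continuous_atB _ C C id (fun=> a)); first exact: (@continuous_at_id C).
  exact: (@continuous_at_cst C C).
have lE j z : normc (l j z - a) = normc (z - a).
  by rewrite /l addrAC subrr add0r normcM normc_cis mul1r.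
pose A (z : C) := N%:R^-1 * \sum_(j < N) f (l j z).
have Aa : A a = f a.
  rewrite /A (eq_bigr (fun=> f a)) => [|j _]; last by rewrite /l subrr mulr0 addr0.
  by rewrite sumr_const card_ord -(mulr_natl (f a)) mulKf.
rewrite -Aa.
apply: (@max_principle [set z : C | normc (z - a) <= r] [set z : C | normc (z - a) < r] A) => //=.
- apply: (@compact_complex _ _ (r + normc a)).
    have -> : [set z : C | normc (z - a) <= r] = (fun z : C => normc (z - a)) @^-1` [set x | x <= r] by [].
    apply: closed_comp; last exact: closed_le.
    move=> z _; refine (@continuous_fcomp C C R (fun z => z - a) (@normc R) z _ _).
      exact: (@continuous_atB _ C C id (fun=> a) z (@continuous_at_id C z) (@continuous_at_cst _ C C a z)).
    exact: normc_continuous.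
  move=> z /= zr; rewrite -(subrK a z); apply: le_trans (le_normcD _ _) _.
  by rewrite lerD2r.
- by move=> z /= /ltW.
- move=> z zr.
  apply: (@continuous_atZ R C R N%:R^-1 (fun z => \sum_(j < N) f (l j z))).
  apply: (@continuous_at_sum R C R N (fun j z => f (l j z))) => j _.
  by refine (@continuous_fcomp C C R (l j) f z (lc j z) (cf _ _)); rewrite lE.
- move=> z zr; apply: submeanZ; first by rewrite invr_ge0.
  apply: (submean_sum (F := fun j z => f (l j z))) => j _.
  apply: (@submean_comp R C C (l j) (fun v => k j * v) (lc j)); last by apply: sf; rewrite lE.
  move=> x c v; rewrite /l (_ : c *: v = c * v)// (_ : c *: _ = c * (k j * v))//.
  by rewrite addrAC !mulrDr mulrCA addrA.
- move=> z zr; apply/nearCP; exists (r - normc (z - a)); first by rewrite subr_gt0.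
  move=> y yz /=; rewrite (_ : y - a = (y - z) + (z - a)); last by rewrite addrA subrK.
  by apply: le_trans (le_normcD _ _) _; rewrite -lerBrDr ltW.
- move=> z zr /negP; rewrite -leNgt => rz.
  have {rz}zr' : normc (z - a) = r by apply/eqP; rewrite eq_le zr.
  (* With s the angle of z - a, A z is the Riemann sum of g starting at s. *)
  have [s sp zE] := polar (z - a); rewrite zr' in zE.
  have s2 : `|s| <= 2 * pi by apply: le_trans sp _; rewrite ler_peMl ?pi_ge0// ler1n.
  rewrite /cmean -/g; apply: le_trans (H s s2).
  rewrite /A le_eqVlt; apply/orP; left; apply/eqP; congr (_ * _).
  apply: eq_bigr => j _; rewrite /g /l zE /k [cis (s + _)]cisD [_ *: _]mulr1.
  by congr (f (_ + _)); ring.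
- by rewrite subrr normc0 ltW.
Qed.

Lemma circle_meanE f a r : (forall t, {for a + r%:C * cis t, continuous f}) ->
  circle_mean (fun z => (f z)%:E) a r = (cmean f a 1 r)%:E.
Proof.
move=> cf; rewrite /circle_mean /cmean /pmean EFinM /Rintegral.
have cg : continuous (fun t => f (a + (r%:C * cis t) *: (1 : C))).
  by apply: circle_continuous => t; rewrite [_ *: _]mulr1.
have E t : f (a + (r%:C * cis t) *: (1 : C)) = f (circle_point a r t).
  by rewrite [_ *: _]mulr1.
rewrite fineK; last by apply: integrable_fin_num => //; exact: (continuous_integrable _ _ cg).
by congr (_ * _)%E; apply: eq_integral => t _ /=; rewrite E.
Qed.

(** On the annulus s <= |z - q| <= rho, f is compared with f q + e + h ln (|z - q| / s): on the
    inner circle by continuity at q, on the outer one because f is bounded above. The point p lies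
    in the annulus, and h is so small that the logarithm contributes at most e' there. *)
Lemma liouville f (B : R) : (forall z, submean_at f z) -> (forall z, f z <= B) ->
  forall p q, f p = f q.
Proof.
move=> sf fB.
have cf z : {for z, continuous f} by case: (sf z) => /nbhs_singleton.
suff H p q : f p <= f q by move=> p q; apply/eqP; rewrite eq_le !H.
have [->//|pq] := eqVneq p q.
apply/ler_addgt0Pr => e e0.
have [d d0 fd] : exists2 d : R, 0 < d & forall y, normc (y - q) < d -> f y <= f q + e.
  have /continuous_distP/(_ _ e0)/nearCP[d d0 H] := cf q.
  exists d => // y /H; rewrite ltr_norml => /andP[+ _]; lra.
have npq : 0 < normc (p - q) by rewrite normc_gt0 subr_eq0.
pose s := Num.min (d / 2) (normc (p - q)).
have s0 : 0 < s by rewrite lt_min npq divr_gt0.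
have sd : s < d by rewrite gt_min ltr_pdivrMr// ltr_pMr// ltr1n.
have sp : s <= normc (p - q) by rewrite ge_min lexx orbT.
apply/ler_addgt0Pr => e' e'0.
have ln0 : 0 <= ln (normc (p - q) / s) by apply: ln_ge0; rewrite ler_pdivlMr// mul1r.
pose h := e' / (ln (normc (p - q) / s) + 1).
have h0 : 0 < h by rewrite divr_gt0// ltr_wpDl.
have hE : h * ln (normc (p - q) / s) <= e'.
  by rewrite /h mulrAC ler_pdivrMr ?ltr_wpDl// ler_wpM2l ?(ltW e'0)// lerDl.
(* Thus h ln T = |B| + |f q|, which dominates B - f q on the outer circle; rho >= s T by
   construction. *)
pose T := expR ((`|B| + `|f q|) / h).
have T1 : 1 <= T by rewrite -expR0 ler_expR divr_ge0 ?addr_ge0 ?(ltW h0).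
pose rho := s * T + normc (p - q).
pose F (z : C) := f z + (- h) * ln (normc (z - q)).
have cq : continuous (fun z : C => z - q : C).
  by move=> z; exact: (@continuous_atB _ C C id (fun=> q) z (@continuous_at_id C z) (@continuous_at_cst _ C C q z)).
have mln z : z != q -> mean_at (fun z : C => ln (normc (z - q))) z.
  move=> zq; apply: (@ln_affine_mean R C (fun z => z - q) (fun v => v)) => //.
    by move=> x c v; rewrite addrAC.
  by rewrite subr_eq0.
have nz z : s <= normc (z - q) -> z != q.
  by move=> h1; rewrite -subr_eq0 -normc_gt0; exact: lt_le_trans h1.
have cn : continuous (fun z : C => normc (z - q)).
  move=> z; refine (@continuous_fcomp C C R (fun z => z - q) (@normc R) z (cq z) _).
  exact: normc_continuous.
have HF z : s <= normc (z - q) <= rho -> F z <= f q + e - h * ln s.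
  apply: (@max_principle [set z : C | s <= normc (z - q) <= rho] [set z : C | s < normc (z - q) < rho] F) => //=.
  - apply: (@compact_complex _ _ (rho + normc q)).
      have -> : [set z : C | s <= normc (z - q) <= rho] = (fun z : C => normc (z - q)) @^-1` `[s, rho].
        by apply/seteqP; split => y /=; rewrite in_itv.
      apply: closed_comp; [by move=> z0 _; exact: cn|exact: interval_closed].
    move=> z' /= /andP[_ zr]; rewrite -(subrK q z'); apply: le_trans (le_normcD _ _) _.
    by rewrite lerD2r.
  - by move=> z' /= /andP[h1 h2]; rewrite !ltW.
  - move=> z' /andP[/nz z'q _]; apply: (cvgD (cf z')).
    by apply: cvgMr; case: (mln _ z'q) => /nbhs_singleton.
  - move=> z' /andP[/ltW/nz z'q _]; apply: submeanD; first exact: sf.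
    by apply: mean_submean; apply: meanZ; exact: mln.
  - move=> z' /andP[h1 h2].
    have hI : normc (z' - q) \in `]s, rho[ by rewrite in_itv/= h1.
    have : nbhs z' ((fun z : C => normc (z - q)) @^-1` [set` `]s, rho[]).
      by apply: cn; exact: near_in_itvoo.
    by apply: filterS => y; rewrite /= in_itv/= => /andP[? ?]; rewrite !ltW.
  - move=> z' /andP[h1 h2] nW.
    have n0 : 0 < normc (z' - q) by exact: lt_le_trans h1.
    have : normc (z' - q) = s \/ normc (z' - q) = rho.
      move: h1 h2; rewrite [s <= _]le_eqVlt [_ <= rho]le_eqVlt => /orP[/eqP->|h1]; first by left.
      by move=> /orP[/eqP->|h2]; [right|case: nW; rewrite h1].
    case=> E; rewrite /F E.
      by have := fd z'; rewrite E => /(_ sd); lra.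
    have lr : ln s + (`|B| + `|f q|) / h <= ln rho.
      rewrite -[X in _ + X]expRK -lnM ?posrE ?expR_gt0// -/T ler_ln ?posrE ?mulr_gt0 ?expR_gt0//.
        by rewrite /rho lerDl ltW.
      by rewrite /rho addr_gt0// mulr_gt0// expR_gt0.
    have : h * (ln s + (`|B| + `|f q|) / h) <= h * ln rho by rewrite ler_wpM2l// ltW.
    rewrite mulrDr mulrCA divff ?gt_eqF// mulr1 => h3.
    have := fB z'; have := ler_norm B; have := ler_norm (- f q); rewrite normrN; lra.
have := HF p; rewrite sp /= /rho lerDr mulr_ge0 ?(ltW s0) ?expR_ge0// => /(_ isT).
rewrite /F; move: hE; rewrite ln_div ?posrE//; lra.
Qed.

End MaxPrinciple.

Section ComplexLine.
Context {R : realType} {V : normedModType R[i]}.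
Implicit Types (phi : V -> R) (x v : V).

Lemma line_continuous x v : continuous (fun l : R[i]^o => x + l *: v).
Proof.
move=> l; apply: (@continuous_atD _ R[i]^o V (fun=> x) (fun l => l *: v)).
  exact: (@continuous_at_cst _ R[i]^o V).
exact: (@continuous_at_scale _ R[i]^o V id v l (@continuous_at_id _ l)).
Qed.

Lemma submean_line phi x v (l : R[i]^o) : submean_at phi (x + l *: v) ->
  submean_at (fun l : R[i]^o => phi (x + l *: v)) l.
Proof.
apply: (@submean_comp R R[i]^o V (fun l => x + l *: v) (fun k => k *: v)).
  exact: line_continuous.
by move=> y c w; rewrite scalerDl addrA scalerA.
Qed.

Lemma cmean_line phi x v r :
  cmean (fun l : R[i]^o => phi (x + l *: v)) 0 1 r = cmean phi x v r.
Proof.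
by congr pmean; apply/funext => t; rewrite add0r [_ *: (1 : R[i]^o)]mulr1.
Qed.

End ComplexLine.

(** * Plurisubharmonicity as a pointwise mean inequality *)

Section Psh.
Context {R : realType} {n : nat}.
Notation V := (Cspace R n).
Implicit Types (U : set V) (phi : V -> R) (x v : V).

Lemma disc_normE (z a : R[i]) (r : R) : (`|z - a| <= r%:C) = (normc (z - a) <= r).
Proof. by rewrite normc_norm lecR. Qed.

(** On each complex line [submean_disc] passes from small radii to every closed disc contained in
    the slice of U. *)
Lemma submean_psh U phi : (forall x, U x -> submean_at phi x) ->
  psh U (fun z => (phi z)%:E).
Proof.
move=> sf.
have cf x : U x -> {for x, continuous phi} by move=> /sf [/nbhs_singleton].
split.
- by move=> z _; rewrite ltry.
- move=> z Uz c; rewrite lte_fin => zc.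
  have : \forall y \near z, phi y < c by exact: (cvgr_lt _ (cf _ Uz)).
  by apply: filterS => y; rewrite lte_fin.
- move=> z w; split.
  + by move=> l _; rewrite ltry.
  + move=> l Ul c; rewrite lte_fin => lc.
    have : nbhs l ((fun l : R[i]^o => z + l *: w) @^-1` [set y | phi y < c]).
      by apply: line_continuous; exact: (cvgr_lt _ (cf _ Ul)).
    by apply: filterS => y; rewrite lte_fin.
  + move=> a r r0 aU; pose f (l : R[i]^o) := phi (z + l *: w).
    have sfl l : normc (l - a) <= r -> submean_at f l.
      move=> lr; apply: submean_line; apply: sf; apply: aU => /=.
      by rewrite disc_normE.
    have cfl l : normc (l - a) <= r -> {for l, continuous f}.
      by move=> /sfl [/nbhs_singleton].
    rewrite (circle_meanE (f := f)) ?lee_fin; last first.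
      by move=> t; apply: cfl; rewrite addrAC subrr add0r normcM normc_cis mulr1 normc_real gtr0_norm.
    by apply: submean_disc => // l lr; apply: sfl; exact: ltW.
Qed.

(** Small closed discs of the lines through x lie in U, so the definition applies to them;
    continuity turns its extended real integral into [cmean]. *)
Lemma psh_submean U phi : open U -> (forall x, U x -> {for x, continuous phi}) ->
  psh U (fun z => (phi z)%:E) -> forall x, U x -> submean_at phi x.
Proof.
move=> oU cf [_ _ sf] x Ux.
have Un : \forall y \near x, U y by exact: open_nbhs_nbhs.
split; first by apply: filterS Un => y; exact: cf.
move=> v; have /nearVP [e e0 eU] := Un.
have n0 : 0 < nrm v + 1 by rewrite ltr_wpDl// nrm_ge0.
near=> r.
have r0 : 0 < r by near: r; exact: nbhs_right_gt.
have re : r * (nrm v + 1) < e.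
  rewrite -ltr_pdivlMr//; near: r; apply: nbhs_right_lt; exact: divr_gt0.
have Ul (l : R[i]) : normc l <= r -> U (x + l *: v).
  move=> lr; apply: eU; rewrite addrAC subrr add0r nrmZ.
  apply: le_lt_trans re; apply: ler_pM; rewrite ?normc_ge0 ?nrm_ge0//.
  by rewrite lerDl.
have [_ _ /(_ 0 r r0)] := sf x v.
have D : [set z : R[i]^o | `|z - 0| <= r%:C] `<=` [set l | U (x + l *: v)].
  by move=> l /=; rewrite disc_normE subr0; exact: Ul.
move=> /(_ D); rewrite scale0r addr0 (circle_meanE (f := fun l => phi (x + l *: v))).
  by rewrite lee_fin cmean_line.
move=> t; rewrite add0r.
refine (@continuous_fcomp R[i]^o V R (fun l => x + l *: v) phi (r%:C * cis t) (@line_continuous _ _ x v _) _).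
by apply: cf; apply: Ul; rewrite normcM normc_cis mulr1 normc_real gtr0_norm.
Unshelve. all: by end_near. Qed.

End Psh.

(** * The Hopf boundary lemma on the unit disc *)

Section Hopf.
Context {R : realType}.
Notation C := (R[i]^o).
(** Outside the closed disc, g enters only through its derivative at 1 along the real axis and its
    values at points 1 + t with t > 0 tending to 0; in the application these points are the real
    poles. *)
Variables (g : C -> R) (c : R).
Hypothesis cg : forall z : C, normc z <= 1 -> {for z, continuous g}.
Hypothesis sg : forall z : C, normc z < 1 -> submean_at g z.
Hypothesis gc : forall z : C, normc z = 1 -> g z = c.
Hypothesis dg : derivable (fun t : R => g (1 + t%:C) : R) 0 1.
Hypothesis gt : forall d : R, 0 < d -> exists2 t : R, 0 < t < d & g (1 + t%:C) = c.

Let near_lt (s : R) (z : C) : normc z < s -> \forall y \near z, normc y < s.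
Proof. by move=> zs; exact: (cvgr_lt _ (@normc_continuous R z)). Qed.

Let near_gt (s : R) (z : C) : s < normc z -> \forall y \near z, s < normc y.
Proof. by move=> zs; exact: (cvgr_gt _ (@normc_continuous R z)). Qed.

Let closed_annulus (s t : R) : compact [set z : C | s <= normc z <= t].
Proof.
apply: (@compact_complex _ _ t); last by move=> z /= /andP[].
have -> : [set z : C | s <= normc z <= t] = (@normc R : C -> R) @^-1` `[s, t].
  by apply/seteqP; split => y /=; rewrite in_itv.
apply: closed_comp; [by move=> z0 _; exact: normc_continuous|exact: interval_closed].
Qed.

Let g_le z : normc z <= 1 -> g z <= c.
Proof.
move=> z1; apply: (@max_principle _ [set z : C | 0 <= normc z <= 1] [set z : C | normc z < 1] g).
- exact: closed_annulus.
- by move=> y /= /ltW ->; rewrite normc_ge0.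
- by move=> y /= /andP[_]; exact: cg.
- exact: sg.
- by move=> y /= /near_lt; apply: filterS => w /= /ltW ->; rewrite normc_ge0.
- move=> y /= /andP[_ y1] /negP; rewrite -leNgt => y1'.
  by rewrite gc//; apply/eqP; rewrite eq_le y1.
- by rewrite /= normc_ge0.
Qed.

(* Otherwise g <= c + h ln |z| on an annulus for some h > 0, and the derivative
   at 1 along the real axis is at least h, whereas [dg] and [gt] make it 0. *)
Let g0 : g 0 = c.
Proof.
apply/eqP; rewrite eq_le g_le ?normc0//= leNgt; apply/negP => gc0.
pose e := (c - g 0) / 2.
have e0 : 0 < e by rewrite divr_gt0 ?subr_gt0.
have [s /andP[s0 s1] gs] : exists2 s : R, 0 < s < 1 & forall y : C, normc y <= s -> g y <= c - e.
  have c0 : {for (0 : C), continuous g} by apply: cg; rewrite normc0.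
  have /continuous_distP/(_ _ e0)/nearCP[d d0 H] := c0.
  exists (Num.min (d / 2) 2^-1).
    by rewrite lt_min divr_gt0// invr_gt0 ltr0n/= gt_min invf_lt1// ltr1n orbT.
  move=> y yd; have yd' : normc (y - 0) < d.
    rewrite subr0 (le_lt_trans yd)// gt_min ltr_pdivrMr// ltr_pMr// ltr1n//.
  have := H _ yd'; rewrite ltr_norml => /andP[+ _]; rewrite /e; lra.
have ls : 0 < - ln s by rewrite oppr_gt0 ln_lt0// s0.
(* Since h ln s = - e, the bound g <= c - e on the inner circle says exactly that F <= c there. *)
pose h := e / (- ln s).
have h0 : 0 < h by rewrite divr_gt0.
have hE : h * ln s = - e.
  by apply: oppr_inj; rewrite -mulrN /h divfK ?gt_eqF// opprK.
pose F (z : C) := g z + (- h) * ln (normc z).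
have mln (z : C) : z != 0 -> mean_at (fun z : C => ln (normc z)) z.
  by move=> z0; apply: (@ln_affine_mean R C id id) => //; move=> y; exact: cvg_id.
have nz (z : C) : s <= normc z -> z != 0.
  by move=> h1; rewrite -normc_gt0; exact: lt_le_trans h1.
have HF (z : C) : s <= normc z <= 1 -> F z <= c.
  apply: (@max_principle _ [set z : C | s <= normc z <= 1] [set z : C | s < normc z < 1] F) => //.
  - by move=> y /= /andP[h1 h2]; rewrite !ltW.
  - move=> y /andP[/nz y0 y1]; apply: (cvgD (cg y1)).
    by apply: cvgMr; case: (mln _ y0) => /nbhs_singleton.
  - move=> y /andP[/ltW/nz y0 y1]; apply: submeanD; first exact: sg.
    by apply: mean_submean; apply: meanZ; exact: mln.
  - move=> y /andP[/near_gt h1 /near_lt h2]; apply: filterS2 h1 h2 => w h1 h2 /=.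
    by rewrite !ltW.
  - move=> y /andP[h1 h2] nW.
    have : normc y = s \/ normc y = 1.
      move: h1 h2; rewrite [s <= _]le_eqVlt [_ <= 1]le_eqVlt => /orP[/eqP->|h1]; first by left.
      by move=> /orP[/eqP->|h2]; [right|case: nW; rewrite /= h1 h2].
    case=> E; rewrite /F E.
      by have := gs y; rewrite E => /(_ (lexx _)); rewrite mulNr hE; lra.
    by rewrite ln1 mulr0 addr0 gc.
have g1 : g 1 = c by rewrite gc// normc1.
have Hneg t : s - 1 <= t < 0 -> g (1 + t%:C) <= c + h * t.
  move=> /andP[t1 t0]; have t1' : 0 < 1 + t by lra.
  have nE : normc (1 + t%:C) = 1 + t.
    by rewrite -(rmorphD (real_complex R) 1 t) normc_real gtr0_norm.
  have := HF (1 + t%:C); rewrite /F nE => /(_ _) H.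
  have {}H := H ltac:(apply/andP; lra).
  have := le_ln1Dx (_ : -1 < t) => /(_ ltac:(lra)) l1.
  have : h * ln (1 + t) <= h * t by rewrite ler_wpM2l// ltW.
  lra.
have [dv dE] : exists dv : R, forall e : R, 0 < e -> exists2 d : R, 0 < d &
    forall t : R, t != 0 -> `|t| < d -> `|dv - t^-1 * (g (1 + t%:C) - c)| < e.
  exists ('D_1 (fun t : R => g (1 + t%:C) : R) 0) => e' e'0.
  have := dg; rewrite /derivable /derive => /cvgrPdist_lt /(_ _ e'0).
  case=> d /= d0 H; exists d => // t t0 td.
  have := H t; rewrite /ball_/= sub0r normrN => /(_ td t0).
  by rewrite addr0 [_ *: 1]mulr1 addr0 g1.
have dv0 : dv = 0.
  apply/eqP; rewrite -normr_eq0 eq_le normr_ge0 andbT.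
  apply/ler_addgt0Pr => e' e'0; rewrite add0r.
  have [d d0 H] := dE _ e'0; have [t /andP[t0 td] gtc] := gt d0.
  have := H t; rewrite gtr0_norm// gt_eqF// gtc subrr mulr0 subr0 => /(_ isT td).
  exact: ltW.
have [d d0 H] := dE _ h0.
pose t := - Num.min (d / 2) (1 - s).
have t0 : t < 0 by rewrite /t oppr_lt0 lt_min divr_gt0// subr_gt0.
have td : `|t| < d.
  by rewrite ltr0_norm// /t opprK gt_min ltr_pdivrMr// ltr_pMr// ltr1n.
have t1 : s - 1 <= t by rewrite /t lerNr opprB ge_min lexx orbT.
have := H t; rewrite lt_eqF// => /(_ isT td); rewrite dv0 sub0r normrN.
have := Hneg t; rewrite t1 t0 => /(_ isT) H1.
have : h <= t^-1 * (g (1 + t%:C) - c).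
  have -> : h = t^-1 * (h * t) by rewrite mulrCA mulVf ?mulr1// lt_eqF.
  by rewrite ler_nM2l ?invr_lt0//; lra.
move=> H2 /(le_lt_trans (ler_norm _)); rewrite ltNge H2//.
Qed.

(** The maximum c is attained at the centre, so every circle mean reaches it, which forces g = c
    along the whole circle. *)
Lemma hopf_disc z : normc z <= 1 -> g z = c.
Proof.
rewrite le_eqVlt => /orP[/eqP/gc//|z1].
have [->|z0] := eqVneq z 0; first exact: g0.
have r0 : 0 < normc z by rewrite normc_gt0.
have [s _ zE] := polar z.
pose f t := g (0 + (normc z)%:C * cis t *: (1 : C)).
have nE t : normc (0 + (normc z)%:C * cis t *: (1 : C)) = normc z.
  by rewrite add0r [_ *: _]mulr1 normcM normc_cis mulr1 normc_real gtr0_norm.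
have cf : continuous f.
  by apply: circle_continuous => t; apply: cg; rewrite nE ltW.
have fc t : f t <= c by apply: g_le; rewrite nE ltW.
have cm : c <= pmean f.
  rewrite -g0; apply: (@submean_disc R g 0 (normc z)) => //.
    by move=> y; rewrite subr0 => yz; apply: cg; rewrite (le_trans yz)// ltW.
  by move=> y; rewrite subr0 => yz; apply: sg; exact: lt_trans z1.
have := pmean_max_eq cf (circle_periodic _ _ _ _) fc cm s.
by rewrite /f add0r [_ *: _]mulr1 -zE.
Qed.

End Hopf.

Section Coord.
Context {R : realType} {n : nat}.
Notation V := (Cspace R n).
Implicit Types x : V.

Lemma coordC_continuous (j : 'I_n) : continuous (fun x : V => x 0 j : R[i]^o).
Proof. by move=> x; exact: coord_continuous. Qed.

Lemma coord_affine (j : 'I_n) (x : V) (c : R[i]) (v : V) :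
  (x + c *: v) 0 j = x 0 j + c * v 0 j.
Proof. by rewrite !mxE. Qed.

(** The squared Euclidean norm, which is smooth, unlike the maximum norm that row vectors carry. *)
Definition sqn (x : V) : R := \sum_(j < n) normc (x 0 j) ^+ 2.

Lemma sqn_submean x : submean_at sqn x.
Proof.
pose F (k : nat) (y : V) : R := if insub k is Some j then normc (y 0 j) ^+ 2 else 0.
have -> : sqn = fun y => \sum_(k < n) F k y.
  apply/funext => y; apply: eq_bigr => j _; rewrite /F.
  by rewrite (_ : insub (nat_of_ord j) = Some j) ?valK.
apply: submean_sum => k kn; rewrite /F; case: insubP => [j _ _|]; last by rewrite kn.
apply: (@normc2_affine_submean R V (fun y => y 0 j) (fun v => v 0 j)).
  exact: coordC_continuous.
by move=> *; rewrite coord_affine.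
Qed.

Lemma sqn_ge0 x : 0 <= sqn x.
Proof. by apply: sumr_ge0 => j _; rewrite sqr_ge0. Qed.

Lemma sqn_coord x (j : 'I_n) : normc (x 0 j) ^+ 2 <= sqn x.
Proof.
by rewrite /sqn (bigD1 j)//= lerDl; apply: sumr_ge0 => i _; rewrite sqr_ge0.
Qed.

Lemma compact_sqn (A : set V) (B : R) : closed A -> (forall x, A x -> sqn x <= B) ->
  compact A.
Proof.
move=> cA AB.
apply: (@subclosed_compact _ _ [set v : V | forall j, [set z : R[i]^o | normc z <= Num.sqrt B] (v 0 j)]) => //.
  apply: (@rV_compact R[i]^o n (fun=> [set z | normc z <= Num.sqrt B])) => j.
  apply: (@compact_complex _ _ (Num.sqrt B)) => //.
  have -> : [set z : R[i]^o | normc z <= Num.sqrt B] = (@normc R : R[i]^o -> R) @^-1` [set t | t <= Num.sqrt B] by [].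
  apply: closed_comp; last exact: closed_le.
  by move=> z _; exact: normc_continuous.
move=> x /AB xB j /=; rewrite -[normc _]ger0_norm ?normc_ge0// -sqrtr_sqr.
by rewrite ler_wsqrtr// (le_trans (sqn_coord x j)).
Qed.

End Coord.

(** * Pseudoconvexity of increasing unions of sublevel sets *)

Section Exhaustion.
Context {R : realType} {n : nat}.
Notation V := (Cspace R n).
Implicit Types x : V.
Variable F : nat -> V -> R.
Hypothesis sF : forall m x, submean_at (F m) x.
Hypothesis dF : forall m x, F m.+1 x + 2^-1 ^+ m.+1 <= F m x.

Let cF m : continuous (F m).
Proof. by move=> x; exact/submean_continuous/sF. Qed.

Let F_homo m k x : (m <= k)%N -> F k x <= F m x.
Proof.
elim: k => [|k IH]; first by rewrite leqn0 => /eqP ->.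
rewrite leq_eqVlt => /orP[/eqP ->//|/IH]; apply: le_trans.
by apply: le_trans (dF k x); rewrite lerDl exprn_ge0.
Qed.

Definition increasing_union : set V := [set x | exists m, F m x < 0].

Lemma open_increasing_union : open increasing_union.
Proof.
rewrite openE => x [m Fm]; have : \forall y \near x, F m y < 0.
  exact: (cvgr_lt _ (@cF m x)).
by apply: filterS => y ?; exists m.
Qed.

Let S N x : R := \sum_(m < N) 4 ^+ m * Num.max 0 (F m x).
Let rho x : R := sqn x + limn (fun N => S N x).

Let S_ge0 N x : 0 <= S N x.
Proof. by apply: sumr_ge0 => m _; rewrite mulr_ge0 ?exprn_ge0// le_max lexx. Qed.

Let S_cst m k x : F m x < 0 -> (m <= k)%N -> S k x = S m x.
Proof.
move=> Fm /subnK <-; elim: (k - m)%N => // j IH.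
rewrite addSn /S big_ord_recr/= -/(S _ _) IH max_l ?mulr0 ?addr0//.
by apply: le_trans (ltW Fm); exact/F_homo/leq_addl.
Qed.

Let rhoE m x : F m x < 0 -> rho x = sqn x + S m x.
Proof.
move=> Fm; congr (_ + _); apply/cvg_lim => //.
apply: cvg_near_cst; exists m => // k /= mk; exact: S_cst.
Qed.

Let rho_submean x : increasing_union x -> submean_at rho x.
Proof.
move=> [m Fm]; apply: (@submean_eq _ _ (fun y => sqn y + S m y)).
  have : \forall y \near x, F m y < 0 by exact: (cvgr_lt _ (@cF m x)).
  by apply: filterS => y Fy; rewrite (rhoE Fy).
apply: submeanD; first exact: sqn_submean.
apply: (submean_sum (F := fun k y => 4 ^+ k * Num.max 0 (F k y))) => k _.
apply: submeanZ; first exact: exprn_ge0.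
by apply: submean_max; [exact: submean_cst|exact: sF].
Qed.

Let rho_bounds x (c : R) : increasing_union x -> rho x < c ->
  sqn x <= c /\ forall k, F k x <= c * 4^-1 ^+ k.
Proof.
move=> [m Fm]; rewrite (rhoE Fm) => rc.
have s0 := sqn_ge0 x; have S0 := S_ge0 m x.
split; first lra.
move=> k; have [km|mk] := ltnP k m; last first.
  apply: le_trans (F_homo _ mk) _; apply: le_trans (ltW Fm) _.
  by rewrite mulr_ge0 ?exprn_ge0 ?invr_ge0//; lra.
rewrite exprVn ler_pdivlMr ?exprn_gt0// mulrC.
have : 4 ^+ k * Num.max 0 (F k x) <= S m x.
  rewrite /S (bigD1 (Ordinal km))//= lerDl; apply: sumr_ge0 => j _.
  by rewrite mulr_ge0 ?exprn_ge0// le_max lexx.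
have : 4 ^+ k * F k x <= 4 ^+ k * Num.max 0 (F k x).
  by rewrite ler_wpM2l ?exprn_ge0// le_max lexx orbT.
lra.
Qed.

(* The exhaustion is |x|^2 + sum_m 4^m max(0, F_m x): near a point where
   F_m < 0 only the terms of index less than m survive. *)
Lemma pseudoconvex_increasing_union (Omega : set V) : Omega `<=` increasing_union ->
  (forall x, increasing_union x -> closure Omega x -> Omega x) ->
  pseudoconvex Omega.
Proof.
move=> sub cl; exists rho.
  split; last by split => // x /sub /rho_submean /submean_continuous.
  by apply: submean_psh => x /sub; exact: rho_submean.
(* These conditions are closed, so they pass to the closure of the sublevel set, whose points are
   not yet known to lie in Omega. *)
move=> c S0; pose T := [set x : V | sqn x <= c] `&` [set x | forall k, F k x <= c * 4^-1 ^+ k].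
have closedT : closed T.
  apply: closedI.
    have -> : [set x : V | sqn x <= c] = sqn @^-1` [set t | t <= c] by [].
    apply: closed_comp; last exact: closed_le.
    by move=> x _; exact/submean_continuous/sqn_submean.
  have -> : [set x : V | forall k, F k x <= c * 4^-1 ^+ k] =
      \bigcap_k (F k @^-1` [set t | t <= c * 4^-1 ^+ k]).
    by apply/seteqP; split => x /= H; [move=> k _; exact: H|move=> k; exact: H].
  apply: closed_bigI => k _; apply: closed_comp; last exact: closed_le.
  by move=> x _; exact: cF.
have ST : closure S0 `<=` T.
  have -> : T = closure T by exact: (closure_id T).1 closedT.
  apply: closure_subset => x [Ox rx].
  by have [h1 h2] := rho_bounds (sub _ Ox) rx; split.
split.
  by apply: (@compact_sqn _ _ _ c); [exact: closed_closure|move=> x /ST []].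
move=> x cx; have [sx Fx] := ST _ cx.
apply: cl; last by move: cx; apply: closure_subset => y [].
have c0 : 0 <= c := le_trans (sqn_ge0 x) sx.
(* As 2 c < k < 2^k, the bound c 4^-k on F_k is less than the margin 2^-(k+1), so F_(k+1) is
   negative. *)
pose k := (Num.truncn (2 * c)).+1.
exists k.+1; have := dF k x; have := Fx k.
have E : c * 4^-1 ^+ k < 2^-1 ^+ k.+1.
  rewrite exprS -ltr_pdivrMl// invrK.
  have -> : 4^-1 = 2^-1 * 2^-1 :> R by rewrite -invfM -natrM.
  rewrite exprMn !mulrA -[ltRHS]mul1r ltr_pM2r ?exprn_gt0//.
  rewrite exprVn ltr_pdivrMr ?exprn_gt0// mul1r.
  apply: (@lt_trans _ _ k%:R); first by rewrite /k truncnS_gt.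
  by rewrite -natrX ltr_nat ltn_expl.
lra.
Qed.

End Exhaustion.

(** * The poles and the function psi *)

Section Points.
Context {R : realType}.

Definition gap (j : nat) : R := 2^-1 ^+ j.+2.

Lemma gap_gt0 j : 0 < gap j.
Proof. by rewrite exprn_gt0. Qed.

Lemma gap_le j : gap j <= 4^-1.
Proof.
have -> : 4^-1 = 2^-1 ^+ 2 :> R by rewrite exprVn -natrX.
by apply: ler_wiXn2l => //; rewrite ?invr_ge0// invf_le1// ler1n.
Qed.

(** The value 1 at z = 0 makes this a unit vector in all cases, so that |a_j| = 1 + gap j holds for
    every code j. *)
Definition direction (z : R[i]) : R[i] := if z == 0 then 1 else z / (normc z)%:C.

Lemma normc_direction z : normc (direction z) = 1.
Proof.
rewrite /direction; case: eqVneq => [_|z0]; first exact: normc1.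
by rewrite normcM -(fmorphV (real_complex R)) normc_real ger0_norm ?invr_ge0 ?normc_ge0// divff// normc_eq0.
Qed.

Definition rational_point (p : rat * rat * nat) : R[i] := ratr p.1.1 +i* ratr p.1.2.

(* pickle enumerates rat * rat * nat, so each direction with rational
   coordinates is used infinitely often, i.e. with arbitrarily small gap. *)
Definition pole (j : nat) : R[i] :=
  (1 + gap j)%:C * direction (if unpickle j is Some p then rational_point p else 1).

Lemma normc_pole j : normc (pole j) = 1 + gap j.
Proof.
by rewrite normcM normc_direction mulr1 normc_real ger0_norm// addr_ge0// ltW// gap_gt0.
Qed.

(** [pickle] is injective, so the N + 1 codes of (p, q, k) with k <= N cannot all be less than N. *)
Lemma pole_infinitely_often (p q : rat) (N : nat) : exists2 j, (N <= j)%N &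
  pole j = (1 + gap j)%:C * direction (ratr p +i* ratr q).
Proof.
pose f (k : 'I_N.+1) := pickle (p, q, nat_of_ord k).
have [k Nk] : exists k : 'I_N.+1, (N <= f k)%N.
  apply: contrapT => /forallNP H.
  have lt k : (f k < N)%N by rewrite ltnNge; apply/negP; exact: H.
  pose g (k : 'I_N.+1) : 'I_N := Ordinal (lt k).
  have gi : injective g.
    move=> k1 k2 /(congr1 val) /= /(pcan_inj pickleK) [] e; exact: val_inj.
  by have := leq_card g gi; rewrite !card_ord ltnn.
by exists (f k) => //; rewrite /pole /f pickleK.
Qed.

Lemma gap_small (e : R) : 0 < e -> exists N, forall j, (N <= j)%N -> gap j < e.
Proof.
move=> e0; exists (Num.truncn e^-1).+1 => j Nj.
rewrite /gap exprVn invf_plt ?posrE ?exprn_gt0//.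
apply: (@lt_le_trans _ _ (Num.truncn e^-1).+1%:R); first exact: truncnS_gt.
rewrite -natrX ler_nat (leq_trans Nj)//.
have j2 : (j < 2 ^ j)%N by rewrite ltn_expl.
by apply: ltnW; apply: leq_trans j2 _; rewrite leq_exp2l// -addn2 leq_addr.
Qed.

Lemma pole_real (d : R) : 0 < d -> exists2 j, gap j < d & pole j = (1 + gap j)%:C.
Proof.
move=> d0; have [N HN] := gap_small d0.
have [j Nj E] := pole_infinitely_often 1 0 N.
exists j; first exact: HN.
rewrite E rmorph1 rmorph0 /direction (_ : 1 +i* 0 = 1)// oner_eq0 normc1.
by rewrite divr1 mulr1.
Qed.

(** For a rational z near k the error is made of the gap, the normalisation of z and z - k, which
    are less than d, 2 d and 2 d. The bound d <= 1/4 keeps z away from 0. *)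
Lemma pole_dense (k : R[i]) (e : R) : normc k = 1 -> 0 < e ->
  exists j, normc (pole j - k) < e.
Proof.
move=> k1 e0; pose d := Num.min (e / 8) 4^-1.
have d0 : 0 < d by rewrite lt_min divr_gt0//= invr_gt0.
have d4 : d <= 4^-1 by rewrite ge_min lexx orbT.
have de : d <= e / 8 by rewrite ge_min lexx.
have [N HN] := gap_small d0.
have [p /andP[p1 p2]] : exists p : rat, complex.Re k - d < ratr p < complex.Re k + d.
  have [|p] := @rat_in_itvoo R (complex.Re k - d) (complex.Re k + d); first lra.
  by rewrite in_itv/=; exists p.
have [q /andP[q1 q2]] : exists q : rat, complex.Im k - d < ratr q < complex.Im k + d.
  have [|q] := @rat_in_itvoo R (complex.Im k - d) (complex.Im k + d); first lra.
  by rewrite in_itv/=; exists q.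
have [j Nj E] := pole_infinitely_often p q N.
have gj := HN _ Nj; have g0 := gap_gt0 j.
exists j; rewrite E; set z := (ratr p +i* ratr q) : R[i].
have zk : normc (z - k) < 2 * d.
  apply: le_lt_trans (normc_le _) _; rewrite /z; case: (k) p1 p2 q1 q2 => a b /= p1 p2 q1 q2.
  rewrite mulr_natl mulr2n; apply: ltrD; rewrite ltr_norml; apply/andP; split; lra.
have nz : `|normc z - 1| < 2 * d.
  by apply: le_lt_trans zk; rewrite -[X in _ - X]k1 normc_dist.
have z0 : z != 0.
  apply/negP => /eqP z0; move: nz; rewrite z0 normc0 sub0r normrN1; lra.
have nz0 : 0 < normc z by rewrite normc_gt0.
rewrite /direction (negbTE z0).
have -> : (1 + gap j)%:C * (z / (normc z)%:C) - k =
  (gap j)%:C * (z / (normc z)%:C) + ((1 - normc z)%:C * (z / (normc z)%:C) + (z - k)).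
  rewrite (rmorphD (real_complex R)) (rmorphB (real_complex R)) (rmorph1 (real_complex R)) !mulrDl !mul1r.
  have nq : (normc z)%:C * (z / (normc z)%:C) = z.
    by rewrite mulrC divfK// (fmorph_eq0 (real_complex R)) gt_eqF.
  by rewrite mulNr nq; ring.
have nd : normc (z / (normc z)%:C) = 1.
  by have := normc_direction z; rewrite /direction (negbTE z0).
apply: le_lt_trans (le_normcD _ _) _; rewrite normcM nd mulr1 normc_real gtr0_norm//.
apply: (@lt_le_trans _ _ (d + (2 * d + 2 * d))); last by lra.
apply: ltrD => //; apply: le_lt_trans (le_normcD _ _) _; rewrite normcM nd mulr1 normc_real.
by apply: ltrD => //; rewrite distrC.
Qed.

End Points.

(** * Uniform limits and geometric series *)

Section UniformLimit.
Context {R : realType} {V : normedModType R[i]}.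
Implicit Types (f g : V -> R) (x v : V).

Lemma continuous_unif_limit f : (forall e : R, 0 < e ->
  exists2 g, continuous g & forall y, `|f y - g y| <= e) -> continuous f.
Proof.
move=> H x; apply/continuous_distP => e e0.
have e4 : 0 < e / 4 by rewrite divr_gt0.
have [g cg gf] := H _ e4; have /continuous_distP /(_ _ e4) := cg x.
apply: filterS => y gxy.
have -> : f x - f y = (f x - g x) + (g x - g y) - (f y - g y) by ring.
apply: le_lt_trans (ler_normB _ _) _.
have := ler_normD (f x - g x) (g x - g y); have := gf x; have := gf y; lra.
Qed.

Lemma submean_circle f x v r : (forall y, submean_at f y) -> 0 < r -> f x <= cmean f x v r.
Proof.
move=> sf r0.
have := @submean_disc R (fun l : R[i]^o => f (x + l *: v)) 0 r r0.
rewrite scale0r addr0 cmean_line => H.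
have sl z : submean_at (fun l : R[i]^o => f (x + l *: v)) z by exact: submean_line (sf _).
by apply: H => z _ //; exact: submean_continuous.
Qed.

(** The approximants are submean at every point, so [submean_circle] gives their inequality at every
    radius; the radius then does not depend on the approximant. *)
Lemma submean_unif_limit f : (forall e : R, 0 < e ->
  exists2 g, (forall y, submean_at g y) & forall y, `|f y - g y| <= e) ->
  forall x, submean_at f x.
Proof.
move=> H x; have cf : continuous f.
  apply: continuous_unif_limit => e /H[g sg gf]; exists g => // y.
  exact: submean_continuous.
split; first exact: continuous_cts_near.
move=> v; near=> r.
have r0 : 0 < r by near: r; exact: nbhs_right_gt.
apply/ler_addgt0Pr => e e0; have e2 : 0 < e / 2 by rewrite divr_gt0.
have [g sg gf] := H _ e2.
have h1 := submean_circle x v sg r0.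
have cg : continuous g by move=> y; exact: submean_continuous.
have h2 : cmean g x v r <= cmean (fun y => f y + e / 2) x v r.
  apply: le_pmean => [||t _].
  - by apply: circle_continuous => t; exact: cg.
  - apply: (@circle_continuous _ _ (fun y => f y + e / 2)) => t.
    by apply: (@continuous_atD _ V R f (fun=> e / 2)); [exact: cf|exact: continuous_at_cst].
  - have := gf (x + (r%:C * cis t) *: v); rewrite ler_norml; lra.
have h3 : cmean (fun y => f y + e / 2) x v r = cmean f x v r + e / 2.
  rewrite /cmean pmeanD ?pmean_cst//; first by apply: circle_continuous => t; exact: cf.
  by move=> t; exact: cvg_cst.
have := gf x; rewrite ler_norml; lra.
Unshelve. all: by end_near. Qed.

End UniformLimit.

Section GeometricSeries.
Context {R : realType}.
Variables (f : nat -> R) (B : R).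
Hypothesis f0 : forall j, 0 <= f j <= B.

Definition gsum (n : nat) : R := \sum_(j < n) 2^-1 ^+ j.+1 * f j.

Lemma gsum_nd : nondecreasing_seq gsum.
Proof.
apply/nondecreasing_seqP => n; rewrite /gsum big_ord_recr/= lerDl.
by rewrite mulr_ge0 ?exprn_ge0//; case/andP: (f0 n).
Qed.

Lemma gsum_tail n k : gsum (n + k) <= gsum n + B * (2^-1 ^+ n - 2^-1 ^+ (n + k)).
Proof.
elim: k => [|k IH]; first by rewrite addn0 subrr mulr0 addr0.
rewrite addnS {1}/gsum big_ord_recr/= -/(gsum _) exprS.
have : 2^-1 * 2^-1 ^+ (n + k) * f (n + k) <= 2^-1 * 2^-1 ^+ (n + k) * B.
  by apply: ler_wpM2l; rewrite ?mulr_ge0 ?exprn_ge0//; case/andP: (f0 (n + k)).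
by move: IH; rewrite !mulrBr; set u := _ ^+ (n + k); lra.
Qed.

Lemma gsum_ub n k : gsum k <= gsum n + B * 2^-1 ^+ n.
Proof.
have B0 : 0 <= B by case/andP: (f0 0) => h /(le_trans h).
have [kn|/ltnW nk] := leqP k n.
  by apply: le_trans (gsum_nd kn) _; rewrite lerDl mulr_ge0 ?exprn_ge0.
rewrite -(subnKC nk); apply: le_trans (gsum_tail _ _) _.
by rewrite lerD2l ler_wpM2l// gerBl exprn_ge0.
Qed.

Lemma gsum_cvg : cvgn gsum.
Proof.
apply: nondecreasing_is_cvgn; first exact: gsum_nd.
by exists (gsum 0 + B * 2^-1 ^+ 0) => _ [n _ <-]; exact: gsum_ub.
Qed.

Lemma gsum_lim n : gsum n <= limn gsum <= gsum n + B * 2^-1 ^+ n.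
Proof.
apply/andP; split; first exact: (nondecreasing_cvgn_le gsum_nd gsum_cvg).
by apply: limr_le; [exact: gsum_cvg|near=> k; exact: gsum_ub].
Unshelve. all: by end_near. Qed.

End GeometricSeries.

(** * Dents with a logarithmic profile *)

Section Dent.
Context {R : realType}.
Notation C := (R[i]^o).
Implicit Types p : R.
Variable s : R.
Hypothesis s01 : 0 < s <= 1.

Let s0 : 0 < s. Proof. by case/andP: s01. Qed.

(* For |z - a| = p, |z|^2 - p^2 is harmonic, and |z|^2 - dent s p is
   obtained from it by adding p^2 if p >= s and the tangent logarithm
   s^2 + 2 s^2 ln (p / s) if p <= s.  The logarithm is truncated at the radius
   where the dent has depth 2 at the centre, whatever s is. *)
Definition dent_radius (s : R) : R := s * expR (- ((s ^+ 2 + 2) / (2 * s ^+ 2))).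

Lemma dent_radius_gt0 : 0 < dent_radius s.
Proof. by rewrite mulr_gt0// expR_gt0. Qed.

Lemma dent_radius_lt : dent_radius s < s.
Proof.
rewrite /dent_radius gtr_pMr// expR_lt1 oppr_lt0 divr_gt0// ?mulr_gt0 ?exprn_gt0//.
by rewrite addr_gt0 ?exprn_gt0.
Qed.

Lemma ln_dent_radius : 2 * s ^+ 2 * (ln (dent_radius s) - ln s) = - (s ^+ 2 + 2).
Proof.
rewrite lnM ?posrE ?expR_gt0// expRK addrAC subrr add0r mulrN mulrC divfK//.
by rewrite gt_eqF// mulr_gt0// exprn_gt0.
Qed.

Definition dent (s p : R) : R := p ^+ 2 - Num.max p s ^+ 2
  - 2 * s ^+ 2 * (ln (Num.max (Num.min p s) (dent_radius s)) - ln s).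

Lemma dent_out p : s <= p -> dent s p = 0.
Proof.
move=> sp; rewrite /dent max_l// min_r// max_l ?(ltW dent_radius_lt)//.
by rewrite !subrr mulr0 subr0.
Qed.

Lemma dent_mid p : dent_radius s <= p <= s ->
  dent s p = p ^+ 2 - s ^+ 2 - 2 * s ^+ 2 * (ln p - ln s).
Proof. by move=> /andP[rp ps]; rewrite /dent max_r// min_l// max_l. Qed.

Lemma dent_in p : p <= dent_radius s -> dent s p = p ^+ 2 + 2.
Proof.
move=> pr; have ps : p <= s := le_trans pr (ltW dent_radius_lt).
by rewrite /dent max_r// min_l// max_r// ln_dent_radius; lra.
Qed.

(** This is ln (x^2) <= x^2 - 1 at x = p / s, multiplied by s^2; equality at p = s is the tangency
    of the two profiles. *)
Lemma ln_ratio p : 0 < p -> 2 * s ^+ 2 * (ln p - ln s) <= p ^+ 2 - s ^+ 2.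
Proof.
move=> p0; rewrite -ln_div ?posrE//; have x0 : 0 < p / s by rewrite divr_gt0.
have -> : p ^+ 2 = s ^+ 2 * (p / s) ^+ 2.
  by rewrite -exprMn [s * _]mulrC divfK// gt_eqF.
have s2 : 0 < s ^+ 2 by rewrite exprn_gt0.
have := expR_ge1Dx (ln ((p / s) ^+ 2)); rewrite lnK ?posrE ?exprn_gt0// lnXn//.
move=> /(ler_wpM2l (ltW s2)); set L := ln _; rewrite mulr2n; lra.
Qed.

Lemma dent_ge0 p : 0 <= dent s p.
Proof.
have [sp|ps] := leP s p; first by rewrite dent_out.
have [rp|pr] := leP (dent_radius s) p; last first.
  by rewrite dent_in ?(ltW pr)// addr_ge0 ?sqr_ge0.
rewrite dent_mid ?subr_ge0; last by rewrite rp ltW.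
 exact: ln_ratio (lt_le_trans dent_radius_gt0 rp).
Qed.

(** The bound does not depend on s, so the dents of all the poles fit into one geometric series. *)
Lemma dent_le p : 0 <= p -> dent s p <= 3.
Proof.
move=> p0; have [sp|ps] := leP s p; first by rewrite dent_out.
have s1 : s ^+ 2 <= 1 by apply: exprn_ile1; [exact: ltW|case/andP: s01].
have p1 : p ^+ 2 <= s ^+ 2 by rewrite lerXn2r// ?nnegrE// ltW.
have [rp|pr] := leP (dent_radius s) p; last by rewrite dent_in ?(ltW pr)//; lra.
rewrite dent_mid; last by rewrite rp ltW.
have : ln (dent_radius s) <= ln p by rewrite ler_ln ?posrE ?dent_radius_gt0// (lt_le_trans dent_radius_gt0).
have s2 : 0 <= 2 * s ^+ 2 by rewrite mulr_ge0 ?exprn_ge0// ltW.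
move=> /(ler_wpM2l s2); have := ln_dent_radius; lra.
Qed.

Lemma dent_continuous : continuous (dent s).
Proof.
move=> p; rewrite /dent; apply: cvgB.
  apply: cvgB; first exact: exprn_continuous.
  refine (@continuous_fcomp R R R (fun p => Num.max p s) (fun t => t ^+ 2) p _ _).
    exact: (continuous_max (f := fun p : R => p) (g := fun=> s) (@cvg_id _ _) (@cvg_cst _ _ _ _ _)).
  exact: exprn_continuous.
apply: cvgMr; apply: cvgB; last exact: cvg_cst.
refine (@continuous_fcomp R R R (fun p => Num.max (Num.min p s) (dent_radius s)) (@ln R) p _ _).
  apply: (continuous_max (f := fun p : R => Num.min p s) (g := fun=> dent_radius s)) => //.
    exact: (continuous_min (f := fun p : R => p) (g := fun=> s) (@cvg_id _ _) (@cvg_cst _ _ _ _ _)).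
  exact: cvg_cst.
by apply: continuous_ln; rewrite lt_max dent_radius_gt0 orbT.
Qed.

End Dent.

Section DentedSquare.
Context {R : realType}.
Notation C := (R[i]^o).
Variables (a : R[i]) (s : R).
Hypothesis s01 : 0 < s <= 1.

Let s0 : 0 < s. Proof. by case/andP: s01. Qed.

Let shift_affine (y : C) (c v : R[i]) : (y + c *: (v : C)) - a = (y - a) + c * v.
Proof. by rewrite addrAC. Qed.

Let shift_cts : continuous (fun y : C => y - a : C).
Proof.
move=> y; apply: (@continuous_atB _ C C id (fun=> a)); first exact: continuous_at_id.
exact: continuous_at_cst.
Qed.

Let dist_cts : continuous (fun y : C => normc (y - a)).
Proof. by move=> y; exact: (@normc_affine_continuous R C (fun y => y - a) shift_cts). Qed.

(** The difference is a real affine function of z, hence harmonic. *)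
Lemma normc2_shift (z : R[i]) : normc z ^+ 2 - normc (z - a) ^+ 2 =
  complex.Re (2 * conjc a * z) - normc a ^+ 2.
Proof. by rewrite !normc_sqr; case: z => x y; case: (a) => b c; simpc => /=; ring. Qed.

Let harmonic_part (k : R) z : mean_at (fun y : C => normc y ^+ 2 - normc (y - a) ^+ 2 + k) z.
Proof.
have -> : (fun y : C => normc y ^+ 2 - normc (y - a) ^+ 2 + k) =
    (fun y : C => complex.Re (2 * conjc a * y) + (k - normc a ^+ 2)).
  by apply/funext => y; rewrite normc2_shift; ring.
apply: meanD; last exact: mean_cst.
exact: Re_mean.
Qed.

Lemma dent_dist_continuous : continuous (fun y : C => dent s (normc (y - a))).
Proof.
move=> y; refine (@continuous_fcomp C R R (fun y => normc (y - a)) (dent s) y _ _).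
  exact: dist_cts.
exact: dent_continuous.
Qed.

(** Away from the dent the function is |z|^2, at the bottom of the dent it is harmonic. For r <= p
    <= s, with both ends included, the untruncated harmonic function m lies below it and touches
    it. *)
Lemma dented_square_submean z : submean_at (fun y : C => normc y ^+ 2 - dent s (normc (y - a))) z.
Proof.
pose p := normc (z - a); pose r := dent_radius s.
have c : continuous (fun y : C => normc y ^+ 2 - dent s (normc (y - a))).
  move=> y; apply: (@continuous_atB _ C R (fun y => normc y ^+ 2)).
    exact: normc2_continuous.
  exact: dent_dist_continuous.
have rs : r < s := dent_radius_lt s01; have r0 : 0 < r := dent_radius_gt0 s01.
have [sp|ps] := ltP s p.
  apply: (@submean_eq _ _ (fun y : C => normc y ^+ 2)).
    have : \forall y \near z, s < normc (y - a) by exact: (cvgr_gt _ (@dist_cts z)).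
    by apply: filterS => y sy; rewrite dent_out ?subr0// ltW.
  exact: normc2_submean.
have [rp|pr] := leP r p; last first.
  apply: (@submean_eq _ _ (fun y : C => normc y ^+ 2 - normc (y - a) ^+ 2 + (- 2))).
    have : \forall y \near z, normc (y - a) < r by exact: (cvgr_lt _ (@dist_cts z)).
    by apply: filterS => y yr; rewrite (dent_in s01 (ltW yr)); ring.
  exact/mean_submean/harmonic_part.
pose m (y : C) := (normc y ^+ 2 - normc (y - a) ^+ 2 + (s ^+ 2 - 2 * s ^+ 2 * ln s)) +
  2 * s ^+ 2 * ln (normc (y - a)).
have p0 : 0 < p := lt_le_trans r0 rp.
apply: (submean_le (m := m)).
- apply/mean_submean/meanD; first exact: harmonic_part.
  apply: meanZ; apply: (@ln_affine_mean R C (fun y => y - a) id) => //.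
  by rewrite -normc_gt0.
- exact: continuous_cts_near.
- by rewrite dent_mid ?rp// /m; ring.
- have : \forall y \near z, 0 < normc (y - a) by exact: (cvgr_gt _ (@dist_cts z)).
  apply: filterS => y y0; rewrite /m; set q := normc (y - a).
  have [sq|qs] := leP s q.
    by rewrite (dent_out s01 sq); have := @ln_ratio _ s s01 q y0; lra.
  have [rq|qr] := leP r q.
    by rewrite dent_mid; [lra|rewrite rq ltW].
  rewrite (dent_in s01) ?(ltW qr)//.
  have : ln q <= ln r by rewrite ler_ln ?posrE// ltW.
  have s2 : 0 <= 2 * s ^+ 2 by rewrite mulr_ge0 ?exprn_ge0// ltW.
  move=> /(ler_wpM2l s2); have := ln_dent_radius s01; rewrite -/r; lra.
Qed.

End DentedSquare.

Section DentedParaboloid.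
Context {R : realType}.
Notation C := (R[i]^o).

(** The radius r_j of the overview. The dent has radius gap j / 2, so it stays clear of the closed
    unit disc. *)
Definition hole (j : nat) : R := dent_radius (gap j / 2 : R).

Let s01 (j : nat) : 0 < (gap j / 2 : R) <= 1.
Proof. by rewrite divr_gt0 ?gap_gt0//=; have := @gap_le R j; lra. Qed.

Lemma hole_gt0 j : 0 < hole j.
Proof. exact: dent_radius_gt0 (s01 j). Qed.

Lemma hole_lt j : hole j < gap j / 2.
Proof. exact: dent_radius_lt (s01 j). Qed.

Let dents (z : C) (j : nat) : R := dent (gap j / 2) (normc (z - pole j)).

Let dents03 z j : 0 <= dents z j <= 3.
Proof. by rewrite dent_ge0 ?dent_le ?normc_ge0. Qed.

(** The function psi of the overview. *)
Definition paraboloid (z : C) : R := normc z ^+ 2 - limn (gsum (dents z)).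

(** The first n weights sum to 1 - 2^-n, so |y|^2 can be distributed over the dents, one share for
    each, with 2^-n |y|^2 left over. *)
Let partial_submean n z : submean_at (fun y : C => normc y ^+ 2 - gsum (dents y) n) z.
Proof.
have -> : (fun y : C => normc y ^+ 2 - gsum (dents y) n) =
    fun y => 2^-1 ^+ n * normc y ^+ 2 +
      \sum_(j < n) 2^-1 ^+ j.+1 * (normc y ^+ 2 - dents y j).
  apply/funext => y; rewrite /gsum; elim: n => [|n IH].
    by rewrite !big_ord0 subr0 addr0 expr0 mul1r.
  rewrite !big_ord_recr/= opprD addrA IH (exprS _ n); lra.
apply: submeanD; first by apply: submeanZ; [exact: exprn_ge0|exact: normc2_submean].
apply: (submean_sum (F := fun (j : nat) (y : C) => 2^-1 ^+ j.+1 * (normc y ^+ 2 - dents y j))) => j _.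
apply: submeanZ; first exact: exprn_ge0.
exact: dented_square_submean.
Qed.

Lemma paraboloid_submean z : submean_at paraboloid z.
Proof.
apply: submean_unif_limit => e e0; have e3 : 0 < e / 3 by rewrite divr_gt0.
(* After N + 2 terms the tail is at most 3 * 2^-(N+2) = 3 * gap N < e. *)
have [N HN] := gap_small e3; exists (fun y : C => normc y ^+ 2 - gsum (dents y) N.+2).
  exact: partial_submean.
move=> y; have := gsum_lim (dents03 y) N.+2; rewrite /paraboloid.
have := HN N (leqnn _); rewrite /gap; set q := _ ^+ N.+2; set l := limn _; set g := gsum _ _.
by move=> h1 /andP[h2 h3]; rewrite ler_norml; apply/andP; split; lra.
Qed.

Lemma paraboloid_le z : paraboloid z <= normc z ^+ 2.
Proof.
have /andP[+ _] := gsum_lim (dents03 z) 0.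
by rewrite /paraboloid {1}/gsum big_ord0; set l := limn _; lra.
Qed.

Lemma paraboloid_disc z : normc z <= 1 -> paraboloid z = normc z ^+ 2.
Proof.
move=> z1; rewrite /paraboloid (_ : gsum _ = fun=> 0) ?lim_cst ?subr0//.
apply/funext => n; rewrite /gsum big1// => j _.
rewrite /dents dent_out ?mulr0//; have := normc_dist (pole j) z.
rewrite normcB normc_pole; have := gap_gt0 (R := R) j => g0.
by move=> /(le_trans (ler_norm _)); lra.
Qed.

(** With g = gap j, the j-th dent removes at least 2 g * 2 = 4 g, the other dents only help, and
    |z|^2 <= (1 + 3 g / 2)^2 <= 1 + 4 g because g <= 1/4. *)
Lemma paraboloid_hole j z : normc (z - pole j) < hole j -> paraboloid z <= 1.
Proof.
move=> zj; have /andP[+ _] := gsum_lim (dents03 z) j.+1.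
rewrite {1}/gsum big_ord_recr/= -/(gsum _ _) {2}/dents (dent_in (s01 j) (ltW zj)).
have : 0 <= gsum (dents z) j.
  by apply: sumr_ge0 => k _; rewrite mulr_ge0 ?exprn_ge0//; case/andP: (dents03 z k).
rewrite /paraboloid; set l := limn _; set G := gsum _ _.
have g0 := gap_gt0 (R := R) j; have g4 := gap_le (R := R) j.
have -> : 2^-1 ^+ j.+1 = 2 * gap j :> R by rewrite /gap [in RHS]exprS mulrA divff// mul1r.
have : normc z <= 1 + gap j + gap j / 2.
  have := le_normcD (pole j) (z - pole j); rewrite addrCA subrr addr0 normc_pole.
  have := hole_lt j; lra.
have := normc_ge0 z; have := sqr_ge0 (normc (z - pole j)).
set g := gap j in g0 g4 *; set x : R := normc z; set p : R := _ ^+ 2 => p0 x0 xg G0 h.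
have : x ^+ 2 <= (1 + g + g / 2) ^+ 2 by rewrite lerXn2r// nnegrE; lra.
have : 0 <= g * p by rewrite mulr_ge0// ltW.
have : g * g <= g * 4^-1 by rewrite ler_pM2l.
by move=> h1 h2 h3; nra.
Qed.

End DentedParaboloid.

(** * The domain *)

Section TruncatedLog.
Context {R : realType}.
Notation C := (R[i]^o).

Definition logmax (c : R) (z : R[i]) : R := ln (Num.max (normc z) c).

(** Where |l x| <= c the constant ln c touches from below; elsewhere the truncation is inactive
    nearby. *)
Lemma logmax_submean (c : R) (V : normedModType R[i]) (l : V -> C) (L : V -> R[i]) :
  0 < c -> continuous l -> (forall x k v, l (x + k *: v) = l x + k * L v) ->
  forall x, submean_at (fun y => logmax c (l y)) x.
Proof.
move=> c0 cl lD x; have cn := normc_affine_continuous cl.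
have p y : 0 < Num.max (normc (l y)) c by rewrite lt_max c0 orbT.
have cc : cts_near (fun y => logmax c (l y)) x.
  apply: continuous_cts_near => y.
  refine (@continuous_fcomp V R R (fun y => Num.max (normc (l y)) c) (@ln R) y _ _).
    exact: (continuous_max (f := fun y => normc (l y)) (g := fun=> c) (cn y) (@cvg_cst _ _ _ _ _)).
  exact: continuous_ln.
have [lc|cl'] := leP (normc (l x)) c.
  apply: (submean_le (submean_cst (ln c) x)) => //; first by rewrite /logmax max_r.
  by apply: nearW => y; rewrite /logmax ler_ln ?posrE// le_max lexx orbT.
apply: (@submean_eq _ _ (fun y => ln (normc (l y)))).
  have : \forall y \near x, c < normc (l y) by exact: (cvgr_gt _ (cn x)).
  by apply: filterS => y cy; rewrite /logmax max_l// ltW.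
apply/mean_submean/(ln_affine_mean cl lD).
by rewrite -normc_gt0; exact: lt_trans cl'.
Qed.

Lemma logmax_submean_id (c : R) (z : C) : 0 < c -> submean_at (logmax c : C -> R) z.
Proof.
move=> c0; have idc : continuous (id : C -> C) by move=> x; exact: continuous_at_id.
have idD (x : C) (k : R[i]) (v : C) : (x + k *: v : R[i]) = x + k * v by [].
exact: (@logmax_submean c C id id c0 idc idD z).
Qed.

Lemma le_logmax (c : R) z : z != 0 -> ln (normc z) <= logmax c z.
Proof.
move=> z0; have n0 : 0 < normc z by rewrite normc_gt0.
by rewrite ler_ln ?posrE ?lt_max ?n0// le_max lexx.
Qed.

Lemma logmax_le (c t : R) z : 0 < c -> c <= expR t -> normc z <= expR t -> logmax c z <= t.
Proof.
move=> c0 ct zt; rewrite -[leRHS]expRK ler_ln ?posrE ?expR_gt0 ?lt_max ?c0 ?orbT//.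
by rewrite ge_max zt.
Qed.

Lemma normc_le_logmax (c t : R) z : logmax c z <= t -> normc z <= expR t.
Proof.
have [->|z0] := eqVneq z 0; first by rewrite normc0 expR_ge0.
by move=> /(le_trans (le_logmax c z0)); rewrite -ler_expR lnK// posrE normc_gt0.
Qed.

Lemma logmax_ndl (c c' : R) z : 0 < c <= c' -> logmax c z <= logmax c' z.
Proof.
move=> /andP[c0 cc']; have c'0 := lt_le_trans c0 cc'.
rewrite ler_ln ?posrE ?lt_max ?c0 ?c'0 ?orbT// ge_max !le_max lexx/=.
by rewrite cc' orbT.
Qed.

Lemma logmax1_ge0 (z : R[i]) : 0 <= logmax 1 z.
Proof. by rewrite ln_ge0// le_max lexx orbT. Qed.

Lemma logmax1_disc (z : R[i]) : normc z <= 1 -> logmax 1 z = 0.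
Proof. by move=> z1; rewrite /logmax max_r ?ln1. Qed.

End TruncatedLog.

(** * The sum of logarithmic poles *)

Section Tower.
Context {R : realType}.
Notation C := (R[i]^o).

(** With this truncation radius the m-th logarithm bottoms out at exactly -m. *)
Definition cutoff (m : nat) : R := expR (- m%:R).

Lemma cutoff_gt0 m : 0 < cutoff m.
Proof. exact: expR_gt0. Qed.

Lemma cutoff_le1 m : cutoff m <= 1.
Proof. by rewrite expR_le1 oppr_le0. Qed.

Lemma cutoffS m : cutoff m.+1 <= cutoff m.
Proof. by rewrite ler_expR lerN2 ler_nat. Qed.

Lemma logmax_cutoffS m (z : R[i]) : logmax (cutoff m.+1) z <= logmax (cutoff m) z.
Proof. by rewrite logmax_ndl// cutoff_gt0 cutoffS. Qed.

Lemma logmax_cutoff1 m (z : R[i]) : logmax (cutoff m) z <= logmax 1 z.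
Proof. by rewrite logmax_ndl// cutoff_gt0 cutoff_le1. Qed.

Lemma logmax_cutoff_small m (z : R[i]) : normc z <= cutoff m -> logmax (cutoff m) z = - m%:R.
Proof. by move=> zm; rewrite /logmax max_r// expRK. Qed.

(* The denominator makes both sum_j weight j and
   sum_j weight j * (ln 3 - ln (hole j)) at most 1/2, so that off the
   holes the logarithmic poles of [tower] cost at most a constant. *)
Definition weight (j : nat) : R := gap j / (1 + ln 3 - ln (hole j)).

Let denom_ge1 j : 1 <= 1 + ln 3 - ln (hole j) :> R.
Proof.
have h1 : ln (hole j) <= 0 :> R.
  by apply: ln_le0; have := @hole_lt R j; have := @gap_le R j; lra.
have : 0 <= ln 3 :> R by rewrite ln_ge0// ler1n.
lra.
Qed.

Lemma weight_gt0 j : 0 < weight j.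
Proof. by rewrite divr_gt0 ?gap_gt0//; exact: lt_le_trans (denom_ge1 j). Qed.

Lemma weight_ge0 j : 0 <= weight j.
Proof. exact/ltW/weight_gt0. Qed.

Lemma sum_gap m : \sum_(j < m) gap j <= 2^-1 :> R.
Proof.
suff -> : \sum_(j < m) gap j = 2^-1 - 2^-1 * 2^-1 ^+ m :> R.
  by rewrite gerBl mulr_ge0// exprn_ge0.
elim: m => [|m IH]; first by rewrite big_ord0 expr0 mulr1 subrr.
by rewrite big_ord_recr/= IH /gap !(exprS _ m) (exprS _ m.+1) (exprS _ m); lra.
Qed.

Lemma sum_weight m : \sum_(j < m) weight j + \sum_(j < m) weight j * (ln 3 - ln (hole j)) <= 2^-1.
Proof.
apply: le_trans (sum_gap m); rewrite -big_split/=; apply: ler_sum => j _.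
rewrite -[X in X + _]mulr1 -mulrDr addrA /weight divfK// gt_eqF//.
exact: lt_le_trans (denom_ge1 j).
Qed.

Lemma sum_weight_le m : \sum_(j < m) weight j <= 2^-1.
Proof.
apply: le_trans (sum_gap m); apply: ler_sum => j _; rewrite ler_pdivrMr.
  by rewrite ler_peMr// ltW// gap_gt0.
exact: lt_le_trans (denom_ge1 j).
Qed.

(** Since |z - a_j| <= 3 max (|z|, 1), every summand is nonpositive, so the sequence decreases in m.
    The leading term pays for the subtracted logarithms and, as the weights sum to at most 1/2,
    leaves growth of at least 3/2 ln |z| off the holes, up to a constant. *)
Definition tower (m : nat) (z : R[i]) : R := 2 * logmax 1 z +
  \sum_(j < m) weight j * (logmax (cutoff m) (z - pole j) - logmax 1 z - ln 3).

(** Collecting the multiples of [logmax 1] leaves the coefficient 2 minus the sum of the weights,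
    which is positive. *)
Lemma tower_submean m (z : C) : submean_at (tower m : C -> R) z.
Proof.
have -> : (tower m : C -> R) = fun z => ((2 - \sum_(j < m) weight j) * logmax 1 z +
    \sum_(j < m) weight j * logmax (cutoff m) (z - pole j)) - \sum_(j < m) weight j * ln 3.
  apply/funext => y; rewrite /tower mulrBl mulr_suml.
  rewrite (eq_bigr (fun j : 'I_m => weight j * logmax (cutoff m) (y - pole j) -
     (weight j * logmax 1 y + weight j * ln 3))); last by move=> j _; ring.
  by rewrite sumrB big_split/=; ring.
apply: submeanD; last exact: submean_cst.
apply: submeanD.
  apply: submeanZ; first by have := sum_weight_le m; lra.
  exact: logmax_submean_id.
apply: (submean_sum (F := fun (j : nat) (y : C) => weight j * logmax (cutoff m) (y - pole j))) => j _.
apply: submeanZ; first exact: weight_ge0.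
apply: (@logmax_submean _ _ C (fun y => y - pole j) id) => //; first exact: cutoff_gt0.
  move=> y; apply: (@continuous_atB _ C C id (fun=> pole j)); first exact: continuous_at_id.
  exact: continuous_at_cst.
by move=> y k v; rewrite addrAC.
Qed.

Lemma logmax_pole m j (z : R[i]) : logmax (cutoff m) (z - pole j) - logmax 1 z - ln 3 <= 0.
Proof.
rewrite -addrA -opprD subr_le0 -lnM ?posrE ?lt_max ?ltr01 ?orbT//.
have p : 0 < Num.max (normc z) 1 by rewrite lt_max ltr01 orbT.
rewrite ler_ln ?posrE ?lt_max ?cutoff_gt0 ?orbT ?mulr_gt0// ge_max.
have z1 : normc z <= Num.max (normc z) 1 by rewrite le_max lexx.
have o1 : 1 <= Num.max (normc z) 1 by rewrite le_max lexx orbT.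
have := cutoff_le1 m; set M := Num.max _ _ in p z1 o1 *; move=> t1; apply/andP; split; last lra.
apply: le_trans (le_normcD _ _) _; rewrite normcN normc_pole.
have := @gap_le R j; lra.
Qed.

Lemma towerS m z : tower m.+1 z <= tower m z.
Proof.
rewrite /tower lerD2l big_ord_recr/= -[leRHS]addr0; apply: lerD; last first.
  by rewrite mulr_ge0_le0 ?logmax_pole// weight_ge0.
apply: ler_sum => j _; rewrite ler_wpM2l ?weight_ge0// !lerD2r.
exact: logmax_cutoffS.
Qed.

Lemma tower_le m z : tower m z <= 2 * logmax 1 z.
Proof.
rewrite /tower gerDl; apply: sumr_le0 => j _.
by rewrite mulr_ge0_le0 ?logmax_pole// weight_ge0.
Qed.

Lemma tower_pole m j : (j < m)%N -> tower m (pole j) <= 2 * logmax 1 (pole j) - weight j * m%:R.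
Proof.
move=> jm; rewrite /tower lerD2l (bigD1 (Ordinal jm))//= -[leRHS]addr0; apply: lerD.
  rewrite -[leRHS]mulrN ler_wpM2l ?weight_ge0// subrr logmax_cutoff_small; last by rewrite normc0 ltW// cutoff_gt0.
  have := @logmax1_ge0 R (pole j); have : 0 <= ln 3 :> R by rewrite ln_ge0// ler1n.
  lra.
apply: sumr_le0 => k _.
by rewrite mulr_ge0_le0 ?logmax_pole// weight_ge0.
Qed.

Lemma tower_off m (z : R[i]) : (forall j, hole j <= normc (z - pole j)) ->
  3 / 2 * logmax 1 z - 2^-1 <= tower m z.
Proof.
move=> off; rewrite /tower.
have : \sum_(j < m) (- (weight j * (ln 3 - ln (hole j))) - weight j * logmax 1 z) <=
    \sum_(j < m) weight j * (logmax (cutoff m) (z - pole j) - logmax 1 z - ln 3).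
  apply: ler_sum => j _; rewrite -mulrN -mulrBr ler_wpM2l ?weight_ge0//.
  have : ln (hole j) <= logmax (cutoff m) (z - pole j).
    have h := hole_gt0 (R := R) j.
    by rewrite ler_ln ?posrE ?lt_max ?cutoff_gt0 ?orbT// le_max off.
  lra.
rewrite sumrB sumrN -mulr_suml; have := sum_weight m.
have h : 0 <= \sum_(j < m) weight j * (ln 3 - ln (hole j)).
  apply: sumr_ge0 => j _; rewrite mulr_ge0 ?weight_ge0//.
  by have := denom_ge1 j; lra.
have h2 : (\sum_(j < m) weight j) * logmax 1 z <= 2^-1 * logmax 1 z.
  by rewrite ler_wpM2r ?logmax1_ge0// sum_weight_le.
have h3 : 0 <= \sum_(j < m) weight j by apply: sumr_ge0 => j _; rewrite ltW// weight_gt0.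
lra.
Qed.

End Tower.

(** * The defining functions F_m *)

Section Defining.
Context {R : realType} {n : nat}.
Notation C := (R[i]^o).
Notation V := (Cspace R n).
Variables i0 i1 : 'I_n.
Hypothesis i01 : i0 != i1.
Implicit Types (x : V) (m : nat).

(* Where [tower] is bounded below, a negative value of [neck] keeps w close to
   0 or to 1, the entry logmax (w - 1) - 1 bounds z, and the other entries bound
   the remaining coordinates.  All entries tend to -oo when w = 1 and
   x_k = 0, and [tower] tends to -oo at the poles. *)
Definition tail_max (m : nat) x : R :=
  \big[Num.max/logmax (cutoff m) (x 0 i1 - 1) - 1]_(k | (k != i0) && (k != i1))
    logmax (cutoff m) (x 0 k).

Definition neck (m : nat) x : R :=
  ln 9 + 2^-1 + logmax (cutoff m) (x 0 i1) + logmax (cutoff m) (x 0 i1 - 1).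

(** The term 2^-m supplies the margin 2^-(m+1) between consecutive functions; all the other terms
    are merely nonincreasing in m. *)
Definition defining (m : nat) x : R :=
  2^-1 ^+ m + tower m (x 0 i0) + Num.max (neck m x) (tail_max m x).

Lemma logmax_coord_submean (c : R) (k : 'I_n) (a : R[i]) x : 0 < c ->
  submean_at (fun y : V => logmax c (y 0 k - a)) x.
Proof.
move=> c0; apply: (@logmax_submean _ _ V (fun y => y 0 k - a) (fun v => v 0 k)) => //.
  move=> y; apply: (@continuous_atB _ V C (fun y : V => y 0 k) (fun=> a)).
    exact: coordC_continuous.
  exact: continuous_at_cst.
by move=> y c' v; rewrite coord_affine addrAC.
Qed.

Lemma logmax_coord_submean0 (c : R) (k : 'I_n) x : 0 < c ->
  submean_at (fun y : V => logmax c (y 0 k)) x.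
Proof.
by move=> /(logmax_coord_submean k 0 x); under eq_fun do rewrite subr0.
Qed.

Lemma defining_submean m x : submean_at (defining m) x.
Proof.
apply: submeanD.
  apply: submeanD; first exact: submean_cst.
  apply: (@submean_comp R V C (fun y => y 0 i0) (fun v => v 0 i0)).
  - exact: coordC_continuous.
  - by move=> y c v; rewrite coord_affine.
  - exact: tower_submean.
have t0 := @cutoff_gt0 R m.
apply: submean_max.
  apply: submeanD; last exact: logmax_coord_submean.
  by apply: submeanD; [exact: submean_cst|exact: logmax_coord_submean0].
rewrite /tail_max; elim: (index_enum _) => [|k r IH].
  under eq_fun do rewrite big_nil.
  by apply: submeanD; [exact: logmax_coord_submean|exact: submean_cst].
have [k01|k01] := boolP ((k != i0) && (k != i1)); last first.
  by under eq_fun do rewrite big_cons (negbTE k01).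
under eq_fun do rewrite big_cons k01.
by apply: submean_max => //; exact: logmax_coord_submean0.
Qed.

Lemma definingS m x : defining m.+1 x + 2^-1 ^+ m.+1 <= defining m x.
Proof.
rewrite /defining.
have h : Num.max (neck m.+1 x) (tail_max m.+1 x) <= Num.max (neck m x) (tail_max m x).
  apply: le_max2.
    by rewrite /neck -!addrA !lerD2l lerD// logmax_cutoffS.
  apply: bigmax_le => [|k k01].
    by apply: le_trans (bigmax_ge_id _ _ _ _); rewrite lerD2r logmax_cutoffS.
  apply: le_trans (logmax_cutoffS _ _) _.
  exact: (le_bigmax_cond _ (fun k => logmax (cutoff m) (x 0 k)) k01).
by have := towerS m (x 0 i0); rewrite (exprS _ m); lra.
Qed.

Lemma defining_ltP m x : defining m x < 0 -> [/\ tower m (x 0 i0) + neck m x < 0,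
  tower m (x 0 i0) + (logmax (cutoff m) (x 0 i1 - 1) - 1) < 0 &
  forall k, k != i0 -> k != i1 -> tower m (x 0 i0) + logmax (cutoff m) (x 0 k) < 0].
Proof.
rewrite /defining => H; have p : 0 < 2^-1 ^+ m :> R by rewrite exprn_gt0.
have : neck m x <= Num.max (neck m x) (tail_max m x) by rewrite le_max lexx.
have : tail_max m x <= Num.max (neck m x) (tail_max m x) by rewrite le_max lexx orbT.
move=> h1 h2; split; first lra.
  have : logmax (cutoff m) (x 0 i1 - 1) - 1 <= tail_max m x by exact: bigmax_ge_id.
  lra.
move=> k k0 k1; have : logmax (cutoff m) (x 0 k) <= tail_max m x.
  have k01 : (k != i0) && (k != i1) by rewrite k0.
  exact: (le_bigmax_cond _ (fun k => logmax (cutoff m) (x 0 k)) k01).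
lra.
Qed.

Lemma ln_small : ln 3 <= 2 :> R /\ ln 9 <= 8 :> R.
Proof.
have H (t : R) : 0 < t -> ln t <= t - 1.
  by move=> t0; have := expR_ge1Dx (ln t); rewrite lnK ?posrE//; lra.
by split; [have := H 3 ltac:(lra)|have := H 9 ltac:(lra)]; lra.
Qed.

Lemma defining_le m x (e t : R) : tower m (x 0 i0) <= e -> neck m x <= t ->
  logmax (cutoff m) (x 0 i1 - 1) - 1 <= t ->
  (forall k, k != i0 -> k != i1 -> logmax (cutoff m) (x 0 k) <= t) ->
  defining m x <= 2^-1 ^+ m + e + t.
Proof.
move=> te nt h1 hk; rewrite /defining; apply: lerD; first by rewrite lerD2l.
rewrite ge_max nt/=; apply/bigmax_leP; split => // k /andP[]; exact: hk.
Qed.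

Lemma central_line x : x 0 i1 = 1 -> (forall k, k != i0 -> k != i1 -> x 0 k = 0) ->
  increasing_union defining x.
Proof.
move=> x1 xk; have T0 := @logmax1_ge0 R (x 0 i0); set T := logmax 1 (x 0 i0) in T0.
have [_ l9] := ln_small; have l90 : 0 <= ln 9 :> R by rewrite ln_ge0// ler1n.
have [m mT] : exists m, 12 + 2 * T < m%:R.
  by exists (Num.truncn (12 + 2 * T)).+1; exact: truncnS_gt.
exists m; have z : logmax (cutoff m) (0 : R[i]) = - m%:R.
  by rewrite logmax_cutoff_small// normc0 ltW// cutoff_gt0.
have o : logmax (cutoff m) (1 : R[i]) = 0.
  by rewrite /logmax normc1 max_l ?ln1// cutoff_le1.
apply: le_lt_trans (defining_le (t := 9 - m%:R) (tower_le m _) _ _ _) _.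
- rewrite /neck x1 subrr z o; lra.
- rewrite x1 subrr z; lra.
- by move=> k k0 k1; rewrite xk// z; lra.
have : 2^-1 ^+ m <= 1 :> R by apply: exprn_ile1; lra.
rewrite -/T; lra.
Qed.

(** All other terms are bounded independently of m, whereas the j-th pole contributes at most -
    weight j * m. *)
Lemma pole_line j x : x 0 i0 = pole j -> increasing_union defining x.
Proof.
move=> x0; have [_ l9] := ln_small; have l90 : 0 <= ln 9 :> R by rewrite ln_ge0// ler1n.
have w0 := @weight_gt0 R j.
pose S := \sum_(k < n) logmax 1 (x 0 k); pose b := logmax 1 (x 0 i1 - 1).
have Sk k : logmax 1 (x 0 k) <= S.
  by rewrite /S (bigD1 k)//= lerDl; apply: sumr_ge0 => ? _; exact: logmax1_ge0.
have b0 : 0 <= b by exact: logmax1_ge0.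
pose B := (10 + 2 * logmax 1 (pole j) + S + b) / weight j.
have [m [jm mB m0]] : exists m, [/\ (j < m)%N, B < m%:R & (0 < m)%N].
  exists (maxn (Num.truncn B) j).+1; split => //; first by rewrite ltnS leq_maxr.
  by apply: lt_le_trans (truncnS_gt B) _; rewrite ler_nat ltnS leq_maxl.
have mB' : 10 + 2 * logmax 1 (pole j) + S + b < weight j * m%:R.
  by rewrite [ltRHS]mulrC -ltr_pdivrMr.
exists m; have := @tower_pole R m j jm; rewrite -x0 => tp.
have h k := logmax_cutoff1 m (x 0 k); have h' := logmax_cutoff1 m (x 0 i1 - 1).
have S1 := Sk i1; have S10 := @logmax1_ge0 R (x 0 i1).
apply: le_lt_trans (defining_le (t := 9 + S + b) tp _ _ _) _.
- by rewrite /neck; have := h i1; rewrite -/b in h'; lra.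
- rewrite -/b in h'; lra.
- by move=> k _ _; have := h k; have := Sk k; lra.
have : 2^-1 ^+ m < 1 :> R by rewrite exprn_ilt1 -?lt0n//; lra.
move: mB'; rewrite x0; lra.
Qed.

Lemma central_polydisc x : normc (x 0 i0) <= 5 / 4 ->
  (forall k, k != i0 -> normc (x 0 k) <= cutoff 12) -> increasing_union defining x.
Proof.
move=> x0 xk; have [_ l9] := ln_small; have l90 : 0 <= ln 9 :> R by rewrite ln_ge0// ler1n.
(* With the crude bound ln 9 <= 8, truncation at -12 brings [neck] below -3. The largest entry is
   then logmax (w - 1) - 1 <= 1/13 - 1 < -9/10, which absorbs 2^-12 and the bound 1/2 on [tower]. *)
exists 12%N.
have t13 : cutoff 12 <= 13^-1 :> R.
  rewrite /cutoff expRN lef_pV2 ?posrE ?expR_gt0//.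
  by have := expR_ge1Dx (12%:R : R); lra.
have sm k : k != i0 -> logmax (cutoff 12) (x 0 k) = - 12%:R.
  by move=> k0; rewrite logmax_cutoff_small// xk.
have e1 : logmax (cutoff 12) (x 0 i1 - 1) <= 13^-1.
  have e13 : 1 + 13^-1 <= expR 13^-1 :> R by exact: expR_ge1Dx.
  apply: logmax_le; [exact: cutoff_gt0|by apply: le_trans t13 _; lra|].
  apply: le_trans (le_normcD _ _) _; rewrite normcN normc1.
  by have := xk i1; rewrite eq_sym i01 => /(_ isT); lra.
have e2 : tower 12 (x 0 i0) <= 2^-1.
  apply: le_trans (tower_le _ _) _.
  suff : logmax 1 (x 0 i0) <= 4^-1 by lra.
  have e4 : 1 + 4^-1 <= expR 4^-1 :> R by exact: expR_ge1Dx.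
  by apply: logmax_le => //; lra.
apply: le_lt_trans (defining_le (t := - (9 / 10)) e2 _ _ _) _.
- by rewrite /neck sm 1?eq_sym//; lra.
- lra.
- by move=> k k0 _; rewrite sm//; lra.
have -> : 2^-1 ^+ 12 = 4096^-1 :> R by rewrite exprVn -natrX.
lra.
Qed.

(** The summand 1/2 of [neck] cancels the loss in [tower_off]; |w - 1| >= 1/2 takes ln 2 from ln 9,
    and the remaining ln (9/2) forces |w| < 2/9. *)
Lemma neck_narrow x : increasing_union defining x ->
  (forall j, hole j <= normc (x 0 i0 - pole j)) -> normc (x 0 i1) < 2^-1 ->
  normc (x 0 i1) <= 4^-1.
Proof.
move=> [m /defining_ltP[+ _ _]] off x1.
have := tower_off m off; have := @logmax1_ge0 R (x 0 i0); rewrite /neck.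
have [->|x10] := eqVneq (x 0 i1) 0; first by rewrite normc0 => *; lra.
have := le_logmax (cutoff m) x10.
have h : 2^-1 <= normc (x 0 i1 - 1).
  by have := le_normcD (x 0 i1) (1 - x 0 i1); rewrite addrCA subrr addr0 normc1 normcB; lra.
have : ln 2^-1 <= logmax (cutoff m) (x 0 i1 - 1).
  by rewrite ler_ln ?posrE ?lt_max ?cutoff_gt0 ?orbT// le_max h.
have n0 : 0 < normc (x 0 i1) by rewrite normc_gt0.
have -> : ln 9 = ln 2 + ln (9 / 2) :> R.
  by rewrite -lnM ?posrE ?divr_gt0//; congr ln; lra.
rewrite lnV ?posrE// => h1 h2 h3 h4 h5.
have : ln (9 / 2) + ln (normc (x 0 i1)) < 0 by lra.
rewrite -lnM ?posrE ?divr_gt0// -ln1 ltr_ln ?posrE ?mulr_gt0 ?divr_gt0//.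
lra.
Qed.

(** The first bound makes psi bounded on the relevant part of the domain; the second keeps |x|^2
    bounded over the unit disc, where the quadratic term is used. Both come from [tower_off] and |w
    - 1| >= 1/2. *)
Lemma central_bounds x : increasing_union defining x ->
  (forall j, hole j <= normc (x 0 i0 - pole j)) -> normc (x 0 i1) < 2^-1 ->
  normc (x 0 i0) <= expR 2 /\
  (normc (x 0 i0) <= 1 -> forall k, normc (x 0 k) <= expR 1).
Proof.
move=> [m /defining_ltP[_ h1 h2]] off x1.
have t := tower_off m off; have l0 := @logmax1_ge0 R (x 0 i0).
have h : 2^-1 <= normc (x 0 i1 - 1).
  by have := le_normcD (x 0 i1) (1 - x 0 i1); rewrite addrCA subrr addr0 normc1 normcB; lra.
have : ln 2^-1 <= logmax (cutoff m) (x 0 i1 - 1).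
  by rewrite ler_ln ?posrE ?lt_max ?cutoff_gt0 ?orbT// le_max h.
rewrite lnV ?posrE//; have l2 : ln 2 <= 1 :> R.
  by have := expR_ge1Dx (ln 2 : R); rewrite lnK ?posrE//; lra.
move=> h3; split; first by apply: (@normc_le_logmax _ 1); lra.
move=> z1 k; have o := logmax1_disc z1; have e1 := expR_ge1Dx (1 : R).
have [->|k0] := eqVneq k i0; first lra.
have [->|k1] := eqVneq k i1; first lra.
by apply: (@normc_le_logmax _ (cutoff m)); have := h2 _ k0 k1; lra.
Qed.

End Defining.

(** * Segments and components of open sets *)

Section Segment.
Context {R : realType} {V : normedModType R[i]}.
Implicit Types (x y p : V) (A : set V).

Definition segment_point x y (t : R) : V := x + t%:C *: (y - x).

Lemma segment_point_continuous x y : continuous (segment_point x y).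
Proof.
move=> t; rewrite /segment_point.
refine (@continuous_fcomp R R[i]^o V (fun t => t%:C) (fun l => x + l *: (y - x)) t _ _).
  exact: real_complex_continuous.
exact: line_continuous.
Qed.

Lemma component_segment A p x y : connected_component A p x ->
  (forall t, 0 <= t <= 1 -> A (segment_point x y t)) -> connected_component A p y.
Proof.
move=> px xyA; pose S := segment_point x y @` `[0, 1].
have Sx : S x by exists 0 => /=; rewrite ?in_itv/= ?lexx ?ler01// /segment_point scale0r addr0.
have Sy : S y.
  by exists 1 => /=; rewrite ?in_itv/= ?lexx ?ler01// /segment_point scale1r addrCA subrr addr0.
have cS : connected S.
  apply: connected_continuous_connected; first exact: segment_connected.
  exact/continuous_subspaceT/segment_point_continuous.
have SA : S `<=` A by move=> _ [t + <-]; rewrite /= in_itv/=; exact: xyA.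
have : connected_component A x y by exists S.
exact: connected_component_trans.
Qed.

(** A ball is joined to its centre by segments, so it meets at most one component; hence the
    components of an open set are open and relatively closed. *)
Lemma component_ball A p x y (e : R) : (forall z, nrm (z - x) < e -> A z) ->
  nrm (y - x) < e -> connected_component A p x <-> connected_component A p y.
Proof.
move=> xA yx; have t01 (t : R) : 0 <= t <= 1 -> nrm (t%:C *: (y - x)) < e.
  move=> /andP[t0 t1]; rewrite nrmZ normc_real ger0_norm//.
  by apply: le_lt_trans yx; rewrite ler_piMl ?nrm_ge0.
split => h; apply: (component_segment h) => t t1; apply: xA.
  by rewrite /segment_point addrAC subrr add0r t01.
have -> : segment_point y x t - x = (1 - t)%:C *: (y - x).
  rewrite /segment_point (rmorphB (real_complex R)) (rmorph1 (real_complex R)) scalerBl scale1r.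
  by rewrite -[x - y]opprB scalerN addrAC.
by apply: t01; case/andP: t1 => ? ?; apply/andP; split; lra.
Qed.

Lemma open_component A p : open A -> open (connected_component A p).
Proof.
rewrite !openE => oA x px; have Ax : A x by exact: connected_component_sub px.
have /nearVP[e e0 eA] := oA x Ax.
by apply/nearVP; exists e => // y yx; exact/(component_ball p eA yx).
Qed.

Lemma component_closed A p x : open A -> A x -> closure (connected_component A p) x ->
  connected_component A p x.
Proof.
rewrite openE => oA Ax cx; have /nearVP[e e0 eA] := oA x Ax.
have [|y [py]] := cx [set y | nrm (y - x) < e]; first by apply/nearVP; exists e.
by move=> /= yx; exact/(component_ball p eA yx).
Qed.

End Segment.

Section Domain.
Context {R : realType} {n : nat}.
Notation C := (R[i]^o).
Notation V := (Cspace R n).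
Variables i0 i1 : 'I_n.
Hypothesis i01 : i0 != i1.
Implicit Types x y : V.

Definition base_point (z : R[i]) : V := \row_k (if k == i0 then z else (k == i1)%:R).

Lemma base_point0 z : base_point z 0 i0 = z.
Proof. by rewrite mxE eqxx. Qed.

Lemma base_point1 z : base_point z 0 i1 = 1.
Proof. by rewrite mxE eq_sym (negbTE i01) eqxx. Qed.

Lemma base_pointk z k : k != i0 -> k != i1 -> base_point z 0 k = 0.
Proof. by move=> k0 k1; rewrite mxE (negbTE k0) (negbTE k1). Qed.

Let tot : set V := increasing_union (defining i0 i1).

Definition domain_component : set V := connected_component tot (base_point 0).

Lemma segment_coord x y t k :
  segment_point x y t 0 k = (1 - t)%:C * x 0 k + t%:C * y 0 k.
Proof.
rewrite /segment_point coord_affine !mxE (rmorphB (real_complex R)) (rmorph1 (real_complex R)).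
by rewrite mulrBl mul1r mulrBr addrA addrAC.
Qed.

Lemma open_tot : open tot.
Proof. exact/open_increasing_union/defining_submean. Qed.

Lemma open_domain : open domain_component.
Proof. exact/open_component/open_tot. Qed.

Lemma domain_sub : domain_component `<=` tot.
Proof. exact: connected_component_sub. Qed.

Lemma domain_base z : domain_component (base_point z).
Proof.
have h z' : tot (base_point z').
  by apply: central_line; [exact: base_point1|exact: base_pointk].
apply: (@component_segment _ _ _ _ (base_point 0)).
  by apply: connected_component_refl; exact: h.
move=> t _; apply: central_line; rewrite ?segment_coord.
  rewrite !base_point1 !mulr1 -(rmorphD (real_complex R)) subrK; exact: rmorph1.
by move=> k k0 k1; rewrite segment_coord !base_pointk// !mulr0 addr0.
Qed.

Lemma domain_pole j x : x 0 i0 = pole j -> domain_component x.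
Proof.
move=> xj; apply: (component_segment (domain_base (pole j))) => t _.
apply: (@pole_line _ _ _ _ j); rewrite segment_coord xj base_point0 -mulrDl.
by rewrite -(rmorphD (real_complex R)) subrK (rmorph1 (real_complex R)) mul1r.
Qed.

(** The radius 5/4 is |a_0|: the convex polydisc meets the hyperplane z = a_0, which already belongs
    to the component. *)
Lemma domain_polydisc x : normc (x 0 i0) <= 5 / 4 ->
  (forall k, k != i0 -> normc (x 0 k) <= cutoff 12) -> domain_component x.
Proof.
move=> x0 xk; pose q : V := \row_k (if k == i0 then pole 0 else 0).
have q0 : q 0 i0 = pole 0 by rewrite mxE eqxx.
have qk k : k != i0 -> q 0 k = 0 by move=> k0; rewrite mxE (negbTE k0).
apply: (component_segment (domain_pole q0)) => t /andP[t0 t1].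
have cvx (a b : R[i]) (r : R) : normc a <= r -> normc b <= r ->
    normc ((1 - t)%:C * a + t%:C * b) <= r.
  move=> ar br; apply: le_trans (le_normcD _ _) _; rewrite !normcM !normc_real.
  rewrite (ger0_norm t0) ger0_norm ?subr_ge0//.
  have : (1 - t) * normc a <= (1 - t) * r by rewrite ler_wpM2l ?subr_ge0.
  have : t * normc b <= t * r by rewrite ler_wpM2l.
  lra.
apply: central_polydisc => //; rewrite ?segment_coord.
  apply: cvx => //; rewrite q0 normc_pole.
  have -> : gap 0 = 4^-1 :> R by rewrite /gap exprVn -natrX.
  lra.
move=> k k0; rewrite segment_coord; apply: cvx; last exact: xk.
by rewrite qk// normc0 ltW// cutoff_gt0.
Qed.

Lemma domain_connected : connected domain_component.
Proof. exact: component_connected. Qed.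

Lemma domain_pseudoconvex : pseudoconvex domain_component.
Proof.
apply: (pseudoconvex_increasing_union (@defining_submean R n i0 i1)).
- exact: definingS.
- exact: domain_sub.
- by move=> x; apply: component_closed; exact: open_tot.
Qed.

End Domain.

(** * Strict plurisubharmonicity of quadratic functions *)

Section SecondDifference.
Context {R : realType} {n : nat}.
Notation C := (R[i]^o).
Notation V := (Cspace R n).
Notation dirs := (bool * 'I_n)%type.
Implicit Types (x y h : V) (g : V -> R) (p q : dirs) (r : seq dirs).

Definition basis_vector p : V := real_dir p.1 p.2.

Definition real_coord p x : R := if p.1 then complex.Im (x 0 p.2) else complex.Re (x 0 p.2).

Definition combination r (d : dirs -> R) : V := \sum_(p <- r) (d p)%:C *: basis_vector p.

Lemma combination_real_coord x : x = combination (index_enum dirs) (real_coord^~ x).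
Proof.
rewrite /combination -(pair_bigA _ (fun b j => (real_coord (b, j) x)%:C *: real_dir b j))/=.
rewrite exchange_big/=; apply/rowP => k; rewrite summxE (bigD1 k)//=.
rewrite [X in _ + X]big1 => [|j jk]; last first.
  by rewrite big_bool/= /real_dir !mxE (eq_sym k) (negbTE jk) !mulr0 addr0.
rewrite addr0 big_bool/= /real_dir !mxE !eqxx/= !mulr1 /real_coord/=.
by rewrite addrC mulrC; exact: complexE.
Qed.

Definition along_derive g (dg : dirs -> V -> R) (A : set V) :=
  forall y, A y -> forall p, is_derive (0 : R) 1 (along p.1 p.2 g y) (dg p y).

Lemma along_derive_shift g dg y p (t : R) :
  is_derive (0 : R) 1 (along p.1 p.2 g (y + t%:C *: basis_vector p)) (dg p (y + t%:C *: basis_vector p)) ->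
  is_derive t 1 (along p.1 p.2 g y) (dg p (y + t%:C *: basis_vector p)).
Proof.
move=> d0; have -> : along p.1 p.2 g y =
    along p.1 p.2 g (y + t%:C *: basis_vector p) \o (fun s => s - t).
  apply/funext => s; rewrite /along/= -addrA -scalerDl -(rmorphD (real_complex R)).
  by rewrite [t + _]addrC subrK.
rewrite -[X in is_derive _ _ _ X]mulr1.
apply: is_derive1_comp; first by rewrite subrr.
by rewrite -[X in is_derive _ _ _ X]subr0; apply: is_deriveB.
Qed.

Section Lipschitz.
Variables (g : V -> R) (dg : dirs -> V -> R) (x0 : V) (delta B M : R).
Hypothesis Mb : forall p, nrm (basis_vector p) <= M.
Hypothesis dgP : along_derive g dg [set y | nrm (y - x0) < delta].
Hypothesis dgB : forall y p, nrm (y - x0) < delta -> `|dg p y| <= B.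

Let M0 (p : dirs) : 0 <= M. Proof. exact: le_trans (nrm_ge0 _) (Mb p). Qed.

Let move_near y p (s : R) : nrm (y + s%:C *: basis_vector p - x0) <= nrm (y - x0) + M * `|s|.
Proof.
rewrite addrAC; apply: le_trans (nrmD _ _) _; rewrite lerD2l nrmZ normc_real mulrC.
by rewrite ler_wpM2r.
Qed.

Let lipschitz_step y p (s : R) : nrm (y - x0) + M * `|s| < delta ->
  `|g (y + s%:C *: basis_vector p) - g y| <= B * `|s|.
Proof.
move=> ys; have m0 := M0 p.
have near (t : R) : `|t| <= `|s| -> nrm (y + t%:C *: basis_vector p - x0) < delta.
  move=> ts; apply: le_lt_trans (move_near _ _ _) _; apply: le_lt_trans ys.
  by rewrite lerD2l ler_wpM2l.
have dt (t : R) : `|t| <= `|s| ->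
    is_derive t 1 (along p.1 p.2 g y) (dg p (y + t%:C *: basis_vector p)).
  by move=> ts; apply: along_derive_shift; apply: dgP; exact: near.
pose a := Num.min 0 s; pose b := Num.max 0 s.
have ab : a <= b by rewrite /a /b; case: (leP 0 s) => // /ltW.
have abs (t : R) : a <= t <= b -> `|t| <= `|s|.
  rewrite /a /b; case: (leP 0 s) => s0 /andP[h1 h2]; first by rewrite !ger0_norm.
  by rewrite !ler0_norm ?lerN2// ltW.
have [t||c + D] := @MVT_segment R (along p.1 p.2 g y)
    (fun t => dg p (y + t%:C *: basis_vector p)) a b ab.
- by rewrite in_itv/= => /andP[h1 h2]; apply: dt; apply: abs; rewrite !ltW.
- apply: derivable_within_continuous => t; by rewrite in_itv/= => /abs/dt[].
rewrite in_itv/= => /abs /near cd.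
have -> : g (y + s%:C *: basis_vector p) - g y = along p.1 p.2 g y s - along p.1 p.2 g y 0.
  by rewrite /along scale0r addr0.
have -> : `|along p.1 p.2 g y s - along p.1 p.2 g y 0| =
    `|along p.1 p.2 g y b - along p.1 p.2 g y a|.
  by rewrite /a /b; case: (leP 0 s) => _; [by []|exact: distrC].
have -> : `|s| = `|b - a|.
  by rewrite /a /b; case: (leP 0 s) => _; rewrite ?subr0// sub0r normrN.
by rewrite D normrM ler_wpM2r// dgB.
Qed.

(** The path moves along one coordinate direction at a time, so partial derivatives suffice and no
    total differential is needed. *)
Lemma lipschitz_combination r d y : nrm (y - x0) + M * (\sum_(p <- r) `|d p|) < delta ->
  `|g (y + combination r d) - g y| <= B * \sum_(p <- r) `|d p|.
Proof.
rewrite /combination; elim: r y => [|p r IH] y.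
  by move=> _; rewrite !big_nil addr0 subrr normr0 mulr0.
rewrite !big_cons => H; have m0 := M0 p.
have S0 : 0 <= \sum_(q <- r) `|d q| by apply: sumr_ge0.
have h1 : nrm (y - x0) + M * `|d p| < delta.
  by apply: le_lt_trans H; rewrite lerD2l ler_wpM2l// lerDl.
have h2 : nrm (y + (d p)%:C *: basis_vector p - x0) + M * (\sum_(q <- r) `|d q|) < delta.
  apply: le_lt_trans H; rewrite mulrDr addrA lerD2r; exact: move_near.
have := IH _ h2; have := @lipschitz_step y p (d p) h1; rewrite addrA.
set g1 := g (_ + _ + _); set g2 := g (_ + _); set g3 := g y => k1 k2.
have -> : g1 - g3 = (g1 - g2) + (g2 - g3) by ring.
by apply: le_trans (ler_normD _ _) _; rewrite mulrDr addrC lerD.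
Qed.

Lemma nrm_combination r d : nrm (combination r d) <= M * \sum_(p <- r) `|d p|.
Proof.
rewrite /combination; elim: r => [|p r IH].
  by rewrite !big_nil mulr0 /nrm normr0 normc0.
rewrite !big_cons mulrDr; apply: le_trans (nrmD _ _) _; rewrite lerD//.
by rewrite nrmZ normc_real mulrC ler_wpM2r.
Qed.

End Lipschitz.

(* Lipschitz bound applied twice: to the partial derivatives of g, and then to
   y |-> g (y + h) - g y. *)
Lemma second_difference g dg (ddg : dirs -> dirs -> V -> R) x0 (delta B M : R) r d :
  (forall p, nrm (basis_vector p) <= M) ->
  along_derive g dg [set y | nrm (y - x0) < delta] ->
  (forall p, along_derive (dg p) (ddg p) [set y | nrm (y - x0) < delta]) ->
  (forall y p q, nrm (y - x0) < delta -> `|ddg p q y| <= B) ->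
  M * (\sum_(p <- r) `|d p|) < delta / 2 ->
  `|g (x0 + combination r d) + g (x0 - combination r d) - 2 * g x0| <=
    B * (\sum_(p <- r) `|d p|) ^+ 2.
Proof.
move=> Mb gP dgP ddgB Ml; set l := \sum_(p <- r) _ in Ml *; set h := combination r d.
have hl : nrm h <= M * l by exact: nrm_combination.
pose D y := g (y + h) - g y; pose dD p y := dg p (y + h) - dg p y.
have near y : nrm (y - x0) < delta / 2 -> nrm (y + h - x0) < delta.
  by move=> yx; rewrite addrAC; apply: le_lt_trans (nrmD _ _) _; lra.
have near' y : nrm (y - x0) < delta / 2 -> nrm (y - x0) < delta.
  by move=> yx; have := nrm_ge0 (y - x0); lra.
have DP : along_derive D dD [set y | nrm (y - x0) < delta / 2].
  move=> y /= yx p; have -> : along p.1 p.2 D y =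
      along p.1 p.2 g (y + h) - along p.1 p.2 g y.
    by apply/funext => t; rewrite /along /D fctE addrAC.
  by apply: is_deriveB; apply: gP; [exact: near|exact: near'].
have DB y p : nrm (y - x0) < delta / 2 -> `|dD p y| <= B * l.
  move=> yx; apply: (lipschitz_combination Mb (dgP p)) => [z q|]; first exact: ddgB.
  rewrite -/l; lra.
have combN : combination r (fun p => - d p) = - h.
  rewrite /h /combination -sumrN; apply: eq_bigr => p _.
  by rewrite (rmorphN (real_complex R)) scaleNr.
have lN : \sum_(p <- r) `|- d p| = l by apply: eq_bigr => p _; rewrite normrN.
have n0 : nrm (x0 - x0) = 0 by rewrite subrr /nrm normr0 normc0.
have := lipschitz_combination (r := r) (d := fun p => - d p) (y := x0) Mb DP DB.
rewrite n0 add0r lN => /(_ Ml); rewrite combN /D addrNK expr2 mulrA => H.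
rewrite -normrN; suff -> : - (g (x0 + h) + g (x0 - h) - 2 * g x0) =
  g x0 - g (x0 - h) - (g (x0 + h) - g x0) by rewrite distrC in H *; exact: H.
by ring.
Qed.

End SecondDifference.

Section StrictlyPsh.
Context {R : realType} {n : nat}.
Notation C := (R[i]^o).
Notation V := (Cspace R n).
Notation dirs := (bool * 'I_n)%type.
Implicit Types (x y h v : V) (f theta : V -> R) (p q : dirs) (U : set V).

Lemma partial_near0 b j f x : (\forall y \near x, f y = 0) ->
  \forall y \near x, partial b j f y = 0.
Proof.
move=> /nearVP[e e0 eP]; apply/nearVP; exists e => // y yx.
rewrite /partial derive1E.
have cl : continuous (fun t : R => y + t%:C *: real_dir b j).
  move=> t; refine (@continuous_fcomp R R[i]^o V (fun t => t%:C) (fun l => y + l *: real_dir b j) t _ _).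
    exact: real_complex_continuous.
  exact: line_continuous.
rewrite (@near_eq_derive _ _ _ _ (fun=> 0 : R)) ?derive_cst//.
have ny : \forall z \near y, nrm (z - x) < e.
  apply/nearVP; exists (e - nrm (y - x)); first by rewrite subr_gt0.
  by move=> z zy; have := nrmD (z - y) (y - x); rewrite addrA subrK; lra.
have : nbhs (0 : R) ((fun t : R => y + t%:C *: real_dir b j) @^-1` [set z | nrm (z - x) < e]).
  by apply: cl; rewrite scale0r addr0; exact: ny.
by apply: filterS => t; exact: eP.
Qed.

Lemma compact_abs_bounded (K : set V) f : compact K ->
  (forall x, K x -> {for x, continuous f}) -> exists2 B : R, 0 <= B & forall x, K x -> `|f x| <= B.
Proof.
move=> cK cf; have [[x Kx]|K0] := pselect (K !=set0); last first.
  by exists 0 => // x Kx; exfalso; apply: K0; exists x.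
have [||c _ cmax] := @compact_EVT_max V R (fun y => `|f y|) K _ cK.
- by exists x.
- apply: continuous_in_subspaceT => y /[1!inE] Ky.
  refine (@continuous_fcomp V R R f (fun t => `|t|) y _ _); first exact: cf.
  exact: norm_continuous.
- by exists `|f c| => // y Ky; apply: cmax; rewrite inE.
Qed.

(** The second partials are continuous on the compact support and vanish at the points of U off
    it. *)
Lemma second_partial_bounded U theta : open U -> Ck 2 U theta -> compact_support U theta ->
  exists2 B : R, 0 <= B & forall p q x, U x -> `|partial q.1 q.2 (partial p.1 p.2 theta) x| <= B.
Proof.
move=> oU [_ Ct] K.
pose f p q := partial q.1 q.2 (partial p.1 p.2 theta).
have cf p q x : U x -> {for x, continuous (f p q)}.
  move=> Ux; have [_ [_ /(_ q.1 q.2) [_ [c _]]]] := Ct p.1 p.2; exact: c.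
have H (pq : dirs * dirs) : exists B : R, 0 <= B /\ forall x, U x -> `|f pq.1 pq.2 x| <= B.
  have [|B B0 BP] := @compact_abs_bounded _ (f pq.1 pq.2) K.
    by move=> x [Ux _]; exact: cf.
  exists B; split => // x Ux; have [cx|ncx] := pselect (closure [set z | U z /\ theta z != 0] x).
    exact: BP.
  have [N xN NP] : exists2 N, nbhs x N & forall z, N z -> ~ (U z /\ theta z != 0).
    have /existsNP[N /not_implyP[xN /set0P/negP]] := ncx.
    rewrite negbK => /eqP NE; exists N => // z Nz Uz.
    by have : set0 z by rewrite -NE.
  suff -> : f pq.1 pq.2 x = 0 by rewrite normr0.
  apply: (nbhs_singleton (partial_near0 _ _ (partial_near0 _ _ _))).
  have : nbhs x U by move: oU; rewrite openE => /(_ x Ux).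
  move: xN; apply: filterS2 => z Nz Uz.
  by apply/eqP; apply: contrapT => /negP t0; exact: (NP z Nz).
have [B BP] := choice H.
exists (\sum_pq B pq) => [|p q x Ux]; first by apply: sumr_ge0 => pq _; case: (BP pq).
have [_ h] := BP (p, q); apply: le_trans (h x Ux) _; rewrite (bigD1 (p, q))//= lerDl.
by apply: sumr_ge0 => pq _; case: (BP pq).
Qed.

Lemma real_coord_le p h : `|real_coord p h| <= Num.sqrt (sqn h).
Proof.
apply: (@le_trans _ _ (normc (h 0 p.2))).
  by rewrite /real_coord; case: ifP => _; [exact: normc_Im|exact: normc_Re].
by rewrite -[normc _]ger0_norm ?normc_ge0// -sqrtr_sqr ler_wsqrtr// sqn_coord.
Qed.

(** Only the radius d depends on x. The uniformity of B over U is what yields a single e0 in the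
    definition of strict plurisubharmonicity. *)
Lemma second_difference_bound U theta : open U -> Ck 2 U theta -> compact_support U theta ->
  exists2 B : R, 0 <= B & forall x, U x -> exists2 d : R, 0 < d & forall h, sqn h < d ->
    `|theta (x + h) + theta (x - h) - 2 * theta x| <= B * sqn h.
Proof.
move=> oU Ct K; have [B B0 BP] := second_partial_bounded oU Ct K.
have [_ Ct1] := Ct.
pose N : R := #|{: dirs}|%:R; pose M : R := \sum_(p : dirs) nrm (basis_vector p : V).
have Mb p : nrm (basis_vector p : V) <= M.
  by rewrite /M (bigD1 p)//= lerDl; apply: sumr_ge0 => ? _; exact: nrm_ge0.
have M0 : 0 <= M by apply: sumr_ge0 => ? _; exact: nrm_ge0.
have N0 : 0 <= N by exact: ler0n.
exists (B * N ^+ 2) => [|x Ux]; first by rewrite mulr_ge0// sqr_ge0.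
have [d d0 dU] : exists2 d : R, 0 < d & forall y, nrm (y - x) < d -> U y.
  by apply/nearVP; move: oU; rewrite openE => /(_ x Ux).
pose e := d / 2 / (M * N + 1).
have MN0 : 0 < M * N + 1 by rewrite ltr_wpDl// mulr_ge0.
have e0 : 0 < e by rewrite !divr_gt0.
exists (e ^+ 2) => [|h he]; first exact: exprn_gt0.
pose s := Num.sqrt (sqn h).
have s0 : 0 <= s := sqrtr_ge0 _.
have se : s < e.
  by rewrite -[e]ger0_norm ?ltW// -sqrtr_sqr ltr_sqrt// exprn_gt0.
have ls : \sum_(p : dirs) `|real_coord p h| <= N * s.
  apply: (@le_trans _ _ (\sum_(p : dirs) s)).
    by apply: ler_sum => p _; exact: real_coord_le.
  by rewrite sumr_const /N mulr_natl.
have l0 : 0 <= \sum_(p : dirs) `|real_coord p h| by apply: sumr_ge0.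
have := @second_difference R n theta (fun p => partial p.1 p.2 theta)
  (fun p q => partial q.1 q.2 (partial p.1 p.2 theta)) x d B M (index_enum dirs) (real_coord^~ h) Mb.
rewrite -combination_real_coord => H.
apply: (le_trans (H _ _ _ _)).
- move=> y /dU Uy p; have [dy _] := Ct1 p.1 p.2; split; first exact: dy.
  by rewrite /partial derive1E.
- move=> p y /dU Uy q; have [_ [_ /(_ q.1 q.2) [dy _]]] := Ct1 p.1 p.2; split; first exact: dy.
  by rewrite /partial derive1E.
- by move=> y p q /dU; exact: BP.
- have : M * (\sum_(p : dirs) `|real_coord p h|) <= M * (N * s) by rewrite ler_wpM2l.
  have : (M * N + 1) * s < d / 2.
    by rewrite mulrC -ltr_pdivlMr.
  by move=> h1 h2; apply: le_lt_trans h2 _; lra.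
rewrite -mulrA ler_wpM2l//; have <- : s ^+ 2 = sqn h by rewrite sqr_sqrtr// sqn_ge0.
by rewrite -exprMn lerXn2r// nnegrE mulr_ge0.
Qed.

Lemma circle_antipode f x v r : (fun t => f (x - (r%:C * cis t) *: v)) =
  (fun t => f (x + (r%:C * cis (t + pi)) *: v)).
Proof. by apply/funext => t; rewrite cisD cispi mulrN1 mulrN scaleNr. Qed.

Lemma circle_antipode_continuous f x v r :
  (forall t, {for x + (r%:C * cis t) *: v, continuous f}) ->
  continuous (fun t => f (x - (r%:C * cis t) *: v)).
Proof.
move=> cf; rewrite circle_antipode.
exact: (@shift_continuous _ _ pi (circle_continuous cf)).
Qed.

(** Pairing antipodal points expresses the mean through symmetric second differences, in which the
    first-order terms cancel. *)
Lemma cmean_symmetric f x v r : (forall t, {for x + (r%:C * cis t) *: v, continuous f}) ->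
  2 * cmean f x v r = pmean (fun t => f (x + (r%:C * cis t) *: v) + f (x - (r%:C * cis t) *: v)).
Proof.
move=> cf; have c := circle_continuous cf.
have cp := circle_periodic f x v r.
rewrite pmeanD//; last exact: circle_antipode_continuous.
rewrite circle_antipode (pmean_shift pi c cp) /cmean; lra.
Qed.

Lemma cmean_sqn x v r : cmean (@sqn R n) x v r = sqn x + r ^+ 2 * sqn v.
Proof.
pose F (k : nat) (t : R) : R :=
  if insub k is Some j then normc ((x + (r%:C * cis t) *: v) 0 j) ^+ 2 else 0.
have FE t (j : 'I_n) : F j t = normc ((x + (r%:C * cis t) *: v) 0 j) ^+ 2.
  by rewrite /F (_ : insub (nat_of_ord j) = Some j) ?valK.
have cF k : continuous (F k).
  rewrite /F; case: insubP => [j _ _|_ t]; last exact: cvg_cst.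
  apply: (@circle_continuous _ V (fun y => normc (y 0 j) ^+ 2)) => t.
  have := @normc2_affine_submean R V (fun y => y 0 j) (fun v => v 0 j)
    (@coordC_continuous _ _ j) (coord_affine j).
  by move=> h; exact: submean_continuous (h _).
have [_ E] := pmean_sum n cF.
rewrite /cmean (_ : (fun t => _) = fun t => \sum_(k < n) F k t); last first.
  by apply/funext => t; apply: eq_bigr => j _; rewrite FE.
rewrite E /sqn mulr_sumr -big_split/=; apply: eq_bigr => j _.
rewrite (_ : F j = fun t => normc ((x + (r%:C * cis t) *: v) 0 j) ^+ 2); last first.
  by apply/funext => t; rewrite FE.
have := @cmean_normc2_affine R V (fun y => y 0 j) (fun v => v 0 j)
    (coord_affine j) x v r.
by rewrite /cmean => ->; rewrite normcM normc_real exprMn real_normK ?num_real.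
Qed.

Lemma near_quadratic_lt (k d : R) : 0 <= k -> 0 < d -> \forall r \near 0^'+, r ^+ 2 * k < d.
Proof.
move=> k0 d0; pose e := Num.min 1 (d / (k + 1)).
have k1 : 0 < k + 1 by rewrite ltr_wpDl.
have e0 : 0 < e by rewrite lt_min ltr01 divr_gt0.
near=> r.
have r0 : 0 < r by near: r; exact: nbhs_right_gt.
have : r < e by near: r; exact: nbhs_right_lt.
rewrite lt_min ltr_pdivlMr// => /andP[r1 rd].
have : r ^+ 2 <= r by rewrite expr2 ler_piMr// ltW.
move=> /(ler_wpM2r k0); lra.
Unshelve. all: by end_near. Qed.

(** On a circle of radius r in direction v the mean of a |x|^2 exceeds the central value by a r^2
    |v|^2, while e theta costs at most |e| B r^2 |v|^2 / 2. Hence e0 = a / (B + 1) serves every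
    point. *)
Lemma strictly_psh_quadratic U phi (a b : R) : open U -> U !=set0 -> 0 < a ->
  (forall x, U x -> phi x = a * sqn x + b) -> strictly_psh U (fun z => (phi z)%:E).
Proof.
move=> oU U0 a0 phiE; split; first by move=> z _; rewrite ltry.
split; first by case: U0 => z Uz; exists z.
move=> theta Ct K; have [B B0 BP] := second_difference_bound oU (Ct 2) K.
have ct x : U x -> {for x, continuous theta} by have [c _] := Ct 0; exact: c.
have Un x : U x -> nbhs x U by move: oU; rewrite openE; exact.
exists (a / (B + 1)) => [|e /andP[e1 e2]]; first by rewrite divr_gt0// ltr_wpDl.
have eB : `|e| * B <= a.
  have h : `|e| < a / (B + 1) by rewrite ltr_norml e1.
  have : `|e| * (B + 1) < a by rewrite -ltr_pdivlMr// ltr_wpDl.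
  have := normr_ge0 e; lra.
apply: (@submean_psh _ _ _ (fun z => phi z + e * theta z)) => x Ux.
apply: (@submean_eq _ _ (fun y => (a * sqn y + e * theta y) + b)).
  by apply: filterS (Un x Ux) => y Uy; rewrite phiE//; ring.
apply: submeanD; last exact: submean_cst.
have csq : cts_near (fun y => a * sqn y) x.
  by apply: cts_nearZ; case: (sqn_submean x).
have cth0 : cts_near theta x by apply: filterS (Un x Ux) => y; exact: ct.
have cth : cts_near (fun y => e * theta y) x by exact: cts_nearZ.
split; first exact: cts_nearD.
move=> v; have [d d0 dP] := BP x Ux.
near=> r.
have r0 : 0 < r by near: r; exact: nbhs_right_gt.
have rU t : U (x + (r%:C * cis t) *: v).
  by move: t; near: r; exact: (circle_near v (Un x Ux)).
have -> : cmean (fun y => a * sqn y + e * theta y) x v r =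
    cmean (fun y => a * sqn y) x v r + cmean (fun y => e * theta y) x v r.
  by near: r; exact: cmeanD.
have -> : cmean (fun y => a * sqn y) x v r = a * cmean (@sqn R n) x v r.
  by near: r; apply: cmeanZ; case: (sqn_submean x).
have -> : cmean (fun y => e * theta y) x v r = e * cmean theta x v r.
  by near: r; exact: cmeanZ.
rewrite cmean_sqn.
have rd : r ^+ 2 * sqn v < d.
  by near: r; apply: near_quadratic_lt => //; exact: sqn_ge0.
have hE t : sqn ((r%:C * cis t) *: v) = r ^+ 2 * sqn v.
  rewrite /sqn mulr_sumr; apply: eq_bigr => j _.
  by rewrite !mxE !normcM normc_cis mulr1 normc_real ger0_norm ?ltW// exprMn.
have cc t : {for x + (r%:C * cis t) *: v, continuous theta} by apply: ct; exact: rU.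
have cs := cmean_symmetric cc.
have cpm : continuous (fun t => theta (x + (r%:C * cis t) *: v) + theta (x - (r%:C * cis t) *: v)).
  by move=> t; apply: cvgD; [exact: circle_continuous|exact: circle_antipode_continuous].
set Q := r ^+ 2 * sqn v in rd hE *.
have b1 : 2 * theta x - B * Q <= 2 * cmean theta x v r.
  rewrite cs -[leLHS]pmean_cst; apply: le_pmean => [?||t _]; [exact: cvg_cst|exact: cpm|].
  have := dP ((r%:C * cis t) *: v); rewrite hE => /(_ rd); rewrite ler_norml; lra.
have b2 : 2 * cmean theta x v r <= 2 * theta x + B * Q.
  rewrite cs -[leRHS]pmean_cst; apply: le_pmean => [|?|t _]; [exact: cpm|exact: cvg_cst|].
  have := dP ((r%:C * cis t) *: v); rewrite hE => /(_ rd); rewrite ler_norml; lra.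
have : `|e * (cmean theta x v r - theta x)| <= `|e| * (B * Q / 2).
  by rewrite normrM ler_wpM2l// ler_norml; lra.
have Q0 : 0 <= Q by rewrite mulr_ge0 ?sqr_ge0 ?sqn_ge0.
have : `|e| * B * Q <= a * Q by rewrite ler_wpM2r.
have aQ : 0 <= a * Q by rewrite mulr_ge0// ltW.
rewrite ler_norml => h1 /andP[h2 _]; lra.
Unshelve. all: by end_near. Qed.

End StrictlyPsh.

(** * The continuous function of assertion (1) *)

Section Barrier.
Context {R : realType} {n : nat}.
Notation C := (R[i]^o).
Notation V := (Cspace R n).
Variables i0 i1 : 'I_n.
Hypothesis i01 : i0 != i1.
Implicit Types x y : V.

Let Om : set V := domain_component i0 i1.

(** Over |z| <= 1 and |w| < 1/2 all coordinates are at most e = exp 1 in modulus, so slope * (1 +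
    |x|^2) <= 1/8 there, well below |z|^2 near |z| = 1. *)
Definition slope : R := (8 * (1 + n%:R * expR 1 ^+ 2))^-1.

Lemma slope_gt0 : 0 < slope.
Proof. by rewrite invr_gt0 mulr_gt0// ltr_pwDl// mulr_ge0// sqr_ge0. Qed.

Lemma disc_off (z : R[i]) j : normc z <= 1 -> hole j <= normc (z - pole j).
Proof.
move=> z1; have := normc_dist (pole j) z; rewrite normcB normc_pole => /(le_trans (ler_norm _)).
by have := hole_lt (R := R) j; have := gap_gt0 (R := R) j; lra.
Qed.

Lemma sqn_disc x : Om x -> normc (x 0 i1) < 2^-1 -> normc (x 0 i0) <= 1 ->
  slope * (1 + sqn x) <= 8^-1.
Proof.
move=> Ox x1 x0; have off j := @disc_off (x 0 i0) j x0.
have [_ /(_ x0) xk] := central_bounds (domain_sub Ox) off x1.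
have : sqn x <= n%:R * expR 1 ^+ 2.
  rewrite /sqn -[n in n%:R]card_ord mulr_natl -sumr_const; apply: ler_sum => k _.
  by rewrite lerXn2r// nnegrE ?normc_ge0// expR_ge0.
have h : 0 <= n%:R * expR 1 ^+ 2 :> R by rewrite mulr_ge0// sqr_ge0.
move=> h1; rewrite /slope invfM -mulrA ler_piMr// mulrC ler_pdivrMr ?mul1r; lra.
Qed.

(** The quadratic term supplies strictness in every direction near the origin, where |z|^2 alone is
    constant along the other coordinates. *)
Definition barrier x : R :=
  if normc (x 0 i1) < 2^-1 then
    if normc (x 0 i0) <= 1 then Num.max (normc (x 0 i0) ^+ 2) (slope * (1 + sqn x))
    else Num.max 1 (paraboloid (x 0 i0))
  else 1.

Let cn (k : 'I_n) : continuous (fun y : V => normc (y 0 k)).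
Proof. exact: (@normc_affine_continuous R V _ (@coordC_continuous R n k)). Qed.

Let near_lt (k : 'I_n) (b : R) x : normc (x 0 k) < b -> \forall y \near x, normc ((y : V) 0 k) < b.
Proof. by move=> h; exact: (cvgr_lt _ (@cn k x)). Qed.

Let near_gt (k : 'I_n) (b : R) x : b < normc (x 0 k) -> \forall y \near x, b < normc ((y : V) 0 k).
Proof. by move=> h; exact: (cvgr_gt _ (@cn k x)). Qed.

Let sq_submean x : submean_at (fun y : V => normc (y 0 i0) ^+ 2) x.
Proof.
exact: (@normc2_affine_submean R V (fun y => y 0 i0) (fun v => v 0 i0)
  (@coordC_continuous _ _ i0) (coord_affine i0)).
Qed.

Let par_submean x : submean_at (fun y : V => paraboloid (y 0 i0)) x.
Proof.
apply: (@submean_comp R V C (fun y => y 0 i0) (fun v => v 0 i0)).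
- exact: coordC_continuous.
- exact: coord_affine.
- exact: paraboloid_submean.
Qed.

Let quad_submean x : submean_at (fun y : V => slope * (1 + sqn y)) x.
Proof.
apply: submeanZ; first exact/ltW/slope_gt0.
by apply: submeanD; [exact: submean_cst|exact: sqn_submean].
Qed.

Let near_dom x : Om x -> nbhs x Om.
Proof. by move: (@open_domain R n i0 i1); rewrite openE; exact. Qed.

Lemma barrier_neck x : Om x -> 4^-1 < normc (x 0 i1) -> barrier x = 1.
Proof.
move=> Ox x1; rewrite /barrier; case: ifPn => // x12.
have [j xj] : exists j, normc (x 0 i0 - pole j) < hole j.
  apply: contrapT => /forallNP H; move: x1; apply/negP; rewrite -leNgt.
  apply: (neck_narrow (domain_sub Ox)) => // j; rewrite leNgt; apply/negP; exact: H.
case: ifPn => [x0|_]; first by move: xj; rewrite ltNge disc_off.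
by apply: max_l; exact: paraboloid_hole xj.
Qed.

(** The delicate points are those over |z| = 1, where psi lies below the function and touches it. *)
Lemma barrier_submean x : Om x -> submean_at barrier x.
Proof.
move=> Ox; have nO := near_dom Ox.
have [x1|x1] := ltP (4^-1) (normc (x 0 i1)).
  apply: (@submean_eq _ _ (fun=> 1)); last exact: submean_cst.
  by move: (near_gt x1) nO; apply: filterS2 => y y1 Oy; rewrite barrier_neck.
have x12 : normc (x 0 i1) < 2^-1 by apply: le_lt_trans x1 _; lra.
have n1 := near_lt x12.
have [x0|x0|x0] := ltgtP (normc (x 0 i0)) 1.
- apply: (@submean_eq _ _ (fun y => Num.max (normc (y 0 i0) ^+ 2) (slope * (1 + sqn y)))).
    move: (near_lt x0) n1; apply: filterS2 => y y0 y1.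
    by rewrite /barrier y1 ltW.
  by apply: submean_max; [exact: sq_submean|exact: quad_submean].
- apply: (@submean_eq _ _ (fun y => Num.max 1 (paraboloid (y 0 i0)))).
    move: (near_gt x0) n1; apply: filterS2 => y y0 y1.
    by rewrite /barrier y1 leNgt y0.
  by apply: submean_max; [exact: submean_cst|exact: par_submean].
have nq : \forall y \near x, slope * (1 + sqn y) < 4^-1.
  have := submean_continuous (quad_submean x) => c; apply: (cvgr_lt _ c).
  by apply: le_lt_trans (sqn_disc Ox x12 _) _; rewrite ?x0//; lra.
have ns : \forall y \near x, 4^-1 < normc ((y : V) 0 i0) ^+ 2.
  have := submean_continuous (sq_submean x) => c; apply: (cvgr_gt _ c).
  by rewrite x0 expr1n; lra.
(* Here |z|^2 > 1/4 dominates the quadratic term, and psi = |z|^2 on the closed unit disc, so one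
   formula covers both sides of the circle. *)
have E : \forall y \near x, barrier y =
    Num.max (Num.min (normc ((y : V) 0 i0) ^+ 2) 1) (paraboloid (y 0 i0)).
  near=> y.
  have y1 : normc (y 0 i1) < 2^-1 by near: y; exact: n1.
  have yq : slope * (1 + sqn y) < 4^-1 by near: y; exact: nq.
  have ys : 4^-1 < normc (y 0 i0) ^+ 2 by near: y; exact: ns.
  rewrite /barrier y1; case: (leP (normc (y 0 i0)) 1) => y0.
    rewrite paraboloid_disc// min_l; last by rewrite expr_le1 ?normc_ge0.
    by rewrite max_l ?maxxx//; lra.
  by rewrite min_r//; apply: exprn_ege1; exact: ltW.
have cE : cts_near barrier x.
  apply: (@cts_near_eq _ _ (fun y => Num.max (Num.min (normc (y 0 i0) ^+ 2) 1) (paraboloid (y 0 i0)))).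
    by apply: filterS E => y ->.
  apply: continuous_cts_near => y.
  have c1 : continuous_at y (fun y : V => normc (y 0 i0) ^+ 2).
    exact: submean_continuous (sq_submean y).
  have c2 : continuous_at y (fun y : V => paraboloid (y 0 i0)).
    exact: submean_continuous (par_submean y).
  have c3 : continuous_at y (fun y : V => Num.min (normc (y 0 i0) ^+ 2) 1).
    refine (@continuous_min R V (fun y : V => normc (y 0 i0) ^+ 2) (fun=> 1) y c1 _).
    exact: (@continuous_at_cst R V R^o (1 : R) y).
  exact: (@continuous_max R V _ _ y c3 c2).
apply: (submean_le (par_submean x)) => //.
  by rewrite (nbhs_singleton E) paraboloid_disc ?x0// expr1n minxx maxxx.
by apply: filterS E => y ->; rewrite le_max lexx orbT.
Unshelve. all: by end_near. Qed.

Lemma barrier_le x : Om x -> barrier x <= expR 4.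
Proof.
move=> Ox; have e1 : 1 <= expR 4 :> R by rewrite -expR0 ler_expR.
rewrite /barrier; case: ifPn => // x1; case: ifPn => x0.
  rewrite ge_max; apply/andP; split.
    by apply: le_trans e1; rewrite expr_le1 ?normc_ge0.
  by apply: le_trans (sqn_disc Ox x1 x0) _; lra.
rewrite ge_max e1/=.
have [[j xj]|H] := pselect (exists j, normc (x 0 i0 - pole j) < hole j).
  by apply: le_trans e1; exact: paraboloid_hole xj.
have off j : hole j <= normc (x 0 i0 - pole j).
  by rewrite leNgt; apply/negP => xj; apply: H; exists j.
have [h _] := central_bounds (domain_sub Ox) off x1.
apply: le_trans (paraboloid_le _) _.
have -> : expR 4 = expR 2 ^+ 2 :> R by rewrite -expRM_natl; congr expR; lra.
by rewrite lerXn2r// nnegrE ?normc_ge0// expR_ge0.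
Qed.

(** The first bound gives |z|^2 < slope, so that the quadratic term wins; the second puts the ball
    inside the polydisc. *)
Definition core_radius : R := Num.min slope (cutoff 12 ^+ 2).

Definition core_ball : set V := [set x | sqn x < core_radius].

Lemma core_radius_gt0 : 0 < core_radius.
Proof. by rewrite lt_min slope_gt0 exprn_gt0// cutoff_gt0. Qed.

Lemma core_ball0 : core_ball 0.
Proof.
rewrite /core_ball/= (_ : sqn 0 = 0) ?core_radius_gt0//.
by rewrite /sqn big1// => k _; rewrite mxE normc0 expr0n.
Qed.

Lemma core_ball_open : open core_ball.
Proof.
rewrite openE => x xr; have c := submean_continuous (@sqn_submean R n x).
by apply: (cvgr_lt _ c).
Qed.

Lemma core_ball_coord x k : core_ball x -> normc (x 0 k) < cutoff 12 /\ normc (x 0 k) ^+ 2 < slope.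
Proof.
rewrite /core_ball/= lt_min => /andP[h1 h2]; have := sqn_coord x k => h; split; last first.
  exact: le_lt_trans h h1.
have : normc (x 0 k) ^+ 2 < cutoff 12 ^+ 2 := le_lt_trans h h2.
by rewrite ltr_pXn2r ?nnegrE ?normc_ge0 ?(ltW (cutoff_gt0 _)).
Qed.

Lemma core_ball_sub : core_ball `<=` Om.
Proof.
move=> x xr; apply: domain_polydisc => // [|k _].
  have [h _] := core_ball_coord i0 xr; have := @cutoff_le1 R 12; lra.
by have [h _] := core_ball_coord k xr; exact: ltW.
Qed.

Lemma barrier_core x : core_ball x -> barrier x = slope * sqn x + slope.
Proof.
move=> xr; have [a1 a2] := core_ball_coord i0 xr; have [b1 b2] := core_ball_coord i1 xr.
have c1 := @cutoff_le1 R 12.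
have c2 : cutoff 12 < 2^-1 :> R.
  rewrite /cutoff expRN ltf_pV2 ?posrE ?expR_gt0//.
  by have := expR_ge1Dx (12%:R : R); lra.
rewrite /barrier (lt_trans b1 c2) ifT; last by rewrite ltW// (lt_le_trans a1).
rewrite max_r; first by ring.
have := mulr_ge0 (ltW slope_gt0) (sqn_ge0 x); lra.
Qed.

Lemma barrier_pshk : pshk 0 Om (fun x => barrier x - (expR 4 + 1)).
Proof.
have s x : Om x -> submean_at (fun x => barrier x - (expR 4 + 1)) x.
  by move=> Ox; apply: submeanD; [exact: barrier_submean|exact: submean_cst].
split; first exact: submean_psh.
by split => // x /s; exact: submean_continuous.
Qed.

Lemma barrier_strictly_psh : strictly_psh core_ball (fun x => (barrier x - (expR 4 + 1))%:E).
Proof.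
apply: (@strictly_psh_quadratic _ _ _ _ slope (slope - (expR 4 + 1))).
- exact: core_ball_open.
- by exists 0; exact: core_ball0.
- exact: slope_gt0.
- by move=> x xr; rewrite barrier_core// addrA.
Qed.

End Barrier.

(** * Rigidity of C^1 functions *)

Section Rigidity.
Context {R : realType} {n : nat}.
Notation C := (R[i]^o).
Notation V := (Cspace R n).
Variables i0 i1 : 'I_n.
Hypothesis i01 : i0 != i1.
Implicit Types x v : V.

Let Om : set V := domain_component i0 i1.

Variables (u : V -> R) (B : R).
Hypothesis pu : pshk 1 Om u.
Hypothesis uB : forall x, Om x -> u x <= B.

Let cu x : Om x -> {for x, continuous u}.
Proof. by case: pu => _ [+ _]; exact. Qed.

Let su x : Om x -> submean_at u x.
Proof. by case: pu => pu' _; apply: psh_submean => //; exact: open_domain. Qed.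

Lemma complex_line_constant x v : (forall l : R[i], Om (x + l *: v)) -> u (x + v) = u x.
Proof.
move=> xv; have := @liouville R (fun l : C => u (x + l *: v)) B.
have H (l : C) : submean_at (fun l : C => u (x + l *: v)) l by apply: submean_line; exact: su.
move=> /(_ H (fun l => uB (xv l)) 1 0); by rewrite scale1r scale0r addr0.
Qed.

Let c : R := u (base_point i0 i1 0).

Lemma constant_base z : u (base_point i0 i1 z) = c.
Proof.
rewrite -[base_point _ _ z](subrK (base_point i0 i1 0)) addrC.
apply: complex_line_constant => l.
suff -> : base_point i0 i1 0 + l *: (base_point i0 i1 z - base_point i0 i1 0) = base_point i0 i1 (l * z).
  exact: domain_base.
apply/rowP => k; rewrite !mxE; case: ifP => _; first by rewrite subr0 add0r.
by rewrite subrr mulr0 addr0.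
Qed.

Lemma constant_pole j x : x 0 i0 = pole j -> u x = c.
Proof.
move=> xj; rewrite -(constant_base (pole j)).
rewrite -[in LHS](subrK (base_point i0 i1 (pole j)) x) addrC.
apply: complex_line_constant => l; apply: (@domain_pole _ _ _ _ i01 j).
by rewrite coord_affine !mxE eqxx xj subrr mulr0 addr0.
Qed.

Let e0 : V := delta_mx 0 i0.

(** The slice replaces the first coordinate of x by z. It stays in the polydisc for |z| <= 5/4, a
    range that contains every pole. *)
Lemma constant_slice x z : (forall k, k != i0 -> normc (x 0 k) <= cutoff 12) ->
  normc z <= 1 -> u (x - x 0 i0 *: e0 + z *: e0) = c.
Proof.
move=> xk; pose P (z : C) : V := x - x 0 i0 *: e0 + z *: e0.
have P0 y : P y 0 i0 = y by rewrite /P /e0 coord_affine !mxE !eqxx/= !mulr1 subrr add0r.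
have Pk y k : k != i0 -> P y 0 k = x 0 k.
  by move=> k0; rewrite /P /e0 coord_affine !mxE !eqxx/= (negbTE k0) !mulr0 subr0 addr0.
have PO y : normc y <= 5 / 4 -> Om (P y).
  by move=> y1; apply: domain_polydisc => // [|k k0]; rewrite ?P0// Pk// xk.
have le1 (y : C) : normc y <= 1 -> normc y <= 5 / 4 by move=> h; apply: le_trans h _; lra.
have pole1 j : normc (pole j : R[i]) <= 5 / 4.
  by rewrite normc_pole; have := @gap_le R j; lra.
have cg (y : C) : normc y <= 1 -> {for y, continuous (fun y => u (P y))}.
  move=> y1; refine (@continuous_fcomp C V R P u y _ _); first exact: line_continuous.
  exact/cu/PO/le1.
apply: (@hopf_disc R (fun y => u (P y)) c) => //.
- by move=> y y1; apply: submean_line; apply/su/PO/le1/ltW.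
- move=> y y1; apply/eqP; rewrite -subr_eq0 -normr_le0; apply/ler_addgt0Pr => e ee.
  have := cg y; rewrite y1 lexx => /(_ isT) /continuous_distP /(_ e ee) /nearCP[d d0 dP].
  have [j jd] := pole_dense y1 d0.
  by have := dP _ jd; rewrite (constant_pole (P0 _)) add0r => /ltW.
(* The only use of C^1 regularity: the partial derivative along Re z at the point of the slice with
   z = 1. *)
- have [_ [_ /(_ false i0) [d _]]] := pu.
  have O1 : Om (P 1) by apply/PO/le1; rewrite normc1.
  have := d (P 1) O1; rewrite (_ : along _ _ _ _ = fun t => u (P (1 + t%:C)))//.
  by apply/funext => t; rewrite /along /real_dir scale1r /P scalerDl addrA.
- move=> d d0; have [j jd jE] := pole_real d0; exists (gap j); first by rewrite gap_gt0.
  rewrite -(constant_pole (P0 (pole j))) jE.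
  by rewrite (rmorphD (real_complex R)) (rmorph1 (real_complex R)).
Qed.

Lemma constant_core x : core_ball x -> u x = c.
Proof.
move=> xr; rewrite -(@constant_slice x (x 0 i0)); first by rewrite subrK.
  by move=> k _; have [/ltW] := core_ball_coord k xr.
have [/ltW h _] := core_ball_coord i0 xr; exact: le_trans h (cutoff_le1 _).
Qed.

End Rigidity.

(** * Smooth bump functions and the cores *)

Section Flat.
Context {R : realType}.
Implicit Types (k : nat) (t : R).

(** For k = 0 this is the classical smooth flat function exp (-1/t); the other k express its
    derivatives. *)
Definition flat k t : R := if 0 < t then t^-1 ^+ k * expR (- t^-1) else 0.

Lemma flat_ge0 k t : 0 <= flat k t.
Proof.
rewrite /flat; case: ifPn => // t0.
by rewrite mulr_ge0 ?expR_ge0// exprn_ge0// invr_ge0 ltW.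
Qed.

(** The term of order k + 2 of the series of exp (1/t) bounds it from below. Quadratic vanishing is
    what makes the derivative at 0 zero. *)
Lemma flat_le k t : flat k t <= (k.+2)`!%:R * t ^+ 2.
Proof.
rewrite /flat; case: ifPn => [t0|_]; last by rewrite mulr_ge0 ?sqr_ge0.
have s0 : 0 < t^-1 by rewrite invr_gt0.
have := expR_ge1Dxn k.+1 (ltW s0) => h.
rewrite expRN ler_pdivrMr ?expR_gt0//.
have -> : t^-1 ^+ k = t^-1 ^+ k.+2 * t ^+ 2.
  by rewrite -addn2 exprD -mulrA -exprMn mulVf ?gt_eqF// expr1n mulr1.
rewrite [leRHS]mulrAC ler_pM2r ?exprn_gt0//.
rewrite mulrC -ler_pdivrMr ?ltr0n ?fact_gt0//; lra.
Qed.

Definition flat' k t : R := - (k%:R) * flat k.+1 t + flat k.+2 t.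

Lemma flat_derive k t : is_derive t 1 (flat k) (flat' k t).
Proof.
have [t0|t0|->] := ltgtP t 0.
- rewrite /flat' /flat ltNge (ltW t0)/= mulr0 addr0.
  apply: (@near_eq_is_derive _ _ _ (fun=> 0 : R)).
    by apply: filterS (lt_nbhsl t0) => s s0; rewrite /flat ltNge (ltW s0).
- rewrite /flat' /flat t0.
  apply: (@near_eq_is_derive _ _ _ (fun s : R => s^-1 ^+ k * expR (- s^-1))).
    by apply: filterS (lt_nbhsr t0) => s s0; rewrite /flat s0.
  have dV : is_derive t 1 (fun s : R => s^-1) (- t^-1 ^+ 2).
    have := @is_deriveV R id t 1 1 (lt0r_neq0 t0) (is_derive_id _ _).
    by move=> h; apply: (is_derive_eq h); rewrite exprVn [_ *: _]mulr1.
  have dX := is_deriveX k dV.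
  have dE : is_derive t 1 (fun s : R => expR (- s^-1)) (expR (- t^-1) * t^-1 ^+ 2).
    apply: (@is_derive1_comp R expR (fun s => - s^-1)).
    by rewrite -[X in is_derive _ _ _ X]opprK; apply: is_deriveN.
  have := is_deriveM dX dE; set F := (X in is_derive _ _ X _); move=> h.
  have FE : F = fun s : R => s^-1 ^+ k * expR (- s^-1).
    by apply/funext => s; rewrite /F fctE exprfctE.
  rewrite -FE; apply: (is_derive_eq h).
  rewrite exprfctE -![_ *: _]/(_ * _); case: (k) => [|m]; first by ring.
  by rewrite /= !(exprS _ m.+1) !(exprS _ m.+2) !(exprS _ m.+1) !(exprS _ m); ring.
- rewrite /flat' /flat ltxx mulr0 addr0.
  have H : (fun h : R => h^-1 *: (flat k (h *: 1 + 0) - flat k 0)) @ 0^' --> (0 : R).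
    apply/cvgrPdist_lt => e e0; pose C : R := (k.+2)`!%:R.
    have C1 : 0 < C + 1 by rewrite ltr_wpDl// ler0n.
    near=> h.
    have h0 : h != 0 by near: h; exact: nbhs_dnbhs_neq.
    have he : `|h| < e / (C + 1).
      near: h; apply: dnbhs0_lt; exact: divr_gt0.
    have nh : 0 < `|h| by rewrite normr_gt0.
    rewrite sub0r normrN [_ *: (1 : R)]mulr1 addr0 {2}/flat ltxx subr0.
    rewrite [_ *: _]/(_ * _) normrM normfV (ger0_norm (flat_ge0 _ _)) mulrC ltr_pdivrMr//.
    apply: le_lt_trans (flat_le _ _) _; rewrite -real_normK ?num_real// -/C expr2 mulrA.
    rewrite ltr_pM2r//; move: he; rewrite ltr_pdivlMr//; lra.
  apply: DeriveDef; first by apply/cvg_ex; exists 0.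
  exact: cvg_lim H.
Unshelve. all: by end_near. Qed.

Lemma flat_continuous k : continuous (flat k).
Proof.
by move=> t; apply/differentiable_continuous; apply/derivable1_diffP; case: (flat_derive k t).
Qed.

End Flat.

Section Smooth.
Context {R : realType} {n : nat}.
Notation V := (Cspace R n).
Notation dirs := (bool * 'I_n)%type.
Implicit Types (f g : V -> R) (p q : dirs).

(* Closed under partial derivatives since the derivative of [flat k] is a
   combination of [flat k.+1] and [flat k.+2]. *)
Inductive smooth : (V -> R) -> Prop :=
| smooth_cst c : smooth (fun=> c)
| smooth_coord p : smooth (real_coord p)
| smooth_add f g : smooth f -> smooth g -> smooth (fun x => f x + g x)
| smooth_mul f g : smooth f -> smooth g -> smooth (fun x => f x * g x)
| smooth_flat k f : smooth f -> smooth (fun x => flat k (f x)).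

Lemma smooth_continuous f : smooth f -> continuous f.
Proof.
elim=> {f} [c|p|f g _ cf _ cg|f g _ cf _ cg|k f _ cf] x.
- exact: (@continuous_at_cst _ V).
- rewrite /real_coord; case: p.1.
    refine (@continuous_fcomp V R[i]^o R (fun x => x 0 p.2) (@complex.Im R) x _ _).
      exact: coordC_continuous.
    exact: Im_continuous.
  refine (@continuous_fcomp V R[i]^o R (fun x => x 0 p.2) (@complex.Re R) x _ _).
    exact: coordC_continuous.
  exact: Re_continuous.
- exact: (@continuous_atD _ V R _ _ x (cf x) (cg x)).
- exact: (@cvgM R V (nbhs x) _ _ _ _ _ (cf x) (cg x)).
- refine (@continuous_fcomp V R R f (flat k) x _ _); first exact: cf.
  exact: flat_continuous.
Qed.

Lemma along0 f p z : along p.1 p.2 f z 0 = f z.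
Proof. by rewrite /along scale0r addr0. Qed.

Lemma smooth_along f p : smooth f -> exists2 f', smooth f' &
  forall z, is_derive (0 : R) 1 (along p.1 p.2 f z) (f' z).
Proof.
elim=> {f} [c|q|f g sf [f' sf' df] sg [g' sg' dg]|f g sf [f' sf' df] sg [g' sg' dg]|k f sf [f' sf' df]].
- exists (fun=> 0); first exact: smooth_cst.
  by move=> z; exact: is_derive_cst.
- exists (fun=> real_coord q (basis_vector p)); first exact: smooth_cst.
  move=> z; rewrite (_ : along _ _ _ _ = fun t => real_coord q z + t * real_coord q (basis_vector p)).
    have := is_deriveD (is_derive_cst (real_coord q z) (0 : R) (1 : R))
      (is_deriveM (is_derive_id (0 : R) (1 : R)) (is_derive_cst (real_coord q (basis_vector p)) (0 : R) (1 : R))).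
    by move=> h; apply: (is_derive_eq h); rewrite /= scale0r !add0r [_ *: _]mulr1.
  apply/funext => t; rewrite /along /real_coord coord_affine -/(basis_vector p).
  by case: q.1; case: (z 0 _) => a b; case: (basis_vector p 0 _) => c d /=; simpc => /=; ring.
- exists (fun x => f' x + g' x); first exact: smooth_add.
  by move=> z; apply: is_deriveD.
- exists (fun x => f x * g' x + g x * f' x).
    by apply: smooth_add; exact: smooth_mul.
  move=> z; rewrite -[f z](along0 f p) -[g z](along0 g p).
  exact: is_deriveM.
- exists (fun x => (- k%:R * flat k.+1 (f x) + flat k.+2 (f x)) * f' x).
    apply: smooth_mul => //; apply: smooth_add; last exact: smooth_flat.
    by apply: (smooth_mul (f := fun=> - k%:R)); [exact: smooth_cst|exact: smooth_flat].
  move=> z; apply: (@is_derive1_comp R (flat k) (along p.1 p.2 f z)) => //.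
  rewrite along0; exact: flat_derive.
Qed.

Lemma smooth_Ck f k (U : set V) : smooth f -> Ck k U f.
Proof.
elim: k f => [|k IH] f sf; first by split => // z _; exact: smooth_continuous.
split=> [z _|b j]; first exact: smooth_continuous.
have [f' sf' df] := smooth_along (b, j) sf.
split => [z _|]; first by case: (df z).
rewrite (_ : partial b j f = f'); first exact: IH.
by apply/funext => z; rewrite /partial derive1E; have [_] := df z.
Qed.

Lemma smooth_sqn : smooth (@sqn R n).
Proof.
rewrite (_ : sqn = fun x => \sum_(j <- index_enum 'I_n)
    (real_coord (false, j) x * real_coord (false, j) x +
     real_coord (true, j) x * real_coord (true, j) x)); last first.
  by apply/funext => x; apply: eq_bigr => j _; rewrite normc_sqr !expr2.
elim: (index_enum _) => [|j r IH].
  rewrite (_ : (fun x => _) = fun=> 0); first exact: smooth_cst.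
  by apply/funext => x; rewrite big_nil.
rewrite (_ : (fun x => _) = fun x => (real_coord (false, j) x * real_coord (false, j) x +
     real_coord (true, j) x * real_coord (true, j) x) + \sum_(j <- r)
    (real_coord (false, j) x * real_coord (false, j) x +
     real_coord (true, j) x * real_coord (true, j) x)); last first.
  by apply/funext => x; rewrite big_cons.
apply: smooth_add => //.
by apply: smooth_add; apply: smooth_mul; exact: smooth_coord.
Qed.

Definition flat_bump (rho : R) (x : V) : R := flat 0 (rho - sqn x).

Lemma flat_bump_Cinfty rho U : Cinfty U (flat_bump rho).
Proof.
move=> k; apply: smooth_Ck; apply: smooth_flat.
rewrite (_ : (fun x => _) = fun x => rho + -1 * sqn x); last first.
  by apply/funext => x; rewrite mulN1r.
apply: smooth_add; first exact: smooth_cst.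
by apply: smooth_mul; [exact: smooth_cst|exact: smooth_sqn].
Qed.

Lemma flat_bump_compact_support rho U : [set x | sqn x <= rho] `<=` U -> compact_support U (flat_bump rho).
Proof.
move=> sU; rewrite /compact_support.
have cl : closed [set x : V | sqn x <= rho].
  have -> : [set x : V | sqn x <= rho] = (@sqn R n) @^-1` [set t | t <= rho] by [].
  apply: closed_comp; last exact: closed_le.
  by move=> x _; exact/submean_continuous/sqn_submean.
have sub : closure [set z | U z /\ flat_bump rho z != 0] `<=` [set x : V | sqn x <= rho].
  rewrite [X in _ `<=` X](closure_id _).1//; apply: closure_subset => x [_].
  rewrite /flat_bump /flat; case: ifPn => [|_]; last by rewrite eqxx.
  by rewrite subr_gt0 => /ltW.
have -> : U `&` closure [set z | U z /\ flat_bump rho z != 0] = closure [set z | U z /\ flat_bump rho z != 0].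
  by apply/seteqP; split => [x []//|x cx]; split => //; apply/sU/sub.
by apply: (@compact_sqn _ _ _ rho); [exact: closed_closure|exact: sub].
Qed.

Lemma flat_decreasing rho (s t : R) : 0 <= s < t -> t < rho -> flat 0 (rho - t) < flat 0 (rho - s).
Proof.
move=> /andP[s0 st] tr; rewrite /flat !subr_gt0 tr (lt_trans st tr) !expr0 !mul1r.
by rewrite ltr_expR ltrN2 ltf_pV2 ?posrE; lra.
Qed.

End Smooth.

(** * Locally constant functions are not strictly plurisubharmonic *)

Section Core.
Context {R : realType} {n : nat}.
Notation V := (Cspace R n).
Implicit Types (x : V) (U : set V).

Lemma sqn0 : sqn (0 : V) = 0.
Proof. by rewrite /sqn big1// => k _; rewrite mxE normc0 expr0n. Qed.

Lemma near0_sqn (P : set V) : (\forall y \near (0 : V), P y) ->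
  exists2 r : R, 0 < r & forall x, sqn x <= r -> P x.
Proof.
move=> /nearVP[d d0 dP].
pose N : R := #|{: bool * 'I_n}|%:R; pose M : R := \sum_(p : bool * 'I_n) nrm (basis_vector p : V).
have Mb p : nrm (basis_vector p : V) <= M.
  by rewrite /M (bigD1 p)//= lerDl; apply: sumr_ge0 => ? _; exact: nrm_ge0.
have M0 : 0 <= M by apply: sumr_ge0 => ? _; exact: nrm_ge0.
have MN0 : 0 <= M * N by rewrite mulr_ge0// ler0n.
have MN1 : 0 < M * N + 1 by rewrite ltr_wpDl.
pose e := d / (M * N + 1); have e0 : 0 < e by rewrite divr_gt0.
exists (e ^+ 2) => [|x xe]; first exact: exprn_gt0.
apply: dP; rewrite subr0 [in nrm x](combination_real_coord x).
apply: le_lt_trans (nrm_combination Mb _ _) _.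
have se : Num.sqrt (sqn x) <= e.
  by rewrite -(ger0_norm (ltW e0)) -sqrtr_sqr ler_wsqrtr.
have ls : \sum_(p : bool * 'I_n) `|real_coord p x| <= N * e.
  apply: (@le_trans _ _ (\sum_(p : bool * 'I_n) e)).
    by apply: ler_sum => p _; apply: le_trans (real_coord_le _ _) se.
  by rewrite sumr_const /N mulr_natl.
apply: le_lt_trans (ler_wpM2l M0 ls) _; rewrite mulrA.
have : e * (M * N + 1) = d by rewrite divfK// gt_eqF.
lra.
Qed.

(** Adding a small positive multiple of a radially decreasing bump gives a function whose value at 0
    exceeds its mean over every small circle around 0. *)
Lemma constant_not_strictly_psh U phi (c : R) (k : 'I_n) : open U -> U 0 ->
  (forall x, U x -> {for x, continuous phi}) -> (\forall x \near (0 : V), phi x = c) ->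
  ~ strictly_psh U (fun x => (phi x)%:E).
Proof.
move=> oU U0 cphi nc [_ [_ sp]].
have n0 : \forall x \near (0 : V), phi x = c /\ U x.
  by apply: filterI nc _; move: oU; rewrite openE; exact.
have [rho rho0 rP] := near0_sqn n0.
have [e0 e0_gt0 H] := sp (flat_bump rho) (@flat_bump_Cinfty R n rho U)
  (flat_bump_compact_support (fun x xr => (rP x xr).2)).
have e_gt0 : 0 < e0 / 2 by rewrite divr_gt0.
have /H pU : - e0 < e0 / 2 < e0 by apply/andP; split; lra.
have cb : continuous (flat_bump rho : V -> R) by have [c0 _] := @flat_bump_Cinfty R n rho setT 0; move=> x; exact: c0.
have [|_ sm] := @psh_submean R n U (fun x => phi x + e0 / 2 * flat_bump rho x) oU _ pU 0 U0.
  move=> x Ux; apply: (@continuous_atD _ V R phi (fun x => e0 / 2 * flat_bump rho x)); first exact: cphi.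
  exact: (@continuous_atZ _ V R (e0 / 2) (flat_bump rho) x (cb x)).
pose v : V := delta_mx 0 k.
have sv : sqn v = 1.
  rewrite /sqn (bigD1 k)//= big1 => [|j jk].
    by rewrite !mxE !eqxx mulr1n normc1 expr1n addr0.
  by rewrite !mxE (negbTE jk) andbF normc0 expr0n.
have : \forall r \near (0 : R)^'+, False; last first.
  by move=> /filter_ex [].
near=> r.
have r0 : 0 < r by near: r; exact: nbhs_right_gt.
have rr : r ^+ 2 < rho.
  rewrite -[r ^+ 2]mulr1; near: r; exact: near_quadratic_lt ler01 rho0.
have := @flat_decreasing R rho 0 (r ^+ 2); rewrite lexx exprn_gt0// => /(_ isT rr).
have : phi 0 + e0 / 2 * flat_bump rho (0 : V) <= cmean (fun x => phi x + e0 / 2 * flat_bump rho x) 0 v r.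
  by near: r; exact: sm.
have sE t : sqn (0 + (r%:C * cis t) *: v) = r ^+ 2.
  rewrite add0r -[RHS]mulr1 -sv /sqn mulr_sumr; apply: eq_bigr => j _.
  by rewrite !mxE !normcM normc_cis mulr1 normc_real ger0_norm ?ltW// exprMn.
rewrite /cmean (_ : (fun t => _) = fun=> c + e0 / 2 * flat 0 (rho - r ^+ 2)); last first.
  apply/funext => t; have xr : sqn (0 + (r%:C * cis t) *: v) <= rho by rewrite sE ltW.
  by rewrite (rP _ xr).1 /flat_bump sE.
have p0 : phi 0 = c by apply: (rP 0 _).1; rewrite sqn0 ltW.
rewrite pmean_cst p0 /flat_bump sqn0 lerD2l ler_pM2l// => h.
by rewrite ltNge h.
Unshelve. all: by end_near. Qed.

End Core.

Theorem theorem2 (R : realType) (n : nat) (hn : (2 <= n)%N) :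
  exists Omega omega : set (Cspace R n),
    [/\ domain Omega, pseudoconvex Omega &
        [/\ omega !=set0, open omega & omega `<=` Omega]] /\
    [/\ exists phi : Cspace R n -> R,
          [/\ pshk 0 Omega phi,
              forall z, Omega z -> phi z < 0 &
              strictly_psh omega (fun z => (phi z)%:E)],
        forall phi : Cspace R n -> R, pshk 1 Omega phi ->
          (forall z, Omega z -> phi z < 0) ->
          exists c : R, forall z, omega z -> phi z = c &
        core 0 Omega <> core 1 Omega].
Proof.
pose i0 := Ordinal (ltnW hn); pose i1 := Ordinal hn.
have i01 : i0 != i1 by [].
pose Om : set (Cspace R n) := domain_component i0 i1.
have bO : @core_ball R n `<=` Om := core_ball_sub i01.
have b_lt z : Om z -> barrier i0 i1 z - (expR 4 + 1) < 0.
  by move=> Oz; have := barrier_le Oz; lra.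
exists Om, core_ball; split; first split.
- split; [|exact: open_domain|exact: domain_connected].
  by exists (base_point i0 i1 0); exact: domain_base.
- exact: domain_pseudoconvex.
- split => //; last exact: core_ball_open.
  by exists 0; exact: core_ball0.
split.
- exists (fun z => barrier i0 i1 z - (expR 4 + 1)); split => //.
    exact: barrier_pshk.
  exact: barrier_strictly_psh.
- move=> phi pphi phi0; exists (phi (base_point i0 i1 0)) => z; apply: constant_core => //.
  by move=> x Ox; exact/ltW/phi0.
(* The origin separates the cores: the function of assertion (1) excludes it from [core 0], and
   rigidity near 0 places it in [core 1]. *)
move=> cE; suff : core 0 Om 0.
  move=> [_ /(_ _ (@barrier_pshk R n i0 i1))]; apply.
    by exists 0 => x Ox; exact/ltW/b_lt.
  exists core_ball; split; [exact: core_ball_open|exact: core_ball0|exact: bO|].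
  exact: barrier_strictly_psh.
rewrite cE; split; first exact/bO/core_ball0.
move=> phi pphi [M phiM] [U [oU U0 UO sU]].
apply: (@constant_not_strictly_psh R n U phi (phi (base_point i0 i1 0)) i0) sU => //.
- by move=> x /UO Ox; case: pphi => _ [+ _]; exact.
- have := @core_ball_open R n; rewrite openE => /(_ 0 (@core_ball0 R n)).
  by apply: filterS => x; exact: (constant_core i01 pphi phiM).
Qed.
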